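(* Let $\{\mathbf X_t(\cdot)\}_{t\in\mathbb Z}$ ($p$-dimensional, on $\mathcal U$) and $\{\mathbf Y_t(\cdot)\}_{t\in\mathbb Z}$ ($d$-dimensional, on $\mathcal V$) be mean-zero, jointly weakly stationary sub-Gaussian functional linear processes. Assume: (i) the spectral density matrix operators $\boldsymbol f^X_\theta$, $\boldsymbol f^Y_\theta$, $\theta\in[-\pi,\pi]$, exist and $\mathcal M^X<\infty$, $\mathcal M^Y<\infty$; (ii) $\boldsymbol f^{X,Y}_\theta$, $\theta\in[-\pi,\pi]$, exists and $\mathcal M^{X,Y}<\infty$; (iii) the coefficient kernels of each of the two processes satisfy $\sum_{l=0}^\infty\|\mathbf A_l\|_\infty=O(1)$; (iv) for the errors of each of the two processes, the marginal covariance functions $\Sigma^{\varepsilon}_{0,jj}$ are continuous and uniformly bounded over $j$, and $\omega_0^\varepsilon=\max_j\int\Sigma^\varepsilon_{0,jj}(u,u)\,du=O(1)$. Let $h\ge 0$ be a fixed integer. Then for any given $\boldsymbol\Phi_1\in\mathbb H_0^p$ and $\boldsymbol\Phi_2\in\mathbb H_0^d$ with $\|\boldsymbol\Phi_1\|_0\le k_1$, $\|\boldsymbol\Phi_2\|_0\le k_2$ ($k_1\in\{1,\dots,p\}$, $k_2\in\{1,\dots,d\}$), there exist constants $c,c_1,c_2>0$ such that for every $\eta>0$, $$P\left\{\left|\frac{\langle\boldsymbol\Phi_1,(\widehat{\boldsymbol\Sigma}_0^X-\boldsymbol\Sigma_0^X)(\boldsymbol\Phi_1)\rangle}{\langle\boldsymbol\Phi_1,\boldsymbol\Sigma_0^X(\boldsymbol\Phi_1)\rangle}\right|>\mathcal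 M_{k_1}^X\eta\right\}\le 2\exp\{-cn\min(\eta^2,\eta)\}$$ and $$P\left\{\left|\frac{\langle\boldsymbol\Phi_1,(\widehat{\boldsymbol\Sigma}_h^{X,Y}-\boldsymbol\Sigma_h^{X,Y})(\boldsymbol\Phi_2)\rangle}{\langle\boldsymbol\Phi_1,\boldsymbol\Sigma_0^X(\boldsymbol\Phi_1)\rangle+\langle\boldsymbol\Phi_2,\boldsymbol\Sigma_0^Y(\boldsymbol\Phi_2)\rangle}\right|>\left(\mathcal M_{k_1}^X+\mathcal M_{k_2}^Y+\mathcal M_{k_1,k_2}^{X,Y}\right)\eta\right\}\le c_1\exp\{-c_2n\min(\eta^2,\eta)\}.$$
   Context: Function spaces. $\mathcal U,\mathcal V$ are compact intervals; $\langle f,g\rangle=\int fg$ and $\|f\|=\langle f,f\rangle^{1/2}$ in $L_2$. $\mathbb H$ is a Hilbert space contained in $L_2(\mathcal U)$ (or $L_2(\mathcal V)$ for functions on $\mathcal V$), $\mathbb S=\mathbb H\otimes\mathbb H$ the corresponding kernels, $\mathbb H^p$ the $p$-fold product with $\langle\boldsymbol f,\boldsymbol g\rangle=\sum_i\langle f_i,g_i\rangle$; $\|\boldsymbol f\|_0=\#\{i:\|f_i\|\ne0\}$. A kernel matrix $\mathbf K=(K_{ij})_{q\times p}$ also denotes the operator $\mathbf K(\boldsymbol f)(u)=(\sum_j\int K_{ij}(u,v)f_j(v)dv)_{i\le q}$. $\|K\|_{\mathcal S}=(\iint K^2)^{1/2}$ and $\|\mathbf K\|_\infty=\max_i\sum_j\|K_{ij}\|_{\mathcal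 S}$. Second-order quantities. $\boldsymbol\Sigma_h^X(u,v)=\mathrm{Cov}\{\mathbf X_t(u),\mathbf X_{t+h}(v)\}$, similarly $\boldsymbol\Sigma_h^Y$; $\boldsymbol\Sigma_h^{X,Y}(u,v)=\mathrm{Cov}\{\mathbf X_t(u),\mathbf Y_{t+h}(v)\}$. $\boldsymbol f_\theta^X=\frac1{2\pi}\sum_{h\in\mathbb Z}\boldsymbol\Sigma_h^Xe^{-ih\theta}$, and $\boldsymbol f_\theta^Y$, $\boldsymbol f_\theta^{X,Y}$ similarly. $\mathbb H_0^p=\{\boldsymbol\Phi\in\mathbb H^p:\langle\boldsymbol\Phi,\boldsymbol\Sigma_0^X(\boldsymbol\Phi)\rangle\in(0,\infty)\}$, $\mathbb H_0^d=\{\boldsymbol\Phi\in\mathbb H^d:\langle\boldsymbol\Phi,\boldsymbol\Sigma_0^Y(\boldsymbol\Phi)\rangle\in(0,\infty)\}$. Stability measures: $\mathcal M^X=2\pi\,\mathrm{ess\,sup}_{\theta\in[-\pi,\pi],\boldsymbol\Phi\in\mathbb H_0^p}\frac{\langle\boldsymbol\Phi,\boldsymbol f_\theta^X(\boldsymbol\Phi)\rangle}{\langle\boldsymbol\Phi,\boldsymbol\Sigma_0^X(\boldsymbol\Phi)\rangle}$; $\mathcal M_k^X$ is the same with the restriction $\|\boldsymbol\Phi\|_0\le k$; $\mathcal M^Y,\mathcal M^Y_k$ analogously. $\mathcal M^{X,Y}=2\pi\,\mathrm{ess\,sup}_{\theta,\boldsymbol\Phi_1\in\mathbb H_0^p,\boldsymbol\Phi_2\in\mathbb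 H_0^d}\frac{|\langle\boldsymbol\Phi_1,\boldsymbol f_\theta^{X,Y}(\boldsymbol\Phi_2)\rangle|}{\sqrt{\langle\boldsymbol\Phi_1,\boldsymbol\Sigma_0^X(\boldsymbol\Phi_1)\rangle}\sqrt{\langle\boldsymbol\Phi_2,\boldsymbol\Sigma_0^Y(\boldsymbol\Phi_2)\rangle}}$; $\mathcal M_{k_1,k_2}^{X,Y}$ is the same with $\|\boldsymbol\Phi_1\|_0\le k_1$, $\|\boldsymbol\Phi_2\|_0\le k_2$. Sub-Gaussian functional linear process. A mean-zero random element $X$ of $\mathbb H$ with covariance operator $\Sigma_0$ is a sub-Gaussian process if there is $\alpha\ge0$ with $\mathbb E e^{\langle x,X\rangle}\le e^{\alpha^2\langle x,\Sigma_0(x)\rangle/2}$ for all $x\in\mathbb H$. A $p$-dimensional sub-Gaussian functional linear process is $\mathbf X_t=\sum_{l=0}^\infty\mathbf A_l(\boldsymbol\varepsilon_{t-l})$, where $\mathbf A_l=(A_{l,jk})_{p\times p}$, $A_{l,jk}\in\mathbb S$, and $\boldsymbol\varepsilon_t=(\varepsilon_{t1},\dots,\varepsilon_{tp})^T\in\mathbb H^p$ are i.i.d. over $t$ with components that are independent mean-zero sub-Gaussian processes; $\Sigma_{0,jj}^\varepsilon(u,v)=\mathrm{Cov}\{\varepsilon_{tj}(u),\varepsilon_{tj}(v)\}$. Estimators from observations $t=1,\dots,n$: $\widehat{\boldsymbol\Sigma}_h^X(u,v)=\frac1{n-h}\sum_{t=1}^{n-h}\mathbf X_t(u)\mathbf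 X_{t+h}(v)^T$, $\widehat{\boldsymbol\Sigma}_h^{X,Y}(u,v)=\frac1{n-h}\sum_{t=1}^{n-h}\mathbf X_t(u)\mathbf Y_{t+h}(v)^T$. Convention: $p,d$ may vary with $n$; constants do not depend on $n,p,d,k_1,k_2,\eta$ (they may depend on $h$, the sub-Gaussian parameters and the bounds in the $O(1)$ assumptions).
   Formalization: ''Jointly'' is made precise by also assuming that the pairs of errors of the X- and Y-processes at time t are independent over t; without this the second bound fails (X_t i.i.d. Rademacher times a constant function, Y_t = S X_t with S an independent random sign). *)

(* Defs.v *)
From HB Require Import structures.
From mathcomp Require Import all_boot all_order all_algebra.
From mathcomp Require Import all_classical all_reals all_analysis.
From mathcomp Require Import ess_sup_inf complex.
Set Implicit Arguments.
Unset Strict Implicit.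
Unset Printing Implicit Defensive.
Import Order.TTheory GRing.Theory Num.Theory.
Import numFieldNormedType.Exports.

Local Open Scope classical_set_scope.
Local Open Scope ring_scope.

Local Notation leb := (@lebesgue_measure _).
Local Notation leb2 := (leb \x leb)%E.

(* Elements of L_2(D) are represented by functions R -> R of which only the
   restriction to D matters; D is always a compact interval below.  Vectors of
   functions are indexed by ['I_p], kernel matrices by ['I_q] and ['I_p]. *)
Notation fvec R p := ('I_p -> R -> R).
Notation kmat R q p := ('I_q -> 'I_p -> R -> R -> R).
Notation ckmat R q p := ('I_q -> 'I_p -> R -> R -> R[i]).

Section function_spaces.
Context {R : realType}.
Implicit Types (D : set R) (f g : R -> R) (H : set (R -> R)).

Definition L2 D : set (R -> R) :=
  [set f : R -> R | measurable_fun D f /\ leb.-integrable D (fun x : R => (f x ^+ 2)%:E)].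

Definition inner D f g : R := Rintegral leb D (fun x : R => f x * g x).

Definition norm2 D f : R := Num.sqrt (inner D f f).

(* H is a Hilbert space contained in L_2(D): a linear subspace that is complete
   for the L_2 inner product.  Saturation under a.e. equality expresses that
   its elements are classes of functions. *)
Definition hilbert_in_L2 D H : Prop :=
  [/\ H `<=` L2 D,
      H (cst 0) /\ (forall (a : R) f g, H f -> H g -> H (fun x => a * f x + g x)),
      (forall f g, H f -> measurable_fun D g ->
         {ae leb, forall x : R, D x -> f x = g x} -> H g) &
      (forall F : nat -> R -> R, (forall n, H (F n)) ->
         (forall e : R, 0 < e -> exists N : nat, forall m n : nat,
            (N <= m)%N -> (N <= n)%N -> norm2 D (fun x => F m x - F n x) < e) ->
         exists2 f, H f & (fun n => norm2 D (fun x => F n x - f x)) @ \oo --> (0 : R))].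

Definition L2ker D1 D2 : set (R -> R -> R) :=
  [set K : R -> R -> R | measurable_fun (D1 `*` D2) (fun z : R * R => K z.1 z.2) /\
           leb2.-integrable (D1 `*` D2) (fun z : R * R => (K z.1 z.2 ^+ 2)%:E)].

Definition hsnorm D1 D2 (K : R -> R -> R) : R :=
  Num.sqrt (\int[leb2]_(z in D1 `*` D2) (K z.1 z.2 ^+ 2)).

(* The Hilbert tensor product of H with itself: the closure in L_2(D x D) of
   the finite sums of kernels f(u) g(v) with f, g in H. *)
Definition tensorH D H : set (R -> R -> R) :=
  [set K : R -> R -> R | L2ker D D K /\
     forall e : R, 0 < e -> exists (m : nat) (f g : 'I_m -> R -> R),
       [/\ forall i, H (f i), forall i, H (g i) &
           hsnorm D D (fun u v => K u v - \sum_(i < m) f i u * g i v) < e]].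

Definition vecH H p : set (fvec R p) := [set f | forall i, H (f i)].

Definition vinner D p (f g : fvec R p) : R := \sum_(i < p) inner D (f i) (g i).

Definition vdist D p (f g : fvec R p) : R :=
  let fg : fvec R p := fun i x => f i x - g i x in Num.sqrt (vinner D fg fg).

Definition l0norm D p (f : fvec R p) : nat := #|[set i | norm2 D (f i) != 0]%SET|.

(* Operator of a q x p kernel matrix; D is the domain of its second variable. *)
Definition kop D q p (K : kmat R q p) (f : fvec R p) : fvec R q :=
  fun i u => \sum_(j < p) \int[leb]_(v in D) (K i j u v * f j v).

(* The bilinear form < f, K(g) >. *)
Definition kform D1 D2 q p (f : fvec R q) (K : kmat R q p) (g : fvec R p) : R :=
  vinner D1 f (kop D2 K g).

Definition ckform D1 D2 q p (f : fvec R q) (K : ckmat R q p) (g : fvec R p) : R[i] :=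
  (kform D1 D2 f (fun i j u v => complex.Re (K i j u v)) g
    +i* kform D1 D2 f (fun i j u v => complex.Im (K i j u v)) g)%C.

Definition knorm_oo D q p (K : kmat R q p) : R :=
  \big[Num.max/0]_(i < q) \sum_(j < p) hsnorm D D (K i j).

End function_spaces.

Section random_elements.
Context {d : measure_display} {T : measurableType d} {R : realType}.
Variable P : probability T R.
Implicit Types (D : set R) (H : set (R -> R)).

(* Square-integrable random element of H, in a jointly measurable version, so
   that its values X(u) at the points u of D are random variables. *)
Definition random_element D H (X : T -> R -> R) : Prop :=
  [/\ measurable_fun (setT `*` D) (fun z : T * R => X z.1 z.2),
      (forall w, H (X w)) &
      ('E_P[fun w => inner D (X w) (X w)] < +oo)%E].

Definition mean_zero D (X : T -> R -> R) : Prop :=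
  {ae leb, forall u : R, D u -> ('E_P[fun w => X w u] = 0)%E}.

Definition covker (X Y : T -> R -> R) : R -> R -> R :=
  fun u v => fine (covariance P (fun w => X w u) (fun w => Y w v)).

Definition covmat q p (X : T -> fvec R q) (Y : T -> fvec R p) : kmat R q p :=
  fun i j => covker (fun w => X w i) (fun w => Y w j).

Definition subgaussian D H (alpha : R) (X : T -> R -> R) : Prop :=
  [/\ random_element D H X, mean_zero D X &
      forall x : R -> R, H x ->
        ('E_P[fun w => expR (inner D x (X w))] <=
         (expR (alpha ^+ 2 *
            inner D x (fun u => \int[leb]_(v in D) (covker X X u v * x v)) / 2))%:E)%E].

(* Borel sigma-algebra of a set S for a (pseudo)distance. *)
Definition borel_sets (E : Type) (S : set E) (dist : E -> E -> R) : set (set E) :=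
  <<s S, [set O | O `<=` S /\
     forall x, O x -> exists2 r : R, 0 < r & forall y, S y -> dist x y < r -> O y] >>.

Definition independent (I : eqType) (E : Type) (B : set (set E)) (X : I -> T -> E) : Prop :=
  forall (s : seq I) (A : I -> set E), uniq s -> (forall i, i \in s -> B (A i)) ->
    P (\bigcap_(i in [set` s]) (X i @^-1` A i)) =
      (\prod_(i <- s) fine (P (X i @^-1` A i)))%:E.

Definition identically_distributed (I E : Type) (B : set (set E)) (X : I -> T -> E) : Prop :=
  forall i j (A : set E), B A -> P (X i @^-1` A) = P (X j @^-1` A).

Definition borelH D H : set (set (R -> R)) :=
  borel_sets H (fun f g => norm2 D (fun x => f x - g x)).

Definition borelHp D H p : set (set (fvec R p)) := borel_sets (@vecH R H p) (@vdist R D p).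

Definition borelH2 D1 H1 p D2 H2 q : set (set (fvec R p * fvec R q)) :=
  borel_sets [set z | vecH H1 z.1 /\ vecH H2 z.2]
    (fun y z => Num.max (vdist D1 y.1 z.1) (vdist D2 y.2 z.2)).

(* X_t = sum_(l >= 0) A_l (e_(t-l)), the series converging in H^p almost surely;
   alpha is a common sub-Gaussian parameter of the p error components. *)
Definition subgaussian_linear_process D H (alpha : R) p
    (A : nat -> kmat R p p) (e X : int -> T -> fvec R p) : Prop :=
  [/\ forall l j k, tensorH D H (A l j k),
      independent (@borelHp D H p) e /\ identically_distributed (@borelHp D H p) e,
      forall t, independent (borelH D H) (fun (j : 'I_p) w => e t w j),
      forall t j, subgaussian D H alpha (fun w => e t w j) &
      forall t, (forall j, random_element D H (fun w => X t w j)) /\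
        {ae P, forall w,
          (fun N => vdist D (X t w)
             (fun i u => \sum_(l < N) kop D (A l) (e (t - l%:Z) w) i u)) @ \oo --> (0 : R)}].

Definition cov_stationary D1 D2 q p (X : int -> T -> fvec R q) (Y : int -> T -> fvec R p) : Prop :=
  forall (t h : int) i j,
    {ae leb2, forall z : R * R, (D1 `*` D2) z ->
       covmat (X t) (Y (t + h)) i j z.1 z.2 = covmat (X 0) (Y h) i j z.1 z.2}.

Definition mean_zero_jointly_stationary D1 D2 q p
    (X : int -> T -> fvec R q) (Y : int -> T -> fvec R p) : Prop :=
  [/\ forall t i, mean_zero D1 (fun w => X t w i),
      forall t j, mean_zero D2 (fun w => Y t w j),
      cov_stationary D1 D1 X X, cov_stationary D2 D2 Y Y & cov_stationary D1 D2 X Y].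

(* Base time 0: independence of the base time is cov_stationary. *)
Definition Sigma q p (X : int -> T -> fvec R q) (Y : int -> T -> fvec R p) (h : int) : kmat R q p :=
  covmat (X 0) (Y h).

Definition hatSigma q p (X : int -> T -> fvec R q) (Y : int -> T -> fvec R p)
    (n h : nat) (w : T) : kmat R q p :=
  fun i j u v => (n - h)%:R^-1 *
    \sum_(1 <= t < (n - h).+1) X t%:Z w i u * Y (t + h)%:Z w j v.

Definition error_condition D p (e : int -> T -> fvec R p) (omega : R) : Prop :=
  let S (j : 'I_p) := covmat (e 0) (e 0) j j in
  [/\ forall j u, D u -> ('E_P[(fun w => (e 0 w j u) ^+ 2)%R] < +oo)%E,
      forall j, {within D `*` D, continuous (fun z : R * R => S j z.1 z.2)},
      exists C : R, forall j u v, D u -> D v -> `|S j u v| <= C &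
      \big[Num.max/0]_(j < p) \int[leb]_(u in D) S j u u <= omega].

End random_elements.

Section spectral.
Context {R : realType}.
Implicit Types (D : set R) (H : set (R -> R)).

Definition cexpi (x : R) : R[i] := (cos x +i* sin x)%C.

Definition spectral_partial_sum q p (S : int -> kmat R q p) (theta : R) (N : nat) : ckmat R q p :=
  fun i j u v => ((2 * pi)^-1)%:C%C *
    \sum_(0 <= m < N.*2.+1) let h : int := m%:Z - N%:Z in
       (S h i j u v)%:C%C * cexpi (- (h%:~R * theta)).

(* f = (2 pi)^-1 sum_(h in Z) S_h e^(- i h theta), in the Hilbert-Schmidt norm. *)
Definition is_spectral_density D1 D2 q p (S : int -> kmat R q p) (theta : R)
    (f : ckmat R q p) : Prop :=
  forall i j,
    [/\ L2ker D1 D2 (fun u v => complex.Re (f i j u v)),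
        L2ker D1 D2 (fun u v => complex.Im (f i j u v)) &
        (fun N => hsnorm D1 D2 (fun u v =>
           Normc.normc (spectral_partial_sum S theta N i j u v - f i j u v))) @ \oo --> (0 : R)].

Definition H0 D H p (S0 : kmat R p p) : set (fvec R p) :=
  [set Phi | vecH H Phi /\ 0 < kform D D Phi S0 Phi].

Definition H0k D H p (S0 : kmat R p p) (k : nat) : set (fvec R p) :=
  H0 D H S0 `&` [set Phi | (l0norm D Phi <= k)%N].

(* Essential supremum over theta in [-pi, pi] (Lebesgue measure) of a function
   of theta; no measure is involved in the suprema over Phi below. *)
Definition ess_sup_pi (g : R -> \bar R) : \bar R :=
  ess_sup (mrestr leb (measurable_itv `[- pi, pi]%R)) g.

(* M^X for A = H0, M^X_k for A = H0k.  The quadratic form of f_theta is real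
   because S_(-h) is the adjoint of S_h, whence the real part. *)
Definition stability D p (S0 : kmat R p p) (f : R -> ckmat R p p) (A : set (fvec R p)) : \bar R :=
  ((2 * pi)%:E * ess_sup_pi (fun theta => ereal_sup
     [set (complex.Re (ckform D D Phi (f theta) Phi) / kform D D Phi S0 Phi)%:E | Phi in A]))%E.

Definition cross_stability D1 D2 p d (SX : kmat R p p) (SY : kmat R d d)
    (f : R -> ckmat R p d) (A1 : set (fvec R p)) (A2 : set (fvec R d)) : \bar R :=
  ((2 * pi)%:E * ess_sup_pi (fun theta => ereal_sup
     [set (Normc.normc (ckform D1 D2 z.1 (f theta) z.2) /
           (Num.sqrt (kform D1 D1 z.1 SX z.1) * Num.sqrt (kform D2 D2 z.2 SY z.2)))%:E
       | z in A1 `*` A2]))%E.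

End spectral.

(* Main.v *)
Require Import Defs.
From mathcomp Require Import all_boot all_order all_algebra.
From mathcomp Require Import all_classical all_reals all_analysis.
From mathcomp Require Import ess_sup_inf complex measurable_realfun.
From mathcomp Require Import ring lra zify.
Set Implicit Arguments.
Unset Strict Implicit.
Unset Printing Implicit Defensive.
Import Order.TTheory GRing.Theory Num.Theory.
Import numFieldNormedType.Exports.

Local Open Scope classical_set_scope.
Local Open Scope ring_scope.

(* The functionals x_t = <Phi_1, X_t> and y_t = <Phi_2, Y_t> are scalar linear
   processes in the errors, and everything reduces to the quadratic form
   S = sum_t (x_t + a y_(t+h))^2: the case a = 0 gives the first bound, and
   polarization over a = 1, -1 gives the second.  S is a limit of squared norms
   of sums of independent blocks indexed by the error time.  A Hanson-Wright
   bound on its moment generating function follows by decoupling (averaging over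
   all splittings of the blocks into two halves) and by linearizing the decoupled
   form with a Gaussian integral; it only involves the norms of the
   autocovariance Toeplitz forms of x and y.  These are bounded by the stability
   measures: the autocovariances gamma of x are the Fourier coefficients of
   <Phi_1, f_theta(Phi_1)>, so that sum u_s u_t gamma(t - s) is the integral of
   |sum_t u_t e^(i t theta)|^2 against a function that is a.e. at most
   M <Phi_1, Sigma_0(Phi_1)> / (2 pi).  Markov's inequality concludes. *)

(** Three obstacles shape the details. The errors of the two processes at one time may depend on
    each other, and only their pairs at distinct times are independent. Hence the blocks, inside
    which dependence is arbitrary, and hence the factor 4 in front of the sub-Gaussian parameter:
    the two contributions are separated by [expR_average], which doubles the exponents and so
    multiplies the variances by 4. The series defining the processes are infinite, so the moment
    generating function is bounded for finitely many blocks with constants free of the truncation,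
    and Fatou's lemma passes to the limit. Finally, the independence hypothesis speaks of Borel sets
    of a distance on H^p and reaches real random variables only through continuous functionals,
    while the sub-Gaussian bound covers only directions in H. The adjoints of the coefficient
    kernels must therefore be shown to lie in H, which uses that the kernels are limits of finite
    sums of tensors and that H is complete. *)

(** * Independence of two finite families of random variables *)

Section independence.
Context d (T : measurableType d) (R : realType) (P : probability T R).

(** A pi-system generating the sigma-algebra of the family. Open sets are used rather than Borel
    ones, since the independence of the errors will be tested on preimages of open sets under
    continuous functionals. *)
Definition open_rectangles (I : Type) (f : I -> T -> R) : set (set T) :=
  [set A | exists2 O : I -> set R, (forall i, open (O i)) &
           A = \bigcap_i (f i @^-1` O i)].

Definition families_independent (I J : Type) (f : I -> T -> R) (g : J -> T -> R) :=
  forall (O : I -> set R) (O' : J -> set R),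
    (forall i, open (O i)) -> (forall j, open (O' j)) ->
    (P ((\bigcap_i (f i @^-1` O i)) `&` (\bigcap_j (g j @^-1` O' j))) =
     P (\bigcap_i (f i @^-1` O i)) * P (\bigcap_j (g j @^-1` O' j)))%E.

Lemma open_rectangles_setI I (f : I -> T -> R) : setI_closed (open_rectangles f).
Proof.
move=> _ _ [U oU ->] [V oV ->]; exists (fun i => U i `&` V i).
  by move=> i; exact: openI.
by rewrite -bigcapI; apply: eq_bigcapr => i _; rewrite preimage_setI.
Qed.

Lemma open_rectanglesT I (f : I -> T -> R) : open_rectangles f setT.
Proof.
exists (fun=> setT); first by move=> _; exact: openT.
by apply/esym; rewrite -subTset => w _ i _.
Qed.

Lemma open_rectangles_measurable (I : finType) (f : I -> T -> R) :
  (forall i, measurable_fun setT (f i)) -> open_rectangles f `<=` measurable.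
Proof.
move=> mf _ [U oU ->]; apply: fin_bigcap_measurable; first exact: finite_finset.
move=> i _.
by rewrite -[X in measurable X]setTI; apply: mf => //; exact: open_measurable.
Qed.

Local Notation sigT f := (g_sigma_algebraType (open_rectangles f)).

Lemma measurable_fun_open_rectangles (I : choiceType) (f : I -> T -> R) (i : I) :
  measurable_fun setT (f i : sigT f -> R).
Proof.
apply: (measurability _ (RGenOpens.measurableE R)).
move=> _ [_ [a [b ->]] <-]; rewrite setTI; apply: sub_sigma_algebra.
exists (fun j => if j == i then `]a, b[%classic else setT).
  by move=> j; case: ifP => _; [exact: interval_open|exact: openT].
apply/seteqP; split => [w fw j _ /=|w /(_ i Logic.I)/=]; last by rewrite eqxx.
by case: eqP => // ->.
Qed.

Lemma sigma_rectangles_measurable (I : finType) (f : I -> T -> R) :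
  (forall i, measurable_fun setT (f i)) ->
  <<s open_rectangles f >> `<=` (measurable : set (set T)).
Proof.
move=> mf; apply: smallest_sub; first exact: sigma_algebra_measurable.
exact: open_rectangles_measurable.
Qed.

Lemma measurable_fun_id_rectangles (I : finType) (f : I -> T -> R) :
  (forall i, measurable_fun setT (f i)) ->
  measurable_fun setT (idfun : T -> sigT f).
Proof.
move=> mf _ A mA; rewrite setTI; exact: (sigma_rectangles_measurable mf).
Qed.

(** Uniqueness of measures on a pi-system, applied twice: for fixed [B], the probability of the
    intersection with [B] and the product with [P B] are finite measures in [A] that agree on
    rectangles; then the roles are exchanged. *)
Lemma families_independent_sigma (I J : finType) (f : I -> T -> R) (g : J -> T -> R) :
  (forall i, measurable_fun setT (f i)) -> (forall j, measurable_fun setT (g j)) ->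
  families_independent f g ->
  forall A B, <<s open_rectangles f >> A -> <<s open_rectangles g >> B ->
  P (A `&` B) = (P A * P B)%E.
Proof.
move=> mf mg ind.
have key (G : set (set T)) (B : set T) : measurable B -> G `<=` measurable -> setI_closed G -> G setT ->
    (forall A, G A -> P (A `&` B) = (P A * P B)%E) ->
    forall A, <<s G >> A -> P (A `&` B) = (P A * P B)%E.
  move=> mB Gm GI GT h A sA.
  have PB0 : (0 <= fine (P B)) by rewrite fine_ge0.
  pose m1 : {measure set T -> \bar R} := mrestr P mB.
  pose m2 : {measure set T -> \bar R} := mscale (NngNum PB0) P.
  have m2E X : m2 X = (P X * P B)%E.
    by rewrite /m2/= /mscale/= fineK ?fin_num_measure// muleC.
  suff : m1 A = m2 A by rewrite m2E.
  apply: (g_sigma_algebra_measure_unique G Gm (fun=> setT)) => //.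
  - by rewrite bigcup_const.
  - by move=> X GX; rewrite m2E; exact: h.
  - by move=> _; rewrite /m1/= /mrestr setTI (le_lt_trans (probability_le1 P mB))// ltry.
move=> A B sA sB.
apply: (key (open_rectangles f)) => //.
- exact: (sigma_rectangles_measurable mg).
- exact: open_rectangles_measurable.
- exact: open_rectangles_setI.
- exact: open_rectanglesT.
- move=> A' GA'; rewrite setIC muleC.
  apply: (key (open_rectangles g)) => //.
  + exact: open_rectangles_measurable.
  + exact: open_rectangles_measurable.
  + exact: open_rectangles_setI.
  + exact: open_rectanglesT.
  + move=> B' GB'; case: GA' => U oU ->; case: GB' => V oV ->.
    by rewrite setIC muleC; exact: ind.
Qed.

(* Tonelli's theorem for the joint law of two independent families, expressed on
   T * T with the sigma-algebras the families generate. *)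
Lemma indep_tonelli (I J : finType) (f : I -> T -> R) (g : J -> T -> R)
    (F : T * T -> \bar R) :
  (forall i, measurable_fun setT (f i)) -> (forall j, measurable_fun setT (g j)) ->
  families_independent f g ->
  measurable_fun setT (F : sigT f * sigT g -> \bar R) -> (forall z, 0 <= F z)%E ->
  (\int[P]_w F (w, w) = \int[P]_w \int[P]_w' F (w, w'))%E.
Proof.
move=> mf mg ind mF F0.
have mi1 := measurable_fun_id_rectangles mf.
have mi2 := measurable_fun_id_rectangles mg.
pose X1 : {mfun T >-> sigT f} := mfun_Sub (mem_set mi1).
pose X2 : {mfun T >-> sigT g} := mfun_Sub (mem_set mi2).
have mX12 : measurable_fun setT ((fun w => (w, w)) : T -> (sigT f * sigT g)%type).
  exact/measurable_fun_pair.
pose X12 : {mfun T >-> (sigT f * sigT g)%type} := mfun_Sub (mem_set mX12).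
have -> : (\int[P]_w F (w, w) = \int[distribution P X12]_z F z)%E.
  by rewrite ge0_integral_distribution.
(* Independence enters here: the law of the diagonal map is the product of its marginals, as seen on
   measurable rectangles. *)
rewrite (eq_measure_integral (distribution P X1 \x distribution P X2)%E); last first.
  move=> A mA _; apply/esym/product_measure_unique => // B C mB mC.
  exact: (families_independent_sigma mf mg ind).
rewrite (fubini_tonelli1 _ mF) // ge0_integral_distribution//; last 2 first.
- exact: (measurable_fun_fubini_tonelli_F _ mF).
- by move=> y; apply: integral_ge0.
apply: eq_integral => w _ /=; rewrite /fubini_F ge0_integral_distribution//.
by apply: measurableT_comp => //; exact: measurable_fun_pair.
Qed.
End independence.

(** * Independent blocks of random variables *)

Section independent_blocks.
Context d (T : measurableType d) (R : realType) (P : probability T R).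
Context (B C : finType).
Implicit Types (xi : B -> C -> T -> R) (O : B -> C -> set R).

Definition rectangle xi O (b : B) : set T := \bigcap_c (xi b c @^-1` O b c).

(** Dependence inside a block is arbitrary. One formula over all of [B] suffices, since taking
    [O b c] equal to [setT] for all [c] removes the block [b]. *)
Definition blocks_independent xi := forall O, (forall b c, open (O b c)) ->
  P (\bigcap_b rectangle xi O b) = (\prod_b fine (P (rectangle xi O b)))%:E.

(** Indexing by a sigma type makes the blocks in [A] a family of their own, with its own generated
    sigma-algebra. *)
Definition subfamily xi (A : pred B) (i : {x : B * C | A x.1}) : T -> R :=
  xi (val i).1 (val i).2.

Variable xi : B -> C -> T -> R.
Hypothesis mxi : forall b c, measurable_fun setT (xi b c).
Hypothesis ixi : blocks_independent xi.

(** Open sets prescribed on some blocks are extended by [setT] to the others, whose rectangles then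
    have probability 1. Since the two parts are disjoint, each factor of the product formula comes
    from one side only. *)
Lemma subfamily_independent (A1 A2 : pred B) : (forall b, A1 b -> A2 b -> False) ->
  families_independent P (subfamily xi (A := A1)) (subfamily xi (A := A2)).
Proof.
move=> A12 O1 O2 oO1 oO2.
pose ext (A : pred B) (O : {x : B * C | A x.1} -> set R) b c : set R :=
  oapp O setT (insub (b, c)).
have oext (A : pred B) (O : {x : B * C | A x.1} -> set R) b c : (forall i, open (O i)) -> open (ext A O b c).
  by rewrite /ext => oO; case: insub => [i|] /=; [exact: oO|exact: openT].
have extE (A : pred B) (O : {x : B * C | A x.1} -> set R) : \bigcap_i (subfamily xi (A := A) i @^-1` O i) =
    \bigcap_b rectangle xi (ext A O) b.
  apply/seteqP; split=> w Hw.
    move=> b _ c _; rewrite /ext /=; case: insubP => //= i _ Ei.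
    by have := Hw i Logic.I; rewrite /= /subfamily/= Ei.
  move=> i _; have := Hw (val i).1 Logic.I (val i).2 Logic.I.
  by rewrite /ext/= -surjective_pairing valK.
have extT (A : pred B) (O : {x : B * C | A x.1} -> set R) b : ~~ A b -> rectangle xi (ext A O) b = setT.
  move=> Ab; apply/seteqP; split => // w _ c _.
  by rewrite /ext /= insubN.
have mr O b : (forall b c, open (O b c)) -> measurable (rectangle xi O b).
  move=> oO; apply: fin_bigcap_measurable; first exact: finite_finset.
  move=> c _; rewrite -[X in measurable X]setTI; apply: mxi => //.
  exact: open_measurable.
pose O b c := ext A1 O1 b c `&` ext A2 O2 b c.
have -> : (\bigcap_i (subfamily xi (A := A1) i @^-1` O1 i)) `&`
    (\bigcap_i (subfamily xi (A := A2) i @^-1` O2 i)) = \bigcap_b rectangle xi O b.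
  rewrite !extE -bigcapI; apply: eq_bigcapr => b _.
  by rewrite /rectangle -bigcapI; apply: eq_bigcapr => c _; rewrite preimage_setI.
rewrite !extE !ixi; do ?[by move=> b c; apply: oext]; last first.
  by move=> b c; apply: openI; exact: oext.
rewrite -EFinM -big_split/=; congr EFin; apply: eq_bigr => b _.
have -> : rectangle xi O b = rectangle xi (ext A1 O1) b `&` rectangle xi (ext A2 O2) b.
  by rewrite /rectangle -bigcapI; apply: eq_bigcapr => c _; rewrite preimage_setI.
have [A1b|A1b] := boolP (A1 b).
  have A2b : ~~ A2 b by apply/negP => /(A12 _ A1b).
  by rewrite (extT A2)// setIT probability_setT mulr1.
by rewrite (extT A1)// setTI probability_setT mul1r.
Qed.

Lemma measurable_subfamily (A : pred B) i : measurable_fun setT (subfamily xi (A := A) i).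
Proof. exact: mxi. Qed.

(* Measurability of H expressed for all coordinate systems at once, so that it
   can be used with the sub-sigma-algebras generated by parts of the family. *)
Definition coordinate_measurable (H : (C -> R) -> R) :=
  forall d' (T' : measurableType d') (f : C -> T' -> R),
    (forall c, measurable_fun setT (f c)) -> measurable_fun setT (fun w => H (f^~ w)).

Lemma measurable_coordinates (A : pred B) b c : A b ->
  measurable_fun setT
    (xi b c : g_sigma_algebraType (open_rectangles (subfamily xi (A := A))) -> R).
Proof.
move=> Ab.
exact: (measurable_fun_open_rectangles (f := subfamily xi (A := A)) (exist (fun x => A x.1) (b, c) Ab)).
Qed.

(** By induction on [s]: the head block is independent of the remaining ones, so [indep_tonelli]
    splits off its expectation. *)
Lemma expectation_prod (H : B -> (C -> R) -> R) (s : seq B) : uniq s ->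
  (forall b, coordinate_measurable (H b)) -> (forall b x, 0 <= H b x) ->
  (\int[P]_w (\prod_(b <- s) H b (fun c => xi b c w))%:E =
   \big[*%E/1%E]_(b <- s) \int[P]_w (H b (fun c => xi b c w))%:E)%E.
Proof.
move=> us mH H0; elim: s us => [_|b s ih /= /andP[bs us]].
  rewrite big_nil; under eq_integral do rewrite big_nil.
  by rewrite integral_cst// mul1e; exact: probability_setT.
rewrite big_cons -ih//; under eq_integral do rewrite big_cons EFinM.
pose A1 : pred B := pred1 b; pose A2 : pred B := mem s.
pose S1 := g_sigma_algebraType (open_rectangles (subfamily xi (A := A1))).
pose S2 := g_sigma_algebraType (open_rectangles (subfamily xi (A := A2))).
have mG : measurable_fun setT (fun w : S2 => (\prod_(b <- s) H b (fun c => xi b c w))%:E).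
  apply/measurable_EFinP.
  apply: measurable_prod => b' b's; apply: (mH b') => c; exact: measurable_coordinates.
have mF : measurable_fun setT (fun w : S1 => (H b (fun c => xi b c w))%:E).
  apply/measurable_EFinP; apply: (mH b) => c; apply: measurable_coordinates.
  by rewrite /A1/=.
rewrite (indep_tonelli (f := subfamily xi (A := A1)) (g := subfamily xi (A := A2))
  (F := fun z => ((H b (fun c => xi b c z.1))%:E * (\prod_(b <- s) H b (fun c => xi b c z.2))%:E)%E)) /=.
- have Pi0 w : (0 <= \prod_(b <- s) H b (fun c => xi b c w))%R by apply: prodr_ge0.
  have idm A := measurable_fun_id_rectangles (f := subfamily xi (A := A)) (@measurable_subfamily A).
  have mG' := measurableT_comp mG (idm A2).
  have mF' := measurableT_comp mF (idm A1).
  transitivity (\int[P]_w ((H b (fun c => xi b c w))%:E *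
      \int[P]_w' (\prod_(b' <- s) H b' (fun c => xi b' c w'))%:E))%E.
    by apply: eq_integral => w _; apply: ge0_integralZl; rewrite ?lee_fin// => w' _; rewrite lee_fin.
  apply: ge0_integralZr => //.
  + by move=> w _; rewrite lee_fin.
  + by apply: integral_ge0 => w _; rewrite lee_fin.
- exact: measurable_subfamily.
- exact: measurable_subfamily.
- by apply: subfamily_independent => b' /eqP ->; exact/negP.
- by apply: emeasurable_funM; [exact: (measurableT_comp mF)|exact: (measurableT_comp mG)].
- by move=> z; rewrite mule_ge0// lee_fin// prodr_ge0.
Qed.

End independent_blocks.

Lemma ge0_integralZl_fin d (T : measurableType d) (R : realType)
    (mu : {measure set T -> \bar R}) (f : T -> R) (k : R) :
  measurable_fun setT f -> (forall x, 0 <= f x) -> 0 <= k ->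
  (\int[mu]_x (k * f x)%:E = k%:E * \int[mu]_x (f x)%:E)%E.
Proof.
move=> mf f0 k0; under eq_integral do rewrite EFinM.
apply: ge0_integralZl_EFin => //; last exact/measurable_EFinP.
by move=> x _; rewrite lee_fin.
Qed.

(** * Squared norms of sub-Gaussian vectors by Gaussian integration *)

Section gaussian_linearization.
Context (R : realType).
Local Notation phi := (@normal_pdf R 0 1).
Local Notation leb := (@lebesgue_measure R).

(** Completing the square: [phi g * expR (b * g)] is [expR (b ^+ 2 / 2)] times the normal density of
    mean [b]. *)
Lemma normal_pdf_expR_linear (b : R) :
  (\int[leb]_g (phi g * expR (b * g))%:E = (expR (b ^+ 2 / 2))%:E)%E.
Proof.
transitivity (\int[leb]_g ((expR (b ^+ 2 / 2))%:E * (normal_pdf b 1 g)%:E))%E.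
  apply: eq_integral => g _; rewrite -EFinM; congr EFin.
  rewrite !normal_pdfE ?oner_neq0// /normal_fun mulrCA -!mulrA -!expRD.
  by congr (_ * expR _); field.
rewrite integralZl//; last exact: integrable_normal_pdf.
by rewrite integral_normal_pdf mule1.
Qed.

(** The integrand is [s] times the normal density of variance [s ^+ 2 = (1 - 2 * a)^-1], so the
    integral is [s]. For [a <= 4^-1] one has s^2 <= 1 + 4 a <= e^(4 a). *)
Lemma normal_pdf_expR_square (a : R) : 0 <= a <= 4^-1 ->
  (\int[leb]_g (phi g * expR (a * g ^+ 2))%:E <= (expR (2 * a))%:E)%E.
Proof.
move=> /andP[a0 a4]; have a1 : 0 < 1 - 2 * a by lra.
pose s : R := (Num.sqrt (1 - 2 * a))^-1.
have s0 : 0 < s by rewrite invr_gt0 sqrtr_gt0.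
have s2 : s ^+ 2 = (1 - 2 * a)^-1 by rewrite exprVn sqr_sqrtr// ltW.
have -> : (\int[leb]_g (phi g * expR (a * g ^+ 2))%:E =
    \int[leb]_g (s%:E * (normal_pdf 0 s g)%:E))%E.
  apply: eq_integral => g _; rewrite -EFinM; congr EFin.
  rewrite !normal_pdfE ?oner_neq0 ?gt_eqF// /normal_fun -mulrA -expRD [s * _]mulrA.
  congr (_ * _); last (congr expR).
    rewrite /normal_peak -[(s ^+ 2 * _ *+ 2)]mulrnAr sqrtrM ?sqr_ge0// sqrtr_sqr gtr0_norm//.
    by rewrite invfM mulrA divff ?gt_eqF// mul1r expr1n mul1r.
  by rewrite s2; field; rewrite gt_eqF.
rewrite integralZl//; last exact: integrable_normal_pdf.
rewrite integral_normal_pdf mule1 lee_fin.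
rewrite -(@ler_pXn2r _ 2) ?nnegrE ?expR_ge0 ?(ltW s0)// s2 -expRM_natl.
apply: (@le_trans _ _ (1 + 2 * (2 * a))); last first.
  by apply: le_trans (expR_ge1Dx _) _; rewrite ler_expR; lra.
rewrite -[leLHS]mul1r ler_pdivrMr//; nra.
Qed.

Context d (T : measurableType d) (P : probability T R).

(** A square is traded for a linear term: [expR (mu * x ^+ 2)] is the Gaussian mean of
    [expR (c * x * g)] with [c ^+ 2 = 2 * mu]. Moving [t0] into [s] amounts to taking
    [u t0 = c * g], which costs [expR (mu * K * g ^+ 2)]; averaging over [g] turns this into
    [expR (2 * (mu * K))] by [normal_pdf_expR_square]. The variables [x t] may be dependent. *)
Lemma sqr_norm_mgf_seq (I : finType) (x : I -> T -> R) (K mu : R) :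
  (forall t, measurable_fun setT (x t)) ->
  (forall u : I -> R, (\int[P]_w (expR (\sum_t u t * x t w))%:E <=
     (expR (K * (\sum_t u t ^+ 2) / 2))%:E)%E) ->
  0 <= K -> 0 <= mu -> mu * K <= 4^-1 ->
  forall s : seq I, uniq s -> forall u : I -> R,
  (\int[P]_w (expR (mu * (\sum_(t <- s) x t w ^+ 2) + \sum_(t | t \notin s) u t * x t w))%:E <=
   (expR (2 * (mu * K) * (size s)%:R + K * (\sum_(t | t \notin s) u t ^+ 2) / 2))%:E)%E.
Proof.
move=> mx sub K0 mu0 muK; elim=> [_ u|t0 s ih /= /andP[t0s us] u].
  under eq_integral do rewrite big_nil mulr0 add0r.
  by rewrite mulr0 add0r; exact: sub.
pose c := Num.sqrt (2 * mu).
have c2 : c ^+ 2 = 2 * mu by rewrite sqr_sqrtr// mulr_ge0.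
pose u' g t := if t == t0 then c * g else u t.
pose G g w := mu * (\sum_(t <- s) x t w ^+ 2) + \sum_(t | t \notin s) u' g t * x t w.
have split_out (F : I -> R) : \sum_(t | t \notin s) F t =
    F t0 + \sum_(t | t \notin t0 :: s) F t.
  rewrite (bigD1 t0)//=; congr (_ + _); apply: eq_bigl => t.
  by rewrite inE negb_or andbC.
have u'E g (F : R -> I -> R) : \sum_(t | t \notin t0 :: s) F (u' g t) t =
    \sum_(t | t \notin t0 :: s) F (u t) t.
  apply: eq_bigr => t; rewrite inE negb_or => /andP[tt0 _].
  by rewrite /u' (negbTE tt0).
have GE g w : G g w = mu * (\sum_(t <- s) x t w ^+ 2) + (c * x t0 w) * g +
    \sum_(t | t \notin t0 :: s) u t * x t w.
  rewrite /G split_out (u'E g (fun a t => a * x t w)) /u' eqxx; ring.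
have mG : measurable_fun setT (fun z : T * R => (phi z.2 * expR (G z.2 z.1))%:E).
  apply/measurable_EFinP; apply: measurable_funM.
    by apply: measurableT_comp => //; exact: measurable_normal_pdf.
  apply: measurableT_comp => //; under eq_fun do rewrite GE.
  have mx1 t : measurable_fun setT (fun z : T * R => x t z.1).
    exact: measurableT_comp.
  apply: measurable_funD; last first.
    rewrite [X in measurable_fun _ X](_ : _ = (fun z : T * R =>
      \sum_t if t \notin t0 :: s then u t * x t z.1 else 0)); last first.
      by apply/funext => z; rewrite big_mkcond.
    apply: measurable_sum => t; case: (t \notin _) => //.
    by apply: measurable_funM.
  apply: measurable_funD.
    apply: measurable_funM => //; apply: measurable_sum => t.
    exact: measurable_funX.
  by apply: measurable_funM => //; apply: measurable_funM.
have G0 z : (0 <= (phi z.2 * expR (G z.2 z.1))%:E)%E.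
  by rewrite lee_fin mulr_ge0 ?expR_ge0 ?normal_pdf_ge0.
have -> : (\int[P]_w (expR (mu * (\sum_(t <- t0 :: s) x t w ^+ 2) +
       \sum_(t | t \notin t0 :: s) u t * x t w))%:E =
    \int[P]_w \int[leb]_g (phi g * expR (G g w))%:E)%E.
  apply: eq_integral => w _; apply/esym.
  transitivity (\int[leb]_g (expR (mu * (\sum_(t <- s) x t w ^+ 2) +
      \sum_(t | t \notin t0 :: s) u t * x t w) * (phi g * expR (c * x t0 w * g)))%:E)%E.
    apply: eq_integral => g _; rewrite mulrCA -expRD GE.
    by congr EFin; congr (_ * _); congr expR; ring.
  rewrite ge0_integralZl_fin ?expR_ge0//; last 2 first.
  - apply: measurable_funM; first exact: measurable_normal_pdf.
    by apply: measurableT_comp => //; exact: measurable_funM.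
  - by move=> g; rewrite mulr_ge0 ?expR_ge0 ?normal_pdf_ge0.
  rewrite normal_pdf_expR_linear -EFinM -expRD big_cons exprMn c2.
  by congr EFin; congr expR; field.
have /= -> := fubini_tonelli (m1 := P) (m2 := leb) _ mG G0.
pose e := expR (2 * (mu * K) * (size s)%:R + K * (\sum_(t | t \notin t0 :: s) u t ^+ 2) / 2).
apply: (@le_trans _ _ (\int[leb]_g (e * (phi g * expR (mu * K * g ^+ 2)))%:E)%E).
  apply: ge0_le_integral => //.
  - by move=> g _; apply: integral_ge0 => w _; exact: (G0 (w, g)).
  - exact: (measurable_fun_fubini_tonelli_G _ mG).
  - apply/measurable_EFinP; apply: measurable_funM => //; apply: measurable_funM.
      exact: measurable_normal_pdf.
    by apply: measurableT_comp => //; apply: measurable_funM => //; exact: measurable_funX.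
  move=> g _.
  have mGg : measurable_fun setT (fun w => expR (G g w)).
    apply: measurableT_comp => //; apply: measurable_funD.
      apply: measurable_funM => //; apply: measurable_sum => t; exact: measurable_funX.
    rewrite [X in measurable_fun _ X](_ : _ = (fun w =>
      \sum_t if t \notin s then u' g t * x t w else 0)); last first.
      by apply/funext => z; rewrite big_mkcond.
    by apply: measurable_sum => t; case: (t \notin _) => //; apply: measurable_funM.
  rewrite ge0_integralZl_fin ?normal_pdf_ge0//.
  apply: le_trans (lee_wpmul2l _ (ih us (u' g))) _.
    by rewrite lee_fin normal_pdf_ge0.
  rewrite -!EFinM lee_fin [leRHS]mulrCA ler_wpM2l ?normal_pdf_ge0// -expRD ler_expR.
  rewrite split_out (u'E g (fun a _ => a ^+ 2)) /u' eqxx exprMn c2.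
  by rewrite le_eqVlt; apply/orP; left; apply/eqP; field.
rewrite ge0_integralZl_fin ?expR_ge0//; last 2 first.
- apply: measurable_funM; first exact: measurable_normal_pdf.
  by apply: measurableT_comp => //; apply: measurable_funM => //; exact: measurable_funX.
- by move=> g; rewrite mulr_ge0 ?expR_ge0 ?normal_pdf_ge0.
apply: le_trans (lee_wpmul2l _ (normal_pdf_expR_square _)) _.
- by rewrite lee_fin expR_ge0.
- by rewrite muK mulr_ge0.
rewrite -EFinM lee_fin /e -expRD ler_expR -natr1.
by rewrite le_eqVlt; apply/orP; left; apply/eqP; ring.
Qed.

Lemma sqr_norm_mgf (I : finType) (x : I -> T -> R) (K mu : R) :
  (forall t, measurable_fun setT (x t)) ->
  (forall u : I -> R, (\int[P]_w (expR (\sum_t u t * x t w))%:E <=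
     (expR (K * (\sum_t u t ^+ 2) / 2))%:E)%E) ->
  0 <= K -> 0 <= mu -> mu * K <= 4^-1 ->
  (\int[P]_w (expR (mu * (\sum_t x t w ^+ 2)))%:E <=
   (expR (2 * (mu * K) * #|I|%:R))%:E)%E.
Proof.
move=> mx sub K0 mu0 muK.
have := sqr_norm_mgf_seq mx sub K0 mu0 muK (enum_uniq I) (fun=> 0).
rewrite -cardE big_pred0; last by move=> t; rewrite mem_enum.
rewrite mulr0 mul0r addr0; apply: le_trans; rewrite le_eqVlt; apply/orP; left; apply/eqP.
apply: eq_integral => w _; congr EFin; congr expR.
rewrite [X in _ + X]big_pred0; last by move=> t; rewrite mem_enum.
by rewrite addr0 big_enum.
Qed.

End gaussian_linearization.

(** * Elementary inequalities for the exponential *)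

Section exponential_inequalities.
Context (R : realType).

(** Each [expR (y i)] lies above the tangent line of [expR] at the mean [m]. *)
Lemma expR_jensen (I : finType) (p y : I -> R) :
  (forall i, 0 <= p i) -> \sum_i p i = 1 ->
  expR (\sum_i p i * y i) <= \sum_i p i * expR (y i).
Proof.
move=> p0 p1; set m := \sum_i _.
apply: (@le_trans _ _ (\sum_i p i * (expR m * (1 + (y i - m))))).
  rewrite le_eqVlt; apply/orP; left; apply/eqP.
  under eq_bigr => i _ do rewrite mulrCA mulrDr mulr1 mulrBr.
  by rewrite -mulr_sumr big_split/= sumrB -mulr_suml p1 mul1r subrr addr0 mulr1.
apply: ler_sum => i _; apply: ler_wpM2l => //.
rewrite -[in leRHS](subrK m (y i)) expRD mulrC ler_wpM2r ?expR_ge0//.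
exact: expR_ge1Dx.
Qed.

(** The arithmetic-geometric mean inequality; it separates two dependent summands at the price of
    doubling both exponents. *)
Lemma expR_average (x y : R) : expR (x + y) <= (expR (2 * x) + expR (2 * y)) / 2.
Proof.
have -> : expR (2 * x) = expR x ^+ 2 by rewrite (expRM_natl 2).
have -> : expR (2 * y) = expR y ^+ 2 by rewrite (expRM_natl 2).
rewrite expRD; have := sqr_ge0 (expR x - expR y); nra.
Qed.

(** From [expR z - 1 <= z * expR z] follows e^y <= 1 + y + y (e^y - 1). The last product is at most
    y^2 e^y if y >= 0, and at most y^2 if y <= 0. *)
Lemma expR_le_quadratic (y : R) : expR y <= 1 + y + y ^+ 2 * expR `|y|.
Proof.
have h (z : R) : expR z - 1 <= z * expR z.
  have := expR_ge1Dx (- z); rewrite expRN => /(ler_wpM2r (expR_ge0 z)).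
  by rewrite mulVf ?gt_eqF ?expR_gt0//; lra.
have e0 := expR_gt0 y; have hy := h y; have e1 := expR_ge1Dx y.
have [y0|y0] := leP 0 y.
  by rewrite ger0_norm//; nra.
have : 1 <= expR `|y| by rewrite -expR0 ler_expR.
move=> n1; have : y ^+ 2 <= y ^+ 2 * expR `|y| by rewrite ler_peMr// sqr_ge0.
nra.
Qed.

(** Half of the exponent [a * W] absorbs the exponential factor of the remainder. The other half
    absorbs W^2, through y^2 / 2 <= e^y at y = a W / 2, which produces the constant 8. *)
Lemma expR_quad_le (a lam W : R) : 0 < a -> 0 <= W -> `|lam| <= a / 2 ->
  expR (lam * W) <= 1 + lam * W + 8 * (lam / a) ^+ 2 * expR (a * W).
Proof.
move=> a0 W0 la; apply: le_trans (expR_le_quadratic _) _; rewrite lerD2l.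
rewrite normrM (ger0_norm W0) exprMn.
pose y := a * W / 2.
have y0 : 0 <= y by rewrite /y; nra.
have e1 : y ^+ 2 / 2 <= expR y.
  have := expR_ge1Dxn 1 y0; rewrite (_ : 2`!%:R = 2)//; lra.
have e2 : expR (`|lam| * W) <= expR y by rewrite ler_expR /y; nra.
have -> : expR (a * W) = expR y * expR y by rewrite -expRD; congr expR; rewrite /y; field.
have W2 : W ^+ 2 = 4 * y ^+ 2 / a ^+ 2 by rewrite /y; field; rewrite gt_eqF.
have -> : lam ^+ 2 * W ^+ 2 = 8 * (lam / a) ^+ 2 * (y ^+ 2 / 2).
  by rewrite W2; field; rewrite gt_eqF.
rewrite -[leLHS]mulrA; apply: ler_wpM2l; first by rewrite mulr_ge0 ?sqr_ge0.
by apply: ler_pM => //; rewrite ?divr_ge0 ?sqr_ge0 ?expR_ge0.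
Qed.

End exponential_inequalities.

(** * The squared norm of one block *)

Section diagonal_block.
Context d (T : measurableType d) (R : realType) (P : probability T R).
Context (C : finType) (x : C -> T -> R) (v : C -> R) (V : R).
Hypothesis mx : forall c, measurable_fun setT (x c).
Hypothesis v0 : forall c, 0 <= v c.
Hypothesis sub : forall c s,
  (\int[P]_w (expR (s * x c w))%:E <= (expR (v c * s ^+ 2 / 2))%:E)%E.
Hypothesis V0 : 0 < V.
Hypothesis vV : \sum_c v c <= V.
Hypothesis C0 : (0 < #|C|)%N.

Let W w := \sum_c x c w ^+ 2.

Let mW : measurable_fun setT W.
Proof. by apply: measurable_sum => c; exact: measurable_funX. Qed.

Lemma sqr_mgf c (mu : R) : 0 <= mu -> mu * v c <= 4^-1 ->
  (\int[P]_w (expR (mu * x c w ^+ 2))%:E <= (expR (2 * (mu * v c)))%:E)%E.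
Proof.
move=> mu0 muv.
have := @sqr_norm_mgf R _ T P 'I_1 (fun=> x c) (v c) mu (fun=> mx c) _ (v0 c) mu0 muv.
under eq_integral do rewrite big_ord1.
rewrite card_ord mulr1; apply => u.
by rewrite big_ord1; under eq_integral do rewrite big_ord1; exact: sub.
Qed.

(** The coordinates of a block may be dependent, so the sum is handled by convexity:
    [(8 * V)^-1 * W] is the average of [mu c * x c ^+ 2] with weights [p c] proportional to [v' c],
    and [mu] is chosen so that all [mu c * v' c] are equal. The common value is at most 4^-1, as
    [sqr_mgf] requires, because [V' <= 2 * V]. *)
Lemma sqr_norm_exp_moment : (\int[P]_w (expR ((8 * V)^-1 * W w))%:E <= 2%:E)%E.
Proof.
pose n : R := #|C|%:R; have n0 : 0 < n by rewrite ltr0n.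
(* The shift makes every weight positive, also where [v c = 0], and keeps the total below
   [2 * V]. *)
pose v' c := v c + V / n.
have v'0 c : 0 < v' c by rewrite ltr_wpDl// divr_gt0.
pose V' := \sum_c v' c.
have V'E : V' = \sum_c v c + V.
  by rewrite /V' big_split/= sumr_const -mulr_natr divfK// gt_eqF.
have V'0 : 0 < V' by rewrite V'E ltr_wpDl// sumr_ge0.
have V'2 : V' <= 2 * V by rewrite V'E mulr_natl mulr2n lerD2r.
pose mu c := (8 * V)^-1 * V' / v' c.
have mu0 c : 0 <= mu c by rewrite !mulr_ge0// ?invr_ge0 ?mulr_ge0// ltW.
have muv' c : mu c * v' c = V' / (8 * V).
  by rewrite /mu divfK ?gt_eqF// mulrC.
have muv c : mu c * v c <= 4^-1.
  apply: (@le_trans _ _ (mu c * v' c)); first by rewrite ler_wpM2l// lerDl divr_ge0// ltW.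
  rewrite muv' ler_pdivrMr ?mulr_gt0//; lra.
pose p c := v' c / V'.
have p0 c : 0 <= p c by rewrite divr_ge0// ltW.
have p1 : \sum_c p c = 1 by rewrite -mulr_suml divff ?gt_eqF.
apply: (@le_trans _ _ (\int[P]_w (\sum_c p c * expR (mu c * x c w ^+ 2))%:E)%E).
  apply: ge0_le_integral => //.
  - apply/measurable_EFinP; apply: measurableT_comp => //; exact: measurable_funM.
  - apply/measurable_EFinP; apply: measurable_sum => c; apply: measurable_funM => //.
    by apply: measurableT_comp => //; apply: measurable_funM => //; exact: measurable_funX.
  - move=> w _; rewrite lee_fin; apply: le_trans (expR_jensen _ p0 p1).
    rewrite ler_expR mulr_sumr le_eqVlt; apply/orP; left; apply/eqP.
    apply: eq_bigr => c _; rewrite /p /mu; field.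
    by rewrite !gt_eqF.
have me c : measurable_fun setT (fun w => expR (mu c * x c w ^+ 2)).
  by apply: measurableT_comp => //; apply: measurable_funM => //; exact: measurable_funX.
under eq_integral do rewrite -sumEFin.
rewrite ge0_integral_sum//; last 2 first.
- by move=> c; apply/measurable_EFinP; exact: measurable_funM.
- by move=> c w _; rewrite lee_fin mulr_ge0// expR_ge0.
apply: (@le_trans _ _ (\sum_c (p c * 2)%:E)%E); last first.
  by rewrite sumEFin -mulr_suml p1 mul1r.
apply: lee_sum => c _; rewrite ge0_integralZl_fin// (EFinM _ 2).
apply: lee_wpmul2l; first by rewrite lee_fin.
apply: le_trans (sqr_mgf (mu0 c) (muv c)) _; rewrite lee_fin.
have : 2 * (mu c * v c) <= 2^-1 by have := muv c; lra.
rewrite -ler_expR => /le_trans; apply.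
(* e^(1/2) <= 2, by inverting e^(-1/2) >= 1/2. *)
have := expR_ge1Dx (- (2^-1 : R)); rewrite expRN.
have e0 : 0 < expR (2^-1 : R) by exact: expR_gt0.
move=> h; rewrite -[leLHS]invrK -[leRHS]invrK lef_pV2 ?posrE ?invr_gt0//; lra.
Qed.

(** With [a = (8 * V)^-1], [expR_quad_le] and [sqr_norm_exp_moment] bound the uncentred expectation
    by 1 + lam m + 2 k, hence by e^(lam m + 2 k), and centring removes lam m. The constant is 1024 =
    2 * 8 * 8^2. *)
Lemma sqr_norm_centered_mgf (m lam : R) : (\int[P]_w (W w)%:E = m%:E)%E ->
  `|lam| <= (16 * V)^-1 ->
  (\int[P]_w (expR (lam * (W w - m)))%:E <= (expR (1024 * lam ^+ 2 * V ^+ 2))%:E)%E.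
Proof.
move=> Wm lamV; pose a := (8 * V)^-1.
have a0 : 0 < a by rewrite invr_gt0 mulr_gt0.
have la : `|lam| <= a / 2.
  by apply: le_trans lamV _; rewrite /a -invfM (_ : 8 * V * 2 = 16 * V)//; ring.
have W0 w : 0 <= W w by apply: sumr_ge0 => c _; exact: sqr_ge0.
have iW : P.-integrable setT (EFin \o W).
  apply/integrableP; split; first exact/measurable_EFinP.
  by under eq_integral do rewrite /= ger0_norm//; rewrite Wm ltry.
have mE k : measurable_fun setT (fun w => expR (k * W w)).
  by apply: measurableT_comp => //; exact: measurable_funM.
have iE : P.-integrable setT (EFin \o (fun w => expR (a * W w))).
  apply/integrableP; split; first exact/measurable_EFinP.
  under eq_integral do rewrite /= ger0_norm ?expR_ge0//.
  by apply: le_lt_trans sqr_norm_exp_moment _; rewrite ltry.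
have -> : (\int[P]_w (expR (lam * (W w - m)))%:E =
    (expR (- (lam * m)))%:E * \int[P]_w (expR (lam * W w))%:E)%E.
  rewrite -ge0_integralZl_fin ?expR_ge0//; apply: eq_integral => w _.
  by rewrite -expRD; congr EFin; congr expR; ring.
pose k := 8 * (lam / a) ^+ 2.
have k0 : 0 <= k by rewrite mulr_ge0 ?sqr_ge0.
have iZW : P.-integrable setT (fun w => (lam%:E * (W w)%:E)%E) by exact: integrableZl.
have iZE : P.-integrable setT (fun w => (k%:E * (expR (a * W w))%:E)%E) by exact: integrableZl.
have i1 : P.-integrable setT (cst 1%E) by exact: finite_measure_integrable_cst.
have i1W : P.-integrable setT (fun w => (1 + lam%:E * (W w)%:E)%E).
  exact: (integrableD _ i1 iZW).
have step : (\int[P]_w (expR (lam * W w))%:E <= (1 + lam * m + k * 2)%:E)%E.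
  apply: (@le_trans _ _ (\int[P]_w ((1 + lam%:E * (W w)%:E) + k%:E * (expR (a * W w))%:E))%E).
    apply: ge0_le_integral => //.
    - exact/measurable_EFinP.
    - by apply: emeasurable_funD; [case/integrableP: i1W|case/integrableP: iZE].
    - by move=> w _; rewrite -!EFinM -!EFinD lee_fin; exact: expR_quad_le.
  have i1E : (\int[P]_w (1 : \bar R) = 1)%E.
    by rewrite integral_cst// mul1e; exact: probability_setT.
  rewrite integralD// integralD// !integralZl// Wm i1E.
  rewrite EFinD EFinD (EFinM lam) (EFinM k); apply: leeD2l.
  by apply: lee_wpmul2l; rewrite ?lee_fin//; exact: sqr_norm_exp_moment.
apply: le_trans (lee_wpmul2l _ step) _; first by rewrite lee_fin expR_ge0.
rewrite -EFinM lee_fin.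
have -> : 1024 * lam ^+ 2 * V ^+ 2 = k * 2.
  by rewrite /k /a; field; rewrite gt_eqF.
have -> : expR (k * 2) = expR (- (lam * m)) * expR (lam * m + k * 2).
  by rewrite -expRD; congr expR; ring.
by rewrite ler_wpM2l ?expR_ge0// -addrA; exact: expR_ge1Dx.
Qed.

End diagonal_block.

Lemma ge0_integralD_fin d (T : measurableType d) (R : realType)
    (mu : {measure set T -> \bar R}) (f g : T -> R) :
  measurable_fun setT f -> measurable_fun setT g ->
  (forall x, 0 <= f x) -> (forall x, 0 <= g x) ->
  (\int[mu]_x (f x + g x)%:E = \int[mu]_x (f x)%:E + \int[mu]_x (g x)%:E)%E.
Proof.
move=> mf mg f0 g0; under eq_integral do rewrite EFinD.
apply: ge0_integralD => //; try exact/measurable_EFinP.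
- by move=> x _; rewrite lee_fin.
- by move=> x _; rewrite lee_fin.
Qed.

Lemma ge0_le_integral_fin d (T : measurableType d) (R : realType)
    (mu : {measure set T -> \bar R}) (f g : T -> R) :
  measurable_fun setT f -> measurable_fun setT g ->
  (forall x, 0 <= f x) -> (forall x, f x <= g x) ->
  (\int[mu]_x (f x)%:E <= \int[mu]_x (g x)%:E)%E.
Proof.
move=> mf mg f0 fg; apply: ge0_le_integral => //; try exact/measurable_EFinP.
- by move=> x _; rewrite lee_fin.
- by move=> x _; rewrite lee_fin.
Qed.

(** Measurability is asked only for the indices in [s]: in [decoupled_mgf] the other blocks need not
    be measurable for the sub-sigma-algebra in force. *)
Lemma measurable_bigsum_in d (T : measurableType d) (R : realType) (I : eqType)
    (s : seq I) (h : I -> T -> R) :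
  (forall i, i \in s -> measurable_fun setT (h i)) ->
  measurable_fun setT (fun x => \sum_(i <- s) h i x).
Proof.
elim: s => [_|i s ih mh].
  by under eq_fun do rewrite big_nil; exact: measurable_cst.
under eq_fun do rewrite big_cons; apply: measurable_funD; first by apply: mh; rewrite mem_head.
by apply: ih => j js; apply: mh; rewrite inE js orbT.
Qed.

Lemma expectation_prod_le d (T : measurableType d) (R : realType)
    (P : probability T R) (B C : finType) (xi : B -> C -> T -> R)
    (H : B -> (C -> R) -> R) (g : B -> R) (s : seq B) :
  (forall b c, measurable_fun setT (xi b c)) -> blocks_independent P xi -> uniq s ->
  (forall b, coordinate_measurable (H b)) -> (forall b x, 0 <= H b x) ->
  (forall b, \int[P]_w (H b (fun c => xi b c w))%:E <= (g b)%:E)%E ->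
  (\int[P]_w (\prod_(b <- s) H b (fun c => xi b c w))%:E <= (\prod_(b <- s) g b)%:E)%E.
Proof.
move=> mxi ixi us mH H0 Hg; rewrite (expectation_prod mxi ixi)//.
have E0 b : (0 <= \int[P]_w (H b (fun c => xi b c w))%:E)%E.
  by apply: integral_ge0 => w _; rewrite lee_fin.
elim: s {us} => [|b s ih]; first by rewrite !big_nil.
rewrite !big_cons EFinM; apply: lee_pmul => //.
by elim: (s) => [|b' s' ih']; rewrite ?big_nil// big_cons mule_ge0.
Qed.

(** * Averaging over all splittings of the blocks *)

Section decoupling.
Context (R : realType) (B : finType).

(** Such a set is determined by its trace on the complement of the two points. The factor 4 avoids
    the exponent [#|B| - 2]. *)
Lemma card_separating_sets (b b' : B) : b != b' ->
  (#|[set A : {set B} | (b \in A) && (b' \notin A)]%SET| * 4 = 2 ^ #|B|)%N.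
Proof.
move=> bb'; pose S : {set B} := (~: [set b; b'])%SET.
have -> : [set A : {set B} | (b \in A) && (b' \notin A)]%SET = ([set b |: A | A in powerset S])%SET.
  apply/setP => A; rewrite inE; apply/andP/imsetP => [[bA b'A]|[A' ]].
    exists (A :\ b)%SET; last by rewrite finset.setD1K.
    rewrite inE; apply/fintype.subsetP => z; rewrite !inE => /andP[zb zA].
    by rewrite negb_or zb/=; apply: contra b'A => /eqP <-.
  rewrite inE => /fintype.subsetP A'S ->; rewrite !inE eqxx/= negb_or eq_sym bb'; split => //.
  by apply/negP => /A'S; rewrite !inE eqxx orbT.
rewrite card_in_imset; last first.
  move=> A A'; rewrite !inE => /fintype.subsetP AS /fintype.subsetP A'S E.
  have nb (A1 : {set B}) : {subset A1 <= S} -> b \notin A1.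
    by move=> h; apply/negP => /h; rewrite !inE eqxx.
  by rewrite -(finset.setU1K (nb _ AS)) E finset.setU1K ?nb.
rewrite card_powerset -(cardsC [set b; b']%SET) cards2 bb' /=.
by rewrite [in RHS]addnC expnD; congr (2 ^ _ * _)%N; apply: eq_card => z; rewrite !inE.
Qed.

(** A uniformly random [A] contains [b] and misses [b'] with probability 1/4, which the factor 4
    compensates. *)
Lemma sum_separated (a : B -> B -> R) :
  \sum_(A : {set B}) (2 ^+ #|B|)^-1 * (4 * \sum_(b in A) \sum_(b' in (~: A)%SET) a b b') =
  \sum_b \sum_(b' | b' != b) a b b'.
Proof.
have sep (A : {set B}) b : (if b \in A then \sum_(b' in (~: A)%SET) a b b' else 0) =
    \sum_(b' | b' != b) if (b \in A) && (b' \notin A) then a b b' else 0.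
  have [bA|bA] := boolP (b \in A); last by rewrite big1.
  rewrite [RHS]big_mkcond [LHS]big_mkcond; apply: eq_bigr => b' _ /=.
  rewrite !inE; have [->|] := eqVneq b' b; first by rewrite bA.
  by case: (b' \in A).
rewrite -mulr_sumr -mulr_sumr.
under eq_bigr => A _ do rewrite big_mkcond.
rewrite exchange_big/= !mulr_sumr; apply: eq_bigr => b _.
under eq_bigr => A _ do rewrite sep.
rewrite exchange_big/= !mulr_sumr; apply: eq_bigr => b' b'b.
rewrite -big_mkcond/= sumr_const -(mulr_natl (a b b')) mulrA mulrA.
rewrite [X in X * _](_ : _ = 1) ?mul1r// -mulrA -natrM mulnC.
have := card_separating_sets (b := b) (b' := b'); rewrite eq_sym cardsE => /(_ b'b) ->.
by rewrite natrX mulVf// expf_neq0.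
Qed.

End decoupling.

(** * A Hanson-Wright bound for independent blocks *)

Section hanson_wright.
Context d (T : measurableType d) (R : realType) (P : probability T R).
Context (B C : finType) (xi : B -> C -> T -> R).
Context (Q : B -> (C -> R) -> R) (v m : B -> C -> R) (K : R).
Hypothesis mxi : forall b c, measurable_fun setT (xi b c).
Hypothesis ixi : blocks_independent P xi.
Hypothesis Q0 : forall b u, 0 <= Q b u.
Hypothesis QK : forall u, \sum_b Q b u <= K * \sum_c u c ^+ 2.
Hypothesis subQ : forall b u,
  (\int[P]_w (expR (\sum_c u c * xi b c w))%:E <= (expR (Q b u / 2))%:E)%E.
Hypothesis v0 : forall b c, 0 <= v b c.
Hypothesis subv : forall b c s,
  (\int[P]_w (expR (s * xi b c w))%:E <= (expR (v b c * s ^+ 2 / 2))%:E)%E.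
Hypothesis vK : forall b, \sum_c v b c <= K.
Hypothesis vKC : \sum_b \sum_c v b c <= #|C|%:R * K.
Hypothesis mE : forall b c, (\int[P]_w (xi b c w ^+ 2)%:E = (m b c)%:E)%E.
Hypothesis K0 : 0 < K.
Hypothesis C0 : (0 < #|C|)%N.
Hypothesis B0 : (0 < #|B|)%N.

Let xA (A : {set B}) c w := \sum_(b <- enum A) xi b c w.

Let mxA A c : measurable_fun setT (xA A c).
Proof.
exact: measurable_sum.
Qed.

(** [Q b u] is a variance bound for the combination of block [b] with coefficients [u]. Independent
    blocks add their [Q], and restricting to [A] drops nonnegative terms, so [K] serves for every
    [A]. *)
Lemma sum_blocks_mgf (A : {set B}) (u : C -> R) :
  (\int[P]_w (expR (\sum_c u c * xA A c w))%:E <=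
   (expR (K * (\sum_c u c ^+ 2) / 2))%:E)%E.
Proof.
have -> : (\int[P]_w (expR (\sum_c u c * xA A c w))%:E =
    \int[P]_w (\prod_(b <- enum A) expR (\sum_c u c * xi b c w))%:E)%E.
  apply: eq_integral => w _; rewrite -expR_sum exchange_big/=.
  by congr EFin; congr expR; apply: eq_bigr => c _; rewrite mulr_sumr.
apply: le_trans (expectation_prod_le (H := fun _ x => expR (\sum_c u c * x c))
  (g := fun b => expR (Q b u / 2)) mxi ixi _ _ _ _) _.
- exact: enum_uniq.
- move=> b d' T' f mf; apply: measurableT_comp => //.
  by apply: measurable_sum => c; exact: measurable_funM.
- by move=> b x; exact: expR_ge0.
- by move=> b; exact: subQ.
rewrite lee_fin big_enum/= -expR_sum ler_expR -mulr_suml ler_pM2r ?invr_gt0//.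
apply: le_trans (QK u); rewrite [leRHS](bigID (mem A))/= lerDl; exact: sumr_ge0.
Qed.

(** With the blocks outside [A] held fixed the form is linear in those of [A], and [sum_blocks_mgf]
    leaves the exponential of (4 lam)^2 K / 2 = 8 lam^2 K times a squared norm. [sqr_norm_mgf] with
    [mu = 8 * lam ^+ 2 * K] then gives 16 = 2 * 8. *)
Lemma decoupled_mgf (A : {set B}) (lam : R) : (8 * lam ^+ 2 * K) * K <= 4^-1 ->
  (\int[P]_w (expR (4 * lam * \sum_c xA A c w * xA (~: A)%SET c w))%:E <=
   (expR (16 * #|C|%:R * lam ^+ 2 * K ^+ 2))%:E)%E.
Proof.
move=> lamK.
(* [A1] goes to the first coordinate, which Tonelli integrates last: the blocks outside [A] are the
   ones held fixed. *)
pose A1 : pred B := fun b => b \notin A; pose A2 : pred B := fun b => b \in A.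
pose S1 := g_sigma_algebraType (open_rectangles (subfamily xi (A := A1))).
pose S2 := g_sigma_algebraType (open_rectangles (subfamily xi (A := A2))).
have mA1 c : measurable_fun setT (xA (~: A)%SET c : S1 -> R).
  apply: measurable_bigsum_in => b; rewrite mem_enum inE => bA; exact: measurable_coordinates.
have mA2 c : measurable_fun setT (xA A c : S2 -> R).
  apply: measurable_bigsum_in => b; rewrite mem_enum => bA; exact: measurable_coordinates.
rewrite (indep_tonelli (f := subfamily xi (A := A1)) (g := subfamily xi (A := A2))
  (F := fun z => (expR (4 * lam * \sum_c xA A c z.2 * xA (~: A)%SET c z.1))%:E)); first last.
- by move=> z; rewrite lee_fin expR_ge0.
- apply/measurable_EFinP; apply: measurableT_comp => //; apply: measurable_funM => //.
  apply: measurable_sum => c; apply: measurable_funM.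
    exact: (measurableT_comp (mA2 c)).
  exact: (measurableT_comp (mA1 c)).
- by apply: subfamily_independent => // b; rewrite /A1 /A2 => /negP.
- exact: measurable_subfamily.
- exact: measurable_subfamily.
apply: (@le_trans _ _ (\int[P]_w (expR (8 * lam ^+ 2 * K * \sum_c xA (~: A)%SET c w ^+ 2))%:E)%E).
  apply: ge0_le_integral => //.
  - by move=> w _; apply: integral_ge0 => w' _; rewrite lee_fin expR_ge0.
  - have mF : measurable_fun setT (fun z : T * T =>
        (expR (4 * lam * \sum_c xA A c z.2 * xA (~: A)%SET c z.1))%:E).
      apply/measurable_EFinP; apply: measurableT_comp => //; apply: measurable_funM => //.
      apply: measurable_sum => c; apply: measurable_funM.
        exact: (measurableT_comp (mxA A c)).
      exact: (measurableT_comp (mxA (~: A)%SET c)).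
    exact: (measurable_fun_fubini_tonelli_F (m2 := P) _ mF).
  - apply/measurable_EFinP; apply: measurableT_comp => //; apply: measurable_funM => //.
    by apply: measurable_sum => c; exact: measurable_funX.
  move=> w _ /=.
  apply: (@le_trans _ _ (\int[P]_w' (expR (\sum_c (4 * lam * xA (~: A)%SET c w) * xA A c w'))%:E)%E).
    rewrite le_eqVlt; apply/orP; left; apply/eqP; apply: eq_integral => w' _.
    by congr EFin; congr expR; rewrite mulr_sumr; apply: eq_bigr => c _; ring.
  apply: le_trans (sum_blocks_mgf A _) _; rewrite lee_fin ler_expR /=.
  under eq_bigr => c _ do rewrite exprMn.
  by rewrite -mulr_sumr le_eqVlt; apply/orP; left; apply/eqP; field.
apply: le_trans (sqr_norm_mgf (K := K) (mxA (~: A)%SET) (sum_blocks_mgf (~: A)%SET) _ _ lamK) _.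
- exact: ltW.
- by apply: mulr_ge0; [apply: mulr_ge0 => //; exact: sqr_ge0|exact: ltW].
- by rewrite lee_fin ler_expR le_eqVlt; apply/orP; left; apply/eqP; ring.
Qed.

Let off w := \sum_c \sum_b \sum_(b' | b' != b) xi b c w * xi b' c w.

(** By [sum_separated] the off-diagonal sum is the average over [A] of four times the decoupled
    form, and convexity of the exponential reduces to a single [A]. *)
Lemma offdiagonal_mgf (lam : R) : (8 * lam ^+ 2 * K) * K <= 4^-1 ->
  (\int[P]_w (expR (lam * off w))%:E <=
   (expR (16 * #|C|%:R * lam ^+ 2 * K ^+ 2))%:E)%E.
Proof.
move=> lamK; pose p (A : {set B}) : R := (2 ^+ #|B|)^-1.
have p0 A : 0 <= p A by rewrite invr_ge0 exprn_ge0.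
have p1 : \sum_A p A = 1.
  have cs : #|{: {set B}}| = (2 ^ #|B|)%N by rewrite -[LHS]cardsT -(finset.powersetT B) card_powerset cardsT.
  rewrite sumr_const /p -[LHS]mulr_natl (_ : #|_| = (2 ^ #|B|)%N)//.
  by rewrite natrX mulfV// expf_neq0.
pose Y A w := 4 * lam * \sum_c xA A c w * xA (~: A)%SET c w.
have mY A : measurable_fun setT (fun w => expR (Y A w)).
  apply: measurableT_comp => //; apply: measurable_funM => //.
  by apply: measurable_sum => c; exact: measurable_funM.
have offE w : lam * off w = \sum_A p A * Y A w.
  rewrite /off mulr_sumr.
  under eq_bigr => c _ do rewrite -sum_separated mulr_sumr.
  rewrite exchange_big/=; apply: eq_bigr => A _.
  rewrite -/(p A) /Y !mulr_sumr; apply: eq_bigr => c _.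
  rewrite /xA !big_enum big_distrl/=.
  under [in RHS]eq_bigr => b _ do rewrite big_distrr/=.
  ring.
apply: (@le_trans _ _ (\int[P]_w (\sum_A p A * expR (Y A w))%:E)%E).
  apply: ge0_le_integral_fin.
  - apply: measurableT_comp => //; apply: measurable_funM => //.
    rewrite /off; apply: measurable_sum => c; apply: measurable_sum => b.
    rewrite [X in measurable_fun _ X](_ : _ = (fun w =>
      \sum_b' if b' != b then xi b c w * xi b' c w else 0)); last first.
      by apply/funext => w; rewrite big_mkcond.
    apply: measurable_sum => b'; case: (b' != b) => //; exact: measurable_funM.
  - by apply: measurable_sum => A; exact: measurable_funM.
  - by move=> w; exact: expR_ge0.
  - by move=> w; rewrite offE; exact: expR_jensen.
under eq_integral do rewrite -sumEFin.
rewrite ge0_integral_sum//; last 2 first.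
- by move=> A; apply/measurable_EFinP; exact: measurable_funM.
- by move=> A w _; rewrite lee_fin mulr_ge0// expR_ge0.
set e := expR _.
apply: (@le_trans _ _ (\sum_(A : {set B}) (p A * e)%:E)%E); last first.
  by rewrite sumEFin -mulr_suml p1 mul1r.
apply: lee_sum => A _; rewrite ge0_integralZl_fin// (EFinM _ e).
by apply: lee_wpmul2l; rewrite ?lee_fin//; exact: decoupled_mgf.
Qed.

Let W b w := \sum_c xi b c w ^+ 2.

Lemma diagonal_mgf (lam : R) : `|lam| <= (32 * K)^-1 ->
  (\int[P]_w (expR (lam * \sum_b (W b w - \sum_c m b c)))%:E <=
   (expR (4096 * #|C|%:R * lam ^+ 2 * K ^+ 2))%:E)%E.
Proof.
move=> lamK; pose n : R := #|B|%:R; have n0 : 0 < n by rewrite ltr0n.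
have n1 : 1 <= n by rewrite ler1n.
(* Positive even for a vanishing block, as [sqr_norm_centered_mgf] requires, while each [V b] is at
   most 2 K and their sum at most 2 |C| K; hence 4096 = 1024 * 2 * 2. *)
pose V b := \sum_c v b c + K / n.
have V0 b : 0 < V b by rewrite ltr_wpDl ?divr_gt0// sumr_ge0.
have V2 b : V b <= 2 * K.
  by rewrite mulr_natl mulr2n lerD// ler_pdivrMr// ler_peMr// ltW.
have sV : \sum_b V b <= 2 * #|C|%:R * K.
  rewrite big_split/= sumr_const -[X in _ + X]mulr_natr divfK ?gt_eqF//.
  have : K <= #|C|%:R * K by rewrite ler_peMl ?ler1n// ltW.
  have := vKC; lra.
pose H b (x : C -> R) := expR (lam * (\sum_c x c ^+ 2 - \sum_c m b c)).
have -> : (\int[P]_w (expR (lam * \sum_b (W b w - \sum_c m b c)))%:E =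
    \int[P]_w (\prod_(b <- index_enum B) H b (fun c => xi b c w))%:E)%E.
  by apply: eq_integral => w _; rewrite -expR_sum mulr_sumr.
apply: le_trans (expectation_prod_le (H := H)
  (g := fun b => expR (1024 * lam ^+ 2 * V b ^+ 2)) mxi ixi _ _ _ _) _.
- exact: index_enum_uniq.
- move=> b d' T' f mf; apply: measurableT_comp => //; apply: measurable_funM => //.
  by apply: measurable_funB => //; apply: measurable_sum => c; exact: measurable_funX.
- by move=> b x; exact: expR_ge0.
- move=> b; apply: (sqr_norm_centered_mgf (mxi b) (v0 b) (subv b) (V0 b)) => //.
  + by rewrite lerDl divr_ge0// ltW.
  + under eq_integral do rewrite -sumEFin.
    rewrite ge0_integral_sum//; last 2 first.
    * by move=> c; apply/measurable_EFinP; exact: measurable_funX.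
    * by move=> c w _; rewrite lee_fin sqr_ge0.
    by rewrite -sumEFin; apply: eq_bigr => c _.
  + apply: le_trans lamK _; rewrite lef_pV2 ?posrE ?mulr_gt0//.
    by have := V2 b; lra.
rewrite lee_fin -expR_sum ler_expR -mulr_sumr.
apply: (@le_trans _ _ (1024 * lam ^+ 2 * (2 * K * (2 * #|C|%:R * K)))); last first.
  by rewrite le_eqVlt; apply/orP; left; apply/eqP; ring.
apply: ler_wpM2l; first by apply: mulr_ge0; [exact: ler0n|exact: sqr_ge0].
apply: (@le_trans _ _ (2 * K * \sum_b V b)); last by rewrite ler_wpM2l// mulr_ge0// ltW.
by rewrite mulr_sumr; apply: ler_sum => b _; rewrite expr2 ler_wpM2r// ltW.
Qed.

(** The diagonal and off-diagonal parts are dependent; [expR_average] separates them and doubles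
    [lam], whence 64 = 2 * 32 and 16384 = 4 * 4096. The off-diagonal constant 64 = 4 * 16 is
    smaller. *)
Theorem hanson_wright_mgf (lam : R) : `|lam| <= (64 * K)^-1 ->
  (\int[P]_w (expR (lam * (\sum_c (\sum_b xi b c w) ^+ 2 - \sum_b \sum_c m b c)))%:E <=
   (expR (16384 * #|C|%:R * lam ^+ 2 * K ^+ 2))%:E)%E.
Proof.
move=> lamK.
have l2 : `|2 * lam| <= (32 * K)^-1.
  rewrite normrM ger0_norm//.
  have -> : (32 * K)^-1 = 2 * (64 * K)^-1 by field; rewrite gt_eqF.
  by rewrite ler_pM2l.
have l2K : (8 * (2 * lam) ^+ 2 * K) * K <= 4^-1.
  have h : `|2 * lam| * K <= 32^-1.
    have := ler_wpM2r (ltW K0) l2; rewrite invfM mulfVK ?gt_eqF//.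
  have -> : 8 * (2 * lam) ^+ 2 * K * K = 8 * (`|2 * lam| * K) ^+ 2.
    by rewrite [(`|_| * _) ^+ 2]exprMn real_normK ?num_real//; ring.
  have : 0 <= `|2 * lam| * K by rewrite mulr_ge0// ltW.
  by nra.
have split w : lam * (\sum_c (\sum_b xi b c w) ^+ 2 - \sum_b \sum_c m b c) =
    lam * \sum_b (W b w - \sum_c m b c) + lam * off w.
  rewrite -mulrDr sumrB addrAC; congr (lam * (_ - _)).
  rewrite /W exchange_big -big_split/=; apply: eq_bigr => c _.
  rewrite expr2 big_distrl/= -big_split/=; apply: eq_bigr => b _.
  by rewrite (bigD1 b)//= mulrDr expr2 big_distrr.
have mW : measurable_fun setT (fun w => \sum_b (W b w - \sum_c m b c)).
  apply: measurable_sum => b; apply: measurable_funB => //.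
  by apply: measurable_sum => c; exact: measurable_funX.
have moff : measurable_fun setT off.
  rewrite /off; apply: measurable_sum => c; apply: measurable_sum => b.
  rewrite [X in measurable_fun _ X](_ : _ = (fun w =>
    \sum_b' if b' != b then xi b c w * xi b' c w else 0)); last first.
    by apply/funext => w; rewrite big_mkcond.
  apply: measurable_sum => b'; case: (b' != b) => //; exact: measurable_funM.
have mE2 (f : T -> R) (k : R) : measurable_fun setT f -> measurable_fun setT (fun w => expR (k * f w)).
  by move=> mf; apply: measurableT_comp => //; exact: measurable_funM.
apply: (@le_trans _ _ (\int[P]_w (2^-1 * expR (2 * lam * \sum_b (W b w - \sum_c m b c)) +
    2^-1 * expR (2 * lam * off w))%:E)%E).
  apply: ge0_le_integral_fin.
  - under eq_fun do rewrite split.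
    apply: measurableT_comp => //; apply: measurable_funD; exact: measurable_funM.
  - by apply: measurable_funD; apply: measurable_funM => //; exact: mE2.
  - by move=> w; exact: expR_ge0.
  - move=> w; rewrite split; apply: le_trans (expR_average _ _) _.
    by rewrite !mulrA; lra.
have mD := mE2 _ (2 * lam) mW; have mO := mE2 _ (2 * lam) moff.
rewrite ge0_integralD_fin; last 4 first.
- exact: measurable_funM.
- exact: measurable_funM.
- by move=> w; rewrite mulr_ge0 ?expR_ge0.
- by move=> w; rewrite mulr_ge0 ?expR_ge0.
rewrite !ge0_integralZl_fin ?invr_ge0//.
set e := expR _.
have -> : e%:E = ((2^-1)%:E * e%:E + (2^-1)%:E * e%:E)%E.
  by rewrite -!EFinM -EFinD; congr EFin; field.
apply: leeD; apply: lee_wpmul2l; rewrite ?lee_fin ?invr_ge0//.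
  apply: le_trans (diagonal_mgf l2) _; rewrite lee_fin ler_expR.
  by rewrite le_eqVlt; apply/orP; left; apply/eqP; ring.
apply: le_trans (offdiagonal_mgf l2K) _; rewrite lee_fin ler_expR.
have h : 0 <= #|C|%:R * lam ^+ 2 * K ^+ 2 by apply: mulr_ge0; [apply: mulr_ge0; [exact: ler0n|exact: sqr_ge0]|exact: sqr_ge0].
have -> : 16 * #|C|%:R * (2 * lam) ^+ 2 * K ^+ 2 = 64 * (#|C|%:R * lam ^+ 2 * K ^+ 2) by ring.
have -> : 16384 * #|C|%:R * lam ^+ 2 * K ^+ 2 = 16384 * (#|C|%:R * lam ^+ 2 * K ^+ 2) by ring.
by rewrite ler_wpM2r// ler_nat.
Qed.

End hanson_wright.

(** * Inner products of square-integrable functions *)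

Section square_integrable.
Context d (T : measurableType d) (R : realType) (mu : {measure set T -> \bar R}).
Context (D : set T).
Implicit Types f g : T -> R.

Definition sqint f := measurable_fun D f /\ mu.-integrable D (fun x => (f x ^+ 2)%:E).

(** Real-valued, with an infinite integral read as 0, so the algebraic rules below ask for
    [sqint]. *)
Definition ip f g : R := \int[mu]_(x in D) (f x * g x).

Hypothesis mD : measurable D.

Lemma sqint_mul f g : sqint f -> sqint g -> mu.-integrable D (fun x => (f x * g x)%:E).
Proof.
move=> [mf f2] [mg g2].
apply: (le_integrable mD _ _ (integrableD mD f2 g2)).
  by apply/measurable_EFinP; exact: measurable_funM.
move=> x Dx /=; rewrite lee_fin [leRHS]ger0_norm ?addr_ge0 ?sqr_ge0// normrM.
rewrite -(real_normK (num_real (f x))) -(real_normK (num_real (g x))).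
have := sqr_ge0 (`|f x| - `|g x|); have := mulr_ge0 (normr_ge0 (f x)) (normr_ge0 (g x)); nra.
Qed.

Lemma sqint0 : sqint (fun=> 0).
Proof.
split => //; rewrite (_ : (fun _ => _) = cst 0%E); first exact: integrable0.
by apply/funext => x; rewrite expr0n.
Qed.

Lemma sqintD f g : sqint f -> sqint g -> sqint (fun x => f x + g x).
Proof.
move=> sf sg; have [mf f2] := sf; have [mg g2] := sg.
split; first exact: measurable_funD.
have i2 := integrableZl mD 2 (sqint_mul sf sg).
rewrite (_ : (fun x => _) = (fun x => ((f x ^+ 2)%:E + (2%:E * (f x * g x)%:E)) + (g x ^+ 2)%:E)%E).
  exact: integrableD (integrableD _ _ _) _.
by apply/funext => x; rewrite -EFinM -!EFinD; congr EFin; ring.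
Qed.

Lemma sqintZ (k : R) f : sqint f -> sqint (fun x => k * f x).
Proof.
move=> [mf f2]; split; first exact: measurable_funM.
under eq_fun do rewrite exprMn EFinM; exact: integrableZl.
Qed.

Lemma sqintN f : sqint f -> sqint (fun x => - f x).
Proof. by move=> sf; under eq_fun do rewrite -mulN1r; exact: sqintZ. Qed.

Lemma sqintB f g : sqint f -> sqint g -> sqint (fun x => f x - g x).
Proof. by move=> sf sg; apply: sqintD => //; exact: sqintN. Qed.

Lemma sqint_sum (I : Type) (s : seq I) (F : I -> T -> R) :
  (forall i, sqint (F i)) -> sqint (fun x => \sum_(i <- s) F i x).
Proof.
move=> sF; elim: s => [|i s ih].
  by under eq_fun do rewrite big_nil; exact: sqint0.
by under eq_fun do rewrite big_cons; exact: sqintD.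
Qed.

Lemma ipC f g : ip f g = ip g f.
Proof. by rewrite /ip; apply: eq_Rintegral => x _; rewrite mulrC. Qed.

Lemma ipDl f g h : sqint f -> sqint g -> sqint h ->
  ip (fun x => f x + g x) h = ip f h + ip g h.
Proof.
move=> sf sg sh; rewrite /ip -RintegralD//; try exact: sqint_mul.
by apply: eq_Rintegral => x _; rewrite mulrDl.
Qed.

Lemma ipZl k f h : sqint f -> sqint h -> ip (fun x => k * f x) h = k * ip f h.
Proof.
move=> sf sh; rewrite /ip -RintegralZl//; last exact: sqint_mul.
by apply: eq_Rintegral => x _; rewrite mulrA.
Qed.

Lemma ip_suml (I : Type) (s : seq I) (F : I -> T -> R) h :
  (forall i, sqint (F i)) -> sqint h ->
  ip (fun x => \sum_(i <- s) F i x) h = \sum_(i <- s) ip (F i) h.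
Proof.
move=> sF sh; elim: s => [|i s ih].
  rewrite big_nil /ip (_ : (fun x => _) = cst 0); first by rewrite Rintegral_cst// mul0r.
  by apply/funext => x; rewrite big_nil mul0r.
rewrite big_cons -ih -ipDl//; last exact: sqint_sum.
by congr ip; apply/funext => x; rewrite big_cons.
Qed.

Lemma ipDr f g h : sqint f -> sqint g -> sqint h ->
  ip h (fun x => f x + g x) = ip h f + ip h g.
Proof. by move=> *; rewrite ipC ipDl// !(ipC h). Qed.

Lemma ipZr k f h : sqint f -> sqint h -> ip h (fun x => k * f x) = k * ip h f.
Proof. by move=> *; rewrite ipC ipZl// (ipC h). Qed.

Lemma ip_sumr (I : Type) (s : seq I) (F : I -> T -> R) h :
  (forall i, sqint (F i)) -> sqint h ->
  ip h (fun x => \sum_(i <- s) F i x) = \sum_(i <- s) ip h (F i).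
Proof. by move=> sF sh; rewrite ipC ip_suml//; apply: eq_bigr => i _; exact: ipC. Qed.

Lemma ipBl f g h : sqint f -> sqint g -> sqint h ->
  ip (fun x => f x - g x) h = ip f h - ip g h.
Proof.
move=> sf sg sh; rewrite ipDl//; last exact: sqintN.
by congr (_ + _); rewrite -mulN1r -ipZl//; congr ip; apply/funext => x; rewrite mulN1r.
Qed.

Lemma ipBr f g h : sqint f -> sqint g -> sqint h ->
  ip h (fun x => f x - g x) = ip h f - ip h g.
Proof. by move=> *; rewrite ipC ipBl// !(ipC h). Qed.

Lemma ip_ge0 f : 0 <= ip f f.
Proof. by apply: Rintegral_ge0 => x _; rewrite -expr2 sqr_ge0. Qed.

Lemma ip_sqr f : sqint f -> ((ip f f)%:E = \int[mu]_(x in D) (f x ^+ 2)%:E)%E.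
Proof.
move=> [mf f2]; rewrite /ip /Rintegral fineK.
  by under eq_integral do rewrite -expr2.
under eq_integral do rewrite -expr2.
exact: integrable_fin_num.
Qed.

(** The quadratic polynomial t -> <f + t g, f + t g> is nonnegative, hence so is minus its
    discriminant. *)
Lemma cauchy_schwarz f g : sqint f -> sqint g ->
  `|ip f g| <= Num.sqrt (ip f f) * Num.sqrt (ip g g).
Proof.
move=> sf sg; set a := ip f f; set b := ip f g; set c := ip g g.
have quad t : 0 <= a + 2 * b * t + c * t ^+ 2.
  have st := sqintZ t sg.
  have := ip_ge0 (fun x => f x + t * g x).
  rewrite ipDl//; last exact: sqintD.
  rewrite !ipDr// !ipZl// !ipZr// (ipC g f) -/a -/b -/c.
  by rewrite (_ : _ + _ = a + 2 * b * t + c * t ^+ 2)//; ring.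
have a0 : 0 <= a := ip_ge0 f; have c0 : 0 <= c := ip_ge0 g.
rewrite -sqrtrM// -sqrtr_sqr ler_sqrt ?mulr_ge0//.
have [c0'|c0'] := eqVneq c 0.
  have [->|b0] := eqVneq b 0; first by rewrite expr0n mulr_ge0.
  (* With [c = 0] the polynomial is affine and would take the value -1 at this point. *)
  have := quad (- (a + 1) / (2 * b)); rewrite c0' mul0r addr0.
  have -> : 2 * b * (- (a + 1) / (2 * b)) = - (a + 1) by field; rewrite b0.
  by rewrite opprD addrA subrr add0r oppr_ge0 ler10.
have cp : 0 < c by rewrite lt_neqAle eq_sym c0'.
have := quad (- b / c).
have -> : a + 2 * b * (- b / c) + c * (- b / c) ^+ 2 = (a * c - b ^+ 2) / c.
  by field; rewrite c0'.
by rewrite pmulr_lge0 ?invr_gt0// subr_ge0.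
Qed.

(** Minkowski's inequality: after squaring, [cauchy_schwarz] bounds the cross term. *)
Lemma ip_sumsq_le_dist f g : sqint f -> sqint g ->
  Num.sqrt (ip (fun x => f x + g x) (fun x => f x + g x)) <=
  Num.sqrt (ip f f) + Num.sqrt (ip g g).
Proof.
move=> sf sg; have sfg := sqintD sf sg.
rewrite -(@ler_pXn2r _ 2) ?nnegrE ?addr_ge0 ?sqrtr_ge0//.
rewrite sqrrD !sqr_sqrtr ?ip_ge0// ipDl// !ipDr// (ipC g f).
have := cauchy_schwarz sf sg; rewrite ler_norml => /andP[_ h].
by rewrite (_ : _ + _ = ip f f + ip f g *+ 2 + ip g g) ?lerD2r ?lerD2l ?lerMn2r//; ring.
Qed.

Lemma ip_le f g : sqint f -> sqint g -> (forall x, D x -> `|f x| <= `|g x|) ->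
  ip f f <= ip g g.
Proof.
move=> sf sg fg; apply: le_Rintegral => //; try exact: sqint_mul.
move=> x Dx; rewrite -!expr2 -(real_normK (num_real (f x))) -(real_normK (num_real (g x))).
by rewrite ler_pXn2r ?nnegrE//; exact: fg.
Qed.

End square_integrable.

(** * Fatou bounds and limits in L_2 *)

Section fatou_bound.
Context d (T : measurableType d) (R : realType) (mu : {measure set T -> \bar R}).

(** Carries uniform bounds to an almost everywhere limit: second moments in [la_x_sqint], moment
    generating functions in [two_process_mgf]. *)
Lemma fatou_ae_le (F : nat -> T -> R) (f : T -> R) (M : \bar R) :
  (forall n, measurable_fun setT (F n)) -> measurable_fun setT f ->
  (forall n x, 0 <= F n x) -> (forall x, 0 <= f x) ->
  {ae mu, forall x, F ^~ x @ \oo --> f x} ->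
  (forall n, \int[mu]_x (F n x)%:E <= M)%E -> (\int[mu]_x (f x)%:E <= M)%E.
Proof.
move=> mF mf F0 f0 cvF FM.
have mEF n : measurable_fun setT (fun x => (F n x)%:E) by exact/measurable_EFinP.
have le1 : (\int[mu]_x (f x)%:E <= \int[mu]_x limn_einf (fun n => (F n x)%:E))%E.
  apply: ae_ge0_le_integral => //.
  - by move=> x _; rewrite lee_fin.
  - exact/measurable_EFinP.
  - move=> x _; rewrite limn_einf_lim; apply: lime_ge.
      by apply: ereal_nondecreasing_is_cvgn; exact: nondecreasing_einfs.
    apply: nearW => n; apply: le_ereal_inf_tmp => _ [k /= _ <-].
    by rewrite lee_fin.
  - rewrite /limn_einf; apply: measurableT_comp => //.
    apply: measurable_fun_limn_esup => n; exact: measurableT_comp.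
  apply: filterS cvF => x cvx _.
  have : (fun n => (F n x)%:E) @ \oo --> (f x)%:E by apply: cvg_EFin => //; exact: nearW.
  by move/cvg_limn_einf_sup => [-> _].
apply: le_trans le1 _; apply: le_trans (fatou _ _ _ _) _ => //.
  by move=> n x _; rewrite lee_fin.
rewrite limn_einf_lim; apply: lime_le.
  by apply: ereal_nondecreasing_is_cvgn; exact: nondecreasing_einfs.
apply: nearW => n; apply: le_trans (FM n).
by apply: ereal_inf_lbound; exists n => /=.
Qed.

End fatou_bound.

Section square_integrable_limits.
Context d (T : measurableType d) (R : realType) (mu : {measure set T -> \bar R}).
Context (D : set T) (mD : measurable D).
Local Notation sqint := (sqint mu D).
Local Notation ip := (ip mu D).

Lemma sqint_le (f g : T -> R) : measurable_fun D f -> sqint g ->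
  (forall x, D x -> `|f x| <= `|g x|) -> sqint f.
Proof.
move=> mf [mg g2] fg; split=> //; apply: (le_integrable mD _ _ g2).
  by apply/measurable_EFinP; exact: measurable_funX.
move=> x Dx /=; rewrite lee_fin !normrX ler_pXn2r ?nnegrE//; exact: fg.
Qed.

(** The difference of the two products is expanded into three terms, each bounded by
    [cauchy_schwarz]. *)
Lemma ip_cvg (f g : nat -> T -> R) (f' g' : T -> R) :
  (forall n, sqint (f n)) -> (forall n, sqint (g n)) -> sqint f' -> sqint g' ->
  (fun n => ip (fun x => f n x - f' x) (fun x => f n x - f' x)) @ \oo --> (0 : R) ->
  (fun n => ip (fun x => g n x - g' x) (fun x => g n x - g' x)) @ \oo --> (0 : R) ->
  (fun n => ip (f n) (g n)) @ \oo --> ip f' g'.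
Proof.
move=> sf sg sf' sg' cf cg.
pose nm h := Num.sqrt (ip h h).
have cnf : (fun n => nm (fun x => f n x - f' x)) @ \oo --> (0 : R).
  by rewrite -(@sqrtr0 R); apply: continuous_cvg => //; exact: sqrt_continuous.
have cng : (fun n => nm (fun x => g n x - g' x)) @ \oo --> (0 : R).
  by rewrite -(@sqrtr0 R); apply: continuous_cvg => //; exact: sqrt_continuous.
have bnd n : `|ip f' g' - ip (f n) (g n)| <=
    nm (fun x => f n x - f' x) * (nm (fun x => g n x - g' x) + nm g') +
    nm f' * nm (fun x => g n x - g' x).
  have sdf := sqintB mD (sf n) sf'; have sdg := sqintB mD (sg n) sg'.
  have -> : ip f' g' - ip (f n) (g n) =
      - (ip (fun x => f n x - f' x) (fun x => g n x - g' x) +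
         ip (fun x => f n x - f' x) g' + ip f' (fun x => g n x - g' x)).
    rewrite !(ipBr mD)// ?(ipBl mD)//; ring.
  rewrite normrN mulrDr; apply: le_trans (ler_normD _ _) _.
  apply: lerD; last exact: cauchy_schwarz.
  by apply: le_trans (ler_normD _ _) _; apply: lerD; exact: cauchy_schwarz.
apply/cvgrPdist_le => e e0.
have c0 : (fun n => nm (fun x => f n x - f' x) * (nm (fun x => g n x - g' x) + nm g') +
    nm f' * nm (fun x => g n x - g' x)) @ \oo --> (0 : R).
  rewrite -[X in _ --> X](_ : 0 * (0 + nm g') + nm f' * 0 = 0); last first.
    by rewrite mul0r mulr0 addr0.
  apply: cvgD; first by apply: cvgM => //; apply: cvgD => //; exact: cvg_cst.
  by apply: cvgM => //; exact: cvg_cst.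
apply: filterS (cvgr_le _ c0 _ e0) => n h; exact: le_trans (bnd n) h.
Qed.

End square_integrable_limits.

(** * Independence, orthogonality and means *)

Section independent_pairs.
Context d (T : measurableType d) (R : realType) (P : probability T R).
Local Notation sqint := (sqint P setT).
Local Notation ip := (ip P setT).

Lemma sqint_cst (k : R) : sqint (fun=> k).
Proof.
split; first exact: measurable_cst.
exact: (finite_measure_integrable_cst P (k ^+ 2)).
Qed.

Lemma ip1_sqint (f : T -> R) : sqint f -> ((ip f (fun=> 1))%:E = \int[P]_w (f w)%:E)%E.
Proof.
move=> sf; have := sqint_mul measurableT sf (sqint_cst 1).
under [X in _.-integrable _ X -> _]eq_fun do rewrite mulr1.
move=> i1; rewrite /ip /Rintegral fineK.
  by under eq_integral do rewrite mulr1.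
by under eq_integral do rewrite mulr1; exact: integrable_fin_num.
Qed.

(** [indep_tonelli] is for nonnegative functions, so the four products of positive and negative
    parts are factorized separately; together they give the product of the means. *)
Lemma indep_ip0 (f g : T -> R) : sqint f -> sqint g ->
  families_independent P (fun _ : unit => f) (fun _ : unit => g) ->
  ip f (fun=> 1) = 0 -> ip f g = 0.
Proof.
move=> sf sg ind f0.
have mf : measurable_fun setT f by case: sf.
have mg : measurable_fun setT g by case: sg.
pose pos (h : T -> R) w : R := Num.max (h w) 0.
pose neg (h : T -> R) w : R := Num.max (- h w) 0.
have dec (h : T -> R) : h = (fun w => pos h w - neg h w).
  by apply/funext => w; rewrite /pos /neg; case: (lerP (h w) 0) => hw; case: (lerP (- h w) 0) => hw'; lra.
have mpos (h : T -> R) : measurable_fun setT h -> measurable_fun setT (pos h).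
  by move=> mh; exact: measurable_funrpos.
have mneg (h : T -> R) : measurable_fun setT h -> measurable_fun setT (neg h).
  by move=> mh; exact: measurable_funrneg.
have spos (h : T -> R) : sqint h -> sqint (pos h).
  move=> sh; have [mh _] := sh; apply: (sqint_le measurableT _ sh); first exact: mpos.
  by move=> w _; rewrite /pos; case: (lerP (h w) 0) => hw; rewrite ?normr0.
have sneg (h : T -> R) : sqint h -> sqint (neg h).
  move=> sh; have [mh _] := sh; apply: (sqint_le measurableT _ sh); first exact: mneg.
  by move=> w _; rewrite /neg; case: (lerP (- h w) 0) => hw; rewrite ?normr0 ?normrN.
have key (phi psi : R -> R) : measurable_fun setT phi -> measurable_fun setT psi ->
    (forall r, 0 <= phi r) -> (forall r, 0 <= psi r) ->
    sqint (phi \o f) -> sqint (psi \o g) ->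
    ip (phi \o f) (psi \o g) = ip (phi \o f) (fun=> 1) * ip (psi \o g) (fun=> 1).
  move=> mphi mpsi phi0 psi0 sphi spsi; apply: EFin_inj; rewrite EFinM !ip1_sqint//.
  have i1 := sqint_mul measurableT sphi spsi.
  rewrite /ip /Rintegral fineK; last exact: integrable_fin_num.
  have E := @indep_tonelli _ T R P unit unit (fun=> f) (fun=> g)
    (fun z => (phi (f z.1))%:E * (psi (g z.2))%:E)%E (fun=> mf) (fun=> mg) ind.
  transitivity (\int[P]_w ((phi (f w))%:E * (psi (g w))%:E))%E.
    by apply: eq_integral => w _; rewrite EFinM.
  rewrite [LHS]E/=; last first.
  - by move=> z; rewrite mule_ge0// lee_fin.
  - apply: emeasurable_funM.
      apply/measurable_EFinP; apply: measurableT_comp => //.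
      exact: (measurableT_comp (measurable_fun_open_rectangles (f := fun _ : unit => f) tt)).
    apply/measurable_EFinP; apply: measurableT_comp => //.
    exact: (measurableT_comp (measurable_fun_open_rectangles (f := fun _ : unit => g) tt)).
  have mphi' : measurable_fun setT (fun w => (phi (f w))%:E).
    by apply/measurable_EFinP; exact: measurableT_comp.
  have mpsi' : measurable_fun setT (fun w => (psi (g w))%:E).
    by apply/measurable_EFinP; exact: measurableT_comp.
  transitivity (\int[P]_w ((phi (f w))%:E * \int[P]_w' (psi (g w'))%:E))%E.
    by apply: eq_integral => w _; apply: ge0_integralZl => //; rewrite ?lee_fin// => w' _; rewrite lee_fin.
  apply: ge0_integralZr => //; first by move=> w _; rewrite lee_fin.
  by apply: integral_ge0 => w _; rewrite lee_fin.
have mid : measurable_fun setT (idfun : R -> R) by exact: measurable_id.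
have mp : measurable_fun setT (fun r : R => Num.max r 0) by exact: measurable_funrpos mid.
have mn : measurable_fun setT (fun r : R => Num.max (- r) 0) by exact: measurable_funrneg mid.
have p0 (r : R) : 0 <= Num.max r 0 by rewrite le_max lexx orbT.
have n0 (r : R) : 0 <= Num.max (- r) 0 by rewrite le_max lexx orbT.
have kpp := key _ _ mp mp p0 p0 (spos _ sf) (spos _ sg).
have kpn := key _ _ mp mn p0 n0 (spos _ sf) (sneg _ sg).
have knp := key _ _ mn mp n0 p0 (sneg _ sf) (spos _ sg).
have knn := key _ _ mn mn n0 n0 (sneg _ sf) (sneg _ sg).
have f0' : ip (pos f) (fun=> 1) - ip (neg f) (fun=> 1) = 0.
  rewrite -(ipBl measurableT); [by rewrite -dec|exact: spos|exact: sneg|exact: sqint_cst].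
rewrite (dec f) (dec g) (ipBl measurableT); [|exact: spos|exact: sneg|].
  rewrite !(ipBr measurableT); [|exact: spos|exact: sneg|exact: sneg|exact: spos|exact: sneg|exact: spos].
  have -> : ip (pos f) (pos g) = ip (pos f) (fun=> 1) * ip (pos g) (fun=> 1) := kpp.
  have -> : ip (pos f) (neg g) = ip (pos f) (fun=> 1) * ip (neg g) (fun=> 1) := kpn.
  have -> : ip (neg f) (pos g) = ip (neg f) (fun=> 1) * ip (pos g) (fun=> 1) := knp.
  have -> : ip (neg f) (neg g) = ip (neg f) (fun=> 1) * ip (neg g) (fun=> 1) := knn.
  by move/eqP: f0'; rewrite subr_eq0 => /eqP ->; ring.
by apply: sqintB => //; [exact: spos|exact: sneg].
Qed.

(** The bound alone forces the mean [m] to vanish: [1 + s * m <= expR (v * s ^+ 2 / 2)] for all [s],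
    both sides equal 1 at s = 0, and the right one has slope 0 there. *)
Lemma subgaussian_mean0 (f : T -> R) (v : R) : sqint f -> 0 <= v ->
  (forall s, (\int[P]_w (expR (s * f w))%:E <= (expR (v * s ^+ 2 / 2))%:E)%E) ->
  ip f (fun=> 1) = 0.
Proof.
move=> sf v0 sub; set m := ip f _.
have mf : measurable_fun setT f by case: sf.
have i1 : P.-integrable setT (EFin \o f).
  have := sqint_mul measurableT sf (sqint_cst 1).
  by under [X in _.-integrable _ X -> _]eq_fun do rewrite mulr1.
have h s : 1 + s * m <= expR (v * s ^+ 2 / 2).
  rewrite -lee_fin; apply: le_trans (sub s).
  have iz := integrableZl measurableT s i1.
  have ic : P.-integrable setT (cst 1%E) by exact: finite_measure_integrable_cst.
  have -> : ((1 + s * m)%:E = \int[P]_w (1 + s%:E * (f w)%:E))%E.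
    rewrite (integralD measurableT ic iz) (integralZl measurableT i1) -(ip1_sqint sf) EFinD EFinM.
    by rewrite integral_cst// mul1e; congr (_ + _)%E; apply/esym; exact: probability_setT.
  have [fin|] := boolP (\int[P]_w (expR (s * f w))%:E < +oo)%E; last first.
    by rewrite -leNgt; apply: le_trans; rewrite leey.
  apply: le_integral => //; first exact: integrableD.
    apply/integrableP; split.
      by apply/measurable_EFinP; apply: measurableT_comp => //; exact: measurable_funM.
    by under eq_integral do rewrite /= ger0_norm ?expR_ge0//.
  by move=> w _; rewrite -EFinM -EFinD lee_fin expR_ge1Dx.
apply/eqP; apply: contraT => m0.
have mm : 0 < m ^+ 2 by rewrite exprn_even_gt0.
have vm : 0 <= v * m ^+ 2 by rewrite mulr_ge0// ltW.
(* The contradiction is reached at [s = t * m], with [t] small enough that t (v + v m^2) <= 1: there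
   the exponent [y] is at most 1/2, [expR y * (1 - y) <= 1], and the gain t m^2 outweighs the loss
   due to y. *)
pose D := 1 + v + v * m ^+ 2; pose t := D^-1.
have D1 : 1 <= D by rewrite /D -addrA lerDl addr_ge0.
have D0 : 0 < D by apply: lt_le_trans D1.
have t0 : 0 < t by rewrite invr_gt0.
have t1 : t <= 1 by rewrite invf_le1.
have tD : t * (1 + v + v * m ^+ 2) = 1 by rewrite mulVf// gt_eqF.
pose y := v * (t * m) ^+ 2 / 2.
have yE : y = (t * (v * m ^+ 2)) * t / 2 by rewrite /y; ring.
have tvm : t * (v * m ^+ 2) <= 1 by nra.
have y1 : y <= 2^-1.
  by rewrite yE; have := mulr_ge0 (ltW t0) vm; nra.
have ey : expR y * (1 - y) <= 1.
  have := expR_ge1Dx (- y); rewrite expRN => /(ler_wpM2l (expR_ge0 y)).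
  by rewrite mulfV ?gt_eqF ?expR_gt0.
have := h (t * m); rewrite -/y => hy.
have : (1 + t * m * m) * (1 - y) <= 1.
  by apply: le_trans ey; apply: ler_wpM2r => //; lra.
have -> : t * m * m = t * m ^+ 2 by ring.
have z0 : 0 < t * m ^+ 2 by rewrite mulr_gt0.
have y0 : 0 <= y by rewrite /y; apply: divr_ge0 => //; apply: mulr_ge0 => //; exact: sqr_ge0.
have : y <= t * m ^+ 2 * (t * v) / 2 by rewrite yE le_eqVlt; apply/orP; left; apply/eqP; ring.
have : t * v + t * (v * m ^+ 2) <= 1 by nra.
have tv0 : 0 <= t * v by rewrite mulr_ge0// ltW.
have : y * (t * m ^+ 2) <= t * m ^+ 2 * (t * (v * m ^+ 2) / 2).
  by rewrite mulrC ler_pM2l// yE; have := mulr_ge0 (ltW t0) vm; nra.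
set z := t * m ^+ 2 in z0 *; set q := t * (v * m ^+ 2); set r := t * v in tv0 *.
move=> h1 h2 h3 h4; exfalso.
have : (1 + z) * (1 - y) = 1 + z - y - y * z by ring.
have : z * (r + q) <= z by rewrite ler_piMr// ltW.
by nra.
Qed.

End independent_pairs.

Lemma cvgn_sum (R : realType) (I : Type) (r : seq I) (f : I -> nat -> R) (l : I -> R) :
  (forall i, f i @ \oo --> l i) ->
  (fun n => \sum_(i <- r) f i n) @ \oo --> \sum_(i <- r) l i.
Proof.
move=> fl; elim: r => [|i r ih].
  by rewrite big_nil; under eq_fun do rewrite big_nil; exact: cvg_cst.
by rewrite big_cons; under eq_fun do rewrite big_cons; exact: cvgD.
Qed.

Lemma ip_sum_orthogonal d (T : measurableType d) (R : realType)
    (mu : {measure set T -> \bar R}) (D : set T) (I : eqType) (s : seq I) (F : I -> T -> R) :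
  measurable D -> uniq s -> (forall i, sqint mu D (F i)) ->
  (forall i j, i != j -> ip mu D (F i) (F j) = 0) ->
  ip mu D (fun w => \sum_(i <- s) F i w) (fun w => \sum_(i <- s) F i w) =
  \sum_(i <- s) ip mu D (F i) (F i).
Proof.
move=> mD us sF oF; rewrite ip_suml//; last exact: sqint_sum.
apply: eq_big_seq => i si; rewrite ip_sumr// (bigD1_seq i)//= big1 ?addr0// => j ji.
by apply: oF; rewrite eq_sym.
Qed.

(** * Scalar linear processes *)

Section linear_arrays.
Context d (T : measurableType d) (R : realType) (P : probability T R).
Local Notation sqint := (sqint P setT).
Local Notation ip := (ip P setT).

(* The scalar linear process x_t = sum_l z_(l, t - l), where z l s is the
   contribution of the innovation of time s at lag l. *)
Record linear_array (alpha2 : R) (z : nat -> int -> T -> R) (x : int -> T -> R)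
    (beta : nat -> R) : Prop := LinearArray {
  la_sqint : forall l s, sqint (z l s);
  la_measurable : forall t, measurable_fun setT (x t);
  la_beta_ge0 : forall l, 0 <= beta l;
  la_ip : forall l s, ip (z l s) (z l s) = beta l ^+ 2;
  la_orth : forall l l' s s', s != s' -> ip (z l s) (z l' s') = 0;
  la_subgaussian : forall s (N : nat) (a : nat -> R),
    (\int[P]_w (expR (\sum_(l < N) a l * z l s w))%:E <=
     (expR (alpha2 * ip (fun w => \sum_(l < N) a l * z l s w)
                        (fun w => \sum_(l < N) a l * z l s w) / 2))%:E)%E;
  la_cvg : forall t, {ae P, forall w,
    (fun N => \sum_(l < N) z l (t - l%:Z) w) @ \oo --> x t w};
  la_summable : exists B, forall N, \sum_(l < N) beta l <= B }.

Variables (alpha2 : R) (z : nat -> int -> T -> R) (x : int -> T -> R) (beta : nat -> R).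
Hypothesis la : linear_array alpha2 z x beta.

Definition partial (t : int) (N : nat) (w : T) := \sum_(l < N) z l (t - l%:Z) w.

Let mT := @measurableT _ T.
Let sz := la_sqint la.

Lemma partial_sqint t N : sqint (partial t N).
Proof. exact: sqint_sum. Qed.

Lemma partial_diffE t M N w : (M <= N)%N ->
  partial t N w - partial t M w = \sum_(l <- index_iota M N) z l (t - l%:Z) w.
Proof.
move=> MN; rewrite /partial -!(big_mkord xpredT (fun l => z l (t - l%:Z) w)).
by rewrite (big_cat_nat (n := M))//= addrAC subrr add0r.
Qed.

Lemma lag_neq (t : int) (l l' : nat) : l != l' -> t - l%:Z != t - l'%:Z.
Proof. by apply: contra => /eqP /addrI /oppr_inj [->]. Qed.

Lemma partial_diff_ip t M N : (M <= N)%N ->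
  ip (fun w => partial t N w - partial t M w) (fun w => partial t N w - partial t M w) =
  \sum_(l <- index_iota M N) beta l ^+ 2.
Proof.
move=> MN; under [X in ip X _]eq_fun do rewrite partial_diffE//.
under [X in ip _ X]eq_fun do rewrite partial_diffE//.
rewrite ip_sum_orthogonal ?iota_uniq//.
  by apply: eq_bigr => l _; exact: (la_ip la).
by move=> l l' ll'; apply: (la_orth la); exact: lag_neq.
Qed.

Lemma partial_ip t N : ip (partial t N) (partial t N) = \sum_(l < N) beta l ^+ 2.
Proof.
have := @partial_diff_ip t 0 N (leq0n N); rewrite big_mkord => <-.
by congr ip; apply/funext => w; rewrite /partial big_ord0 subr0.
Qed.

Let Sn N := \sum_(l < N) beta l ^+ 2.

Lemma sum_beta_sqr_bounded : exists2 C, 0 <= C & forall N, Sn N <= C.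
Proof.
have [B hB] := la_summable la; have B0 : 0 <= B by have := hB 0%N; rewrite big_ord0.
exists (B ^+ 2) => [|N]; first exact: sqr_ge0.
apply: (@le_trans _ _ (B * \sum_(l < N) beta l)); last by rewrite expr2 ler_wpM2l.
rewrite mulr_sumr; apply: ler_sum => l _; rewrite expr2 ler_wpM2r ?(la_beta_ge0 la)//.
apply: le_trans (hB l.+1); rewrite big_ord_recr/= lerDr sumr_ge0// => i _.
exact: (la_beta_ge0 la).
Qed.

Lemma Sn_nd : nondecreasing_seq Sn.
Proof.
apply/nondecreasing_seqP => N; rewrite /Sn big_ord_recr/= lerDl; exact: sqr_ge0.
Qed.

Lemma cvg_Sn : cvgn Sn.
Proof.
apply: nondecreasing_is_cvgn; first exact: Sn_nd.
by have [C _ hC] := sum_beta_sqr_bounded; exists C => _ [N _ <-].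
Qed.

Let S := limn Sn.

(** The series is only known to converge almost surely. Orthogonality bounds the second moments of
    the partial sums, and Fatou's lemma carries the bound to [x t]. *)
Lemma la_x_sqint t : sqint (x t).
Proof.
split; first exact: (la_measurable la).
apply/integrableP; split.
  by apply/measurable_EFinP; apply: measurable_funX; exact: (la_measurable la).
under eq_integral do rewrite /= ger0_norm ?sqr_ge0//.
have [C _ hC] := sum_beta_sqr_bounded.
apply: (@le_lt_trans _ _ C%:E); last exact: ltry.
apply: (@fatou_ae_le _ _ _ P (fun N w => partial t N w ^+ 2)).
- by move=> N; apply: measurable_funX; case: (partial_sqint t N).
- by apply: measurable_funX; exact: (la_measurable la).
- by move=> N w; exact: sqr_ge0.
- by move=> w; exact: sqr_ge0.
- apply: filterS (la_cvg la t) => w cw.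
  by rewrite expr2; under eq_fun do rewrite expr2; exact: (cvgM cw cw).
- by move=> N; rewrite -(ip_sqr mT (partial_sqint t N)) partial_ip lee_fin; exact: hC.
Qed.

(** Fatou's lemma applied to the distances from [partial t N] to later partial sums: the almost sure
    limit is also the limit in L_2, at the rate of the tail of the series of squared [beta]. *)
Lemma x_partial_dist t N :
  ip (fun w => partial t N w - x t w) (fun w => partial t N w - x t w) <= S - Sn N.
Proof.
have sd := sqintB mT (partial_sqint t N) (la_x_sqint t).
rewrite -lee_fin (ip_sqr mT sd).
apply: (@fatou_ae_le _ _ _ P (fun M w => (partial t N w - partial t (M + N)%N w) ^+ 2)).
- move=> M; apply: measurable_funX; apply: measurable_funB.
    by case: (partial_sqint t N).
  by case: (partial_sqint t (M + N)).
- by apply: measurable_funX; case: sd.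
- by move=> M w; exact: sqr_ge0.
- by move=> w; exact: sqr_ge0.
- apply: filterS (la_cvg la t) => w cw.
  have c1 : (fun M => partial t N w - partial t (M + N)%N w) @ \oo --> partial t N w - x t w.
    apply: cvgB; first exact: cvg_cst.
    by rewrite (cvg_shiftn N (fun M => partial t M w)).
  by rewrite expr2; under eq_fun do rewrite expr2; exact: (cvgM c1 c1).
- move=> M; under eq_integral do rewrite -sqrrN opprB.
  have sMN := sqintB mT (partial_sqint t (M + N)) (partial_sqint t N).
  rewrite -(ip_sqr mT sMN) partial_diff_ip ?leq_addl// lee_fin lerBrDl.
  have -> : Sn N + \sum_(l <- index_iota N (M + N)) beta l ^+ 2 = Sn (M + N).
    rewrite /Sn -!(big_mkord xpredT (fun l => beta l ^+ 2)).
    by rewrite [RHS](big_cat_nat (n := N))//= leq_addl.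
  exact: (nondecreasing_cvgn_le Sn_nd cvg_Sn).
Qed.

Lemma x_partial_cvg t :
  (fun N => ip (fun w => partial t N w - x t w) (fun w => partial t N w - x t w)) @ \oo --> (0 : R).
Proof.
apply: (@squeeze_cvgr _ _ _ _ (cst 0) (fun N => S - Sn N)).
- by apply: nearW => N; rewrite ip_ge0 x_partial_dist.
- exact: cvg_cst.
- rewrite -(subrr S); apply: cvgB; [exact: cvg_cst|exact: cvg_Sn].
Qed.

(** The shifts are there because blocks cut off at one common error time leave [x t] and [x s] with
    different numbers of lags. *)
Lemma partial_ip_cvg t s k k' :
  (fun N => ip (partial t (N - k)) (partial s (N - k'))) @ \oo --> ip (x t) (x s).
Proof.
apply: (ip_cvg mT (f := fun N => partial t (N - k)) (g := fun N => partial s (N - k'))).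
- by move=> N; exact: partial_sqint.
- by move=> N; exact: partial_sqint.
- exact: la_x_sqint.
- exact: la_x_sqint.
- by have := x_partial_cvg t; rewrite -(cvg_centern k).
- by have := x_partial_cvg s; rewrite -(cvg_centern k').
Qed.

(** By orthogonality, lags [l] and [l'] interact at distance h only when they point to the same
    error time, l' = h + l. Each pair of lags thus counts for at most one h, and the total is at
    most the square of the sum of [beta]. *)
Lemma autocovariance_summable : exists B, forall H : nat,
  \sum_(0 <= m < H.*2.+1) `|ip (x 0) (x (m%:Z - H%:Z))| <= B.
Proof.
have [B hB] := la_summable la; have B0 : 0 <= B by have := hB 0%N; rewrite big_ord0.
exists (B * B) => H.
have lim : (fun N => \sum_(0 <= m < H.*2.+1) `|ip (partial 0 N) (partial (m%:Z - H%:Z) N)|) @ \oo -->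
    \sum_(0 <= m < H.*2.+1) `|ip (x 0) (x (m%:Z - H%:Z))|.
  apply: cvgn_sum => m; apply: cvg_norm.
  by have := @partial_ip_cvg 0 (m%:Z - H%:Z) 0 0; under eq_fun do rewrite !subn0.
apply: (ler_cvg_to lim (cvg_cst (B * B))); apply: nearW => N.
have bnd m : `|ip (partial 0 N) (partial (m%:Z - H%:Z) N)| <=
    \sum_(l < N) \sum_(l' < N) (if (l' : nat)%:Z == m%:Z - H%:Z + l%:Z then beta l * beta l' else 0).
  rewrite ip_suml//; last exact: partial_sqint.
  apply: le_trans (ler_norm_sum _ _ _) _; apply: ler_sum => l _.
  rewrite ip_sumr//; apply: le_trans (ler_norm_sum _ _ _) _; apply: ler_sum => l' _.
  case: eqP => [E|E].
    apply: le_trans (cauchy_schwarz mT _ _) _ => //.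
    by rewrite !(la_ip la) !sqrtr_sqr !ger0_norm ?(la_beta_ge0 la).
  rewrite (la_orth la) ?normr0//; apply/eqP => E'; apply: E.
  lia.
apply: le_trans (ler_sum _ (fun m _ => bnd m)) _.
rewrite exchange_big/=.
apply: (@le_trans _ _ (\sum_(l < N) \sum_(l' < N) beta l * beta l')); last first.
  under eq_bigr => l _ do rewrite -mulr_sumr.
  rewrite -mulr_suml; apply: ler_pM => //; apply: sumr_ge0 => l _; exact: (la_beta_ge0 la).
apply: ler_sum => l _; rewrite exchange_big/=; apply: ler_sum => l' _.
have b0 : 0 <= beta l * beta l' by rewrite mulr_ge0 ?(la_beta_ge0 la).
rewrite -big_mkcond/=.
(* For given lags at most one [m] contributes; the second condition says that it is not negative. *)
have eqm (m : nat) : ((l' : nat)%:Z == m%:Z - H%:Z + l%:Z) = (m == absz ((l' : nat)%:Z + H%:Z - (l : nat)%:Z)%R) && (l <= l' + H)%N.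
  by apply/idP/idP; lia.
rewrite big_mkord; under eq_bigl => m do rewrite eqm.
case: (leqP l (l' + H)) => h; last by rewrite big_pred0// => m; rewrite andbF.
under eq_bigl => m do rewrite andbT.
set j := absz _.
have [jH|jH] := ltnP j H.*2.+1.
  by rewrite (big_pred1 (Ordinal jH))// => m; rewrite -val_eqE.
by rewrite big_pred0// => m; apply/negbTE; rewrite neq_ltn (leq_trans (ltn_ord m) jH).
Qed.

Section time_blocks.
Variables (top : int) (C : finType) (k : C -> nat).

(** Block [b] collects the contributions of the errors of time [top - b]. The process at time
    [top - k c] sees them with lag [b - k c], and not at all when [b < k c], as they lie in its
    future. *)
Definition time_block (b : nat) (c : C) : T -> R :=
  if (k c <= b)%N then z (b - k c) (top - b%:Z) else fun=> 0.

Lemma time_block_sqint b c : sqint (time_block b c).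
Proof. by rewrite /time_block; case: ifP => _; [exact: sz|exact: sqint0]. Qed.

Lemma time_block_ip b c : ip (time_block b c) (time_block b c) =
  if (k c <= b)%N then beta (b - k c) ^+ 2 else 0.
Proof.
rewrite /time_block; case: ifP => _; first exact: (la_ip la).
by rewrite -[RHS](mul0r (ip (fun=> 0) (fun=> 0))) -ipZl//; [congr ip; apply/funext => w; rewrite mul0r|exact: sqint0|exact: sqint0].
Qed.

(** Keeping [M] blocks truncates each coordinate at its own number of lags; natural subtraction
    yields the empty sum when [M < k c]. *)
Lemma sum_time_block M c w :
  \sum_(b < M) time_block b c w = partial (top - (k c)%:Z) (M - k c) w.
Proof.
rewrite /partial -(big_mkord xpredT (fun b => time_block b c w)).
under eq_bigr => b _ do rewrite /time_block (fun_if (fun f => f w)).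
rewrite -big_mkcond/= -(big_mkord xpredT (fun l => z l (top - (k c)%:Z - l%:Z) w)).
have [kM|Mk] := leqP (k c) M; last first.
  rewrite (eqP (ltnW Mk : _ - _ == 0)%N) [RHS]big_geq// big_nat_cond big_pred0// => b.
  by apply/negP => /andP[/andP[_ bM] kb]; have := leq_ltn_trans kb bM; rewrite ltnNge (ltnW Mk).
rewrite (big_cat_nat (n := k c))//=.
have -> : \sum_(0 <= b < k c | (k c <= b)%N) z (b - k c) (top - b%:Z) w = 0.
  rewrite big_nat_cond big_pred0// => b.
  by apply/negP => /andP[/andP[_ bk]]; rewrite leqNgt bk.
rewrite add0r.
rewrite -{1}(add0n (k c)) big_addn; apply: eq_big => b; first by rewrite leq_addl.
by move=> _; rewrite addnK PoszD opprD addrA addrAC.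
Qed.

Definition block_comb (u : C -> R) (b : nat) (w : T) := \sum_c u c * time_block b c w.

Lemma block_comb_sqint u b : sqint (block_comb u b).
Proof.
by apply: sqint_sum => // c; apply: sqintZ => //; exact: time_block_sqint.
Qed.

Lemma time_block_orth b b' c c' : b != b' -> ip (time_block b c) (time_block b' c') = 0.
Proof.
move=> bb'; rewrite /time_block.
have ip0 f : sqint f -> ip (fun=> 0) f = 0.
  move=> sf; rewrite -[RHS](mul0r (ip (fun=> 0) f)) -ipZl//; last exact: sqint0.
  by congr ip; apply/funext => w; rewrite mul0r.
case: ifP => _; case: ifP => _; rewrite ?ip0//; [|by rewrite ipC ip0|exact: sqint0].
by apply: (la_orth la); exact: lag_neq.
Qed.

Lemma block_comb_orth u b b' : b != b' -> ip (block_comb u b) (block_comb u b') = 0.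
Proof.
move=> bb'; rewrite ip_suml//; last 2 first.
- by move=> c; apply: sqintZ => //; exact: time_block_sqint.
- exact: block_comb_sqint.
rewrite big1// => c _; rewrite ip_sumr//; last 2 first.
- by move=> c'; apply: sqintZ => //; exact: time_block_sqint.
- by apply: sqintZ => //; exact: time_block_sqint.
rewrite big1// => c' _; rewrite ipZl ?ipZr ?time_block_orth ?mulr0//.
- exact: time_block_sqint.
- exact: time_block_sqint.
- exact: time_block_sqint.
- by apply: sqintZ => //; exact: time_block_sqint.
Qed.

(* The covariance form of x dominates its truncation to finitely many
   innovation times, because innovations at distinct times are orthogonal. *)
Lemma block_comb_le u M :
  \sum_(b < M) ip (block_comb u b) (block_comb u b) <=
  ip (fun w => \sum_c u c * x (top - (k c)%:Z) w) (fun w => \sum_c u c * x (top - (k c)%:Z) w).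
Proof.
pose g N := \sum_(b < N) ip (block_comb u b) (block_comb u b).
have gE N : g N = \sum_c \sum_c' u c * (u c' *
    ip (partial (top - (k c)%:Z) (N - k c)) (partial (top - (k c')%:Z) (N - k c'))).
  rewrite /g -(ip_sum_orthogonal (F := fun b : 'I_N => block_comb u b)) ?index_enum_uniq//; last 2 first.
  - by move=> b; exact: block_comb_sqint.
  - by move=> b b' bb'; exact: block_comb_orth.
  have -> : (fun w => \sum_(b < N) block_comb u b w) =
      (fun w => \sum_c u c * partial (top - (k c)%:Z) (N - k c) w).
    apply/funext => w; rewrite exchange_big/=; apply: eq_bigr => c _.
    by rewrite -mulr_sumr sum_time_block.
  rewrite ip_suml//; last 2 first.
  - by move=> c; apply: sqintZ => //; exact: partial_sqint.
  - by apply: sqint_sum => // c; apply: sqintZ => //; exact: partial_sqint.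
  apply: eq_bigr => c _; rewrite ip_sumr//; last 2 first.
  - by move=> c'; apply: sqintZ => //; exact: partial_sqint.
  - by apply: sqintZ => //; exact: partial_sqint.
  apply: eq_bigr => c' _; rewrite ipZl ?ipZr//; try exact: partial_sqint.
  by apply: sqintZ => //; exact: partial_sqint.
have limE : ip (fun w => \sum_c u c * x (top - (k c)%:Z) w) (fun w => \sum_c u c * x (top - (k c)%:Z) w) =
    \sum_c \sum_c' u c * (u c' * ip (x (top - (k c)%:Z)) (x (top - (k c')%:Z))).
  have sx t := la_x_sqint t.
  rewrite ip_suml//; last 2 first.
  - by move=> c; apply: sqintZ.
  - by apply: sqint_sum => // c; apply: sqintZ.
  apply: eq_bigr => c _; rewrite ip_sumr//; last 2 first.
  - by move=> c'; apply: sqintZ.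
  - exact: sqintZ.
  apply: eq_bigr => c' _; rewrite ipZl ?ipZr//; exact: sqintZ.
have gl : g @ \oo --> \sum_c \sum_c' u c * (u c' * ip (x (top - (k c)%:Z)) (x (top - (k c')%:Z))).
  rewrite (_ : g = (fun N => \sum_c \sum_c' u c * (u c' *
    ip (partial (top - (k c)%:Z) (N - k c)) (partial (top - (k c')%:Z) (N - k c'))))); last exact/funext.
  apply: cvgn_sum => c; apply: cvgn_sum => c'.
  by apply: cvgM; [exact: cvg_cst|apply: cvgM; [exact: cvg_cst|exact: partial_ip_cvg]].
rewrite limE -(cvg_lim _ gl)//; apply: (nondecreasing_cvgn_le (u_ := g)); last by apply: cvgP gl.
by apply/nondecreasing_seqP => N; rewrite /g big_ord_recr/= lerDl ip_ge0.
Qed.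

Lemma block_comb_subgaussian u b :
  (\int[P]_w (expR (block_comb u b w))%:E <=
   (expR (alpha2 * ip (block_comb u b) (block_comb u b) / 2))%:E)%E.
Proof.
(* Several coordinates may see this error at the same lag; their coefficients add up. *)
pose a l := \sum_(c | (k c <= b)%N && (b - k c == l)%N) u c.
have E : block_comb u b = (fun w => \sum_(l < b.+1) a l * z l (top - b%:Z) w).
  apply/funext => w; rewrite /block_comb /a.
  under [RHS]eq_bigr => l _ do rewrite mulr_suml big_mkcond.
  rewrite exchange_big/=; apply: eq_bigr => c _; rewrite /time_block.
  case: ifP => kb; last by rewrite mulr0 big1.
  have bk : (b - k c < b.+1)%N by rewrite ltnS leq_subr.
  rewrite (bigD1 (Ordinal bk))//= eqxx big1 ?addr0// => l.
  by rewrite -val_eqE/= eq_sym => /negbTE ->.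
by rewrite E; exact: (la_subgaussian la).
Qed.

End time_blocks.

End linear_arrays.

Lemma ae_forall_fin d (T : measurableType d) (R : realType)
    (mu : {measure set T -> \bar R}) (I : finType) (Q : I -> T -> Prop) :
  (forall i, {ae mu, forall x, Q i x}) -> {ae mu, forall x, forall i, Q i x}.
Proof.
move=> h; have : {ae mu, forall x, forall i, i \in enum I -> Q i x}.
  elim: (enum I) => [|i s ih]; first exact: nearW.
  apply: filterS2 (h i) ih => x Qi Qs j; rewrite inE => /orP[/eqP -> //|]; exact: Qs.
by apply: filterS => x Qx i; apply: Qx; rewrite mem_enum.
Qed.

(** * Sums of squares for two linear processes *)

Section two_processes.
Context d (T : measurableType d) (R : realType) (P : probability T R).
Local Notation sqint := (sqint P setT).
Local Notation ip := (ip P setT).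

(** The partial sums increase to the second moment of [x t]. *)
Lemma la_ip_partial_le (alpha2 : R) z x beta (la : linear_array P alpha2 z x beta) t N :
  \sum_(l < N) beta l ^+ 2 <= ip (x t) (x t).
Proof.
have l := partial_ip_cvg la (t := t) (s := t) 0 0.
have E : (fun N => ip (partial z t (N - 0)) (partial z t (N - 0))) =
    (fun N => \sum_(l < N) beta l ^+ 2).
  by apply/funext => M; rewrite subn0 (partial_ip la).
rewrite E in l; rewrite -(cvg_lim _ l)//.
by apply: (nondecreasing_cvgn_le (u_ := fun N => \sum_(l < N) beta l ^+ 2));
  [exact: Sn_nd|exact: (cvg_Sn la)].
Qed.

(** Injectivity makes the lags [b - k c] distinct, so each value of [F] is used at most once. *)
Lemma sum_injective_lags (C : finType) (k : C -> nat) (F : nat -> R) (b : nat) :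
  injective k -> (forall l, 0 <= F l) ->
  \sum_(c | (k c <= b)%N) F (b - k c)%N <= \sum_(l < b.+1) F l.
Proof.
move=> kI F0.
have -> : \sum_(c | (k c <= b)%N) F (b - k c)%N =
    \sum_(l < b.+1) \sum_(c | (k c <= b)%N && ((l : nat) == b - k c)%N) F l.
  rewrite (exchange_big_dep (fun c => (k c <= b)%N))/=; last by move=> l c _ /andP[].
  apply: eq_bigr => c kb; have bk : (b - k c < b.+1)%N by rewrite ltnS leq_subr.
  by rewrite (big_pred1 (Ordinal bk))// => l; rewrite /= kb.
apply: ler_sum => l _.
have [/existsP[c /andP[kc /eqP lc]]|] := boolP [exists c, (k c <= b)%N && ((l : nat) == b - k c)%N].
  rewrite (big_pred1 c)// => c'; apply/andP/eqP => [[kc' /eqP lc']|->]; last by rewrite kc lc.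
  by apply: kI; apply/eqP; lia.
rewrite negb_exists => /forallP h; rewrite big_pred0// => c; exact/negbTE.
Qed.

Variables (aX aY a2 : R) (zX zY : nat -> int -> T -> R) (x y : int -> T -> R).
Variables (betaX betaY : nat -> R).
Hypothesis laX : linear_array P aX zX x betaX.
Hypothesis laY : linear_array P aY zY y betaY.
Hypothesis cross : forall l l' s s', s != s' -> ip (zX l s) (zY l' s') = 0.
Hypothesis indep : forall (B C : finType) (tau : B -> int) (L : nat)
    (a a' : B -> C -> nat -> R), injective tau ->
  blocks_independent P (fun b c w => \sum_(l < L) a b c l * zX l (tau b) w +
                                     \sum_(l < L) a' b c l * zY l (tau b) w).
Hypotheses (aXa : aX <= a2) (aYa : aY <= a2) (a20 : 0 < a2).

Variables (top : int) (C : finType) (kx ky : C -> nat) (KX KY : R).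
Hypotheses (kxI : injective kx) (kyI : injective ky) (C0 : (0 < #|C|)%N).
Let X c := x (top - (kx c)%:Z).
Let Y c := y (top - (ky c)%:Z).
Hypothesis hKX : forall u : C -> R,
  ip (fun w => \sum_c u c * X c w) (fun w => \sum_c u c * X c w) <= KX * \sum_c u c ^+ 2.
Hypothesis hKY : forall u : C -> R,
  ip (fun w => \sum_c u c * Y c w) (fun w => \sum_c u c * Y c w) <= KY * \sum_c u c ^+ 2.
Hypothesis KXY : 0 < KX + KY.

Let K := 4 * a2 * (KX + KY).
Let mT := @measurableT _ T.

Let xi M (b : 'I_M.+1) (c : C) (w : T) : R := time_block zX top kx b c w + time_block zY top ky b c w.

Let tX b c := time_block_sqint laX top kx b c.
Let tY b c := time_block_sqint laY top ky b c.

Let sxi M b c : sqint (@xi M b c).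
Proof. exact: sqintD. Qed.

Let mxi M b c : measurable_fun setT (@xi M b c).
Proof. by case: (@sxi M b c). Qed.

(** Written over all lags below [M] with coefficients 0 and 1, a block takes the form in which
    [indep] is stated. *)
Lemma time_block_sum (z : nat -> int -> T -> R) (k : C -> nat) M b c w : (b < M)%N ->
  time_block z top k b c w =
  \sum_(l < M) ((k c <= b)%N && ((l : nat) == b - k c)%N)%:R * z l (top - b%:Z) w.
Proof.
move=> bM; rewrite /time_block; case: ifP => kb; last by rewrite big1// => l _; rewrite mul0r.
have bk : (b - k c < M)%N by apply: leq_ltn_trans bM; rewrite leq_subr.
rewrite (bigD1 (Ordinal bk))//= eqxx mul1r big1 ?addr0// => l.
by rewrite -val_eqE/= => /negbTE ->; rewrite mul0r.
Qed.

Let ixi M : blocks_independent P (@xi M).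
Proof.
have -> : @xi M = (fun b c w =>
    \sum_(l < M.+1) ((kx c <= b)%N && ((l : nat) == b - kx c)%N)%:R * zX l (top - (b : nat)%:Z) w +
    \sum_(l < M.+1) ((ky c <= b)%N && ((l : nat) == b - ky c)%N)%:R * zY l (top - (b : nat)%:Z) w).
  by apply/funext => b; apply/funext => c; apply/funext => w; rewrite /xi !(@time_block_sum _ _ M.+1).
apply: (@indep _ C (fun b : 'I_M.+1 => top - (b : nat)%:Z) M.+1
  (fun b c l => ((kx c <= b)%N && (l == b - kx c)%N)%:R)
  (fun b c l => ((ky c <= b)%N && (l == b - ky c)%N)%:R)).
by move=> b b' /addrI /oppr_inj [] /val_inj.
Qed.

Let cX u b := block_comb zX top kx u b.
Let cY u b := block_comb zY top ky u b.
Let Q (b : nat) u := 4 * a2 * (ip (cX u b) (cX u b) + ip (cY u b) (cY u b)).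

Let scX u b : sqint (cX u b) := block_comb_sqint laX top kx u b.
Let scY u b : sqint (cY u b) := block_comb_sqint laY top ky u b.

Lemma block_comb_scale (z : nat -> int -> T -> R) (k : C -> nat) (r : R) u b :
  block_comb z top k (fun c => r * u c) b = (fun w => r * block_comb z top k u b w).
Proof.
by apply/funext => w; rewrite /block_comb mulr_sumr; apply: eq_bigr => c _; rewrite mulrA.
Qed.

Lemma block_comb_delta (z : nat -> int -> T -> R) (k : C -> nat) (r : R) c b :
  block_comb z top k (fun c' => if c' == c then r else 0) b =
  (fun w => r * time_block z top k b c w).
Proof.
apply/funext => w; rewrite /block_comb (bigD1 c)//= eqxx big1 ?addr0// => c' /negbTE ->.
by rewrite mul0r.
Qed.

(** The errors of the two processes at one time may be dependent, so [expR_average] separates their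
    contributions; doubling them multiplies the variances by 4, hence the 4 in [Q] and in [K]. *)
Let subQ b u : (\int[P]_w (expR (cX u b w + cY u b w))%:E <= (expR (Q b u / 2))%:E)%E.
Proof.
have dbl (a : R) z x' beta (k : C -> nat) (la : linear_array P a z x' beta) : a <= a2 ->
    (\int[P]_w (expR (2 * block_comb z top k u b w))%:E <=
     (expR (2 * a2 * ip (block_comb z top k u b) (block_comb z top k u b)))%:E)%E.
  move=> aa2; have sc := block_comb_sqint la top k u b.
  have := block_comb_subgaussian la top k (fun c => 2 * u c) b.
  rewrite block_comb_scale ipZl ?ipZr//; last exact: sqintZ.
  move=> h; apply: le_trans h _; rewrite lee_fin ler_expR.
  have -> : a * (2 * (2 * ip (block_comb z top k u b) (block_comb z top k u b))) / 2 =
    2 * a * ip (block_comb z top k u b) (block_comb z top k u b) by field.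
  by rewrite ler_wpM2r ?ip_ge0// ler_wpM2l.
have mX : measurable_fun setT (cX u b) by case: (scX u b).
have mY : measurable_fun setT (cY u b) by case: (scY u b).
have mE (f : T -> R) (r : R) : measurable_fun setT f -> measurable_fun setT (fun w => expR (r * f w)).
  by move=> mf; apply: measurableT_comp => //; exact: measurable_funM.
apply: (@le_trans _ _ (\int[P]_w (2^-1 * expR (2 * cX u b w) + 2^-1 * expR (2 * cY u b w))%:E)%E).
  apply: ge0_le_integral_fin.
  - by apply: measurableT_comp => //; exact: measurable_funD.
  - by apply: measurable_funD; apply: measurable_funM => //; exact: mE.
  - by move=> w; exact: expR_ge0.
  - by move=> w; apply: le_trans (expR_average _ _) _; lra.
rewrite ge0_integralD_fin; last 4 first.
- by apply: measurable_funM => //; exact: mE.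
- by apply: measurable_funM => //; exact: mE.
- by move=> w; rewrite mulr_ge0 ?expR_ge0.
- by move=> w; rewrite mulr_ge0 ?expR_ge0.
rewrite !ge0_integralZl_fin ?invr_ge0//; try exact: mE.
set e := expR _.
have -> : e%:E = ((2^-1)%:E * e%:E + (2^-1)%:E * e%:E)%E.
  by rewrite -!EFinM -EFinD; congr EFin; field.
have a22 : 0 <= 2 * a2 by rewrite mulr_ge0// ltW.
have h1 := mulr_ge0 a22 (ip_ge0 P setT (cX u b)).
have h2 := mulr_ge0 a22 (ip_ge0 P setT (cY u b)).
apply: leeD; apply: lee_wpmul2l; rewrite ?lee_fin ?invr_ge0//.
  by apply: le_trans (dbl _ _ _ _ _ laX aXa) _; rewrite lee_fin ler_expR /Q; lra.
by apply: le_trans (dbl _ _ _ _ _ laY aYa) _; rewrite lee_fin ler_expR /Q; lra.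
Qed.

Let xi_comb M (b : 'I_M.+1) u w : \sum_c u c * xi b c w = cX u b w + cY u b w.
Proof.
rewrite /cX /cY /block_comb -big_split/=; apply: eq_bigr => c _.
by rewrite -mulrDr.
Qed.

Let v (b : nat) c := 4 * a2 * (ip (time_block zX top kx b c) (time_block zX top kx b c) +
  ip (time_block zY top ky b c) (time_block zY top ky b c)).

Let a4 : 0 <= 4 * a2. Proof. by rewrite mulr_ge0// ltW. Qed.

(** Both bounds come from the one on quadratic forms. A unit vector [u] in [block_comb_le] bounds
    one coordinate summed over the blocks. For one block summed over the coordinates, injectivity of
    [k] makes the lags distinct, and the squared [beta] add up to at most the second moment of a
    single variable. *)
Lemma covariance_bound_ge (a : R) z x' beta (la : linear_array P a z x' beta) (k : C -> nat) K' :
  (forall u : C -> R, ip (fun w => \sum_c u c * x' (top - (k c)%:Z) w)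
     (fun w => \sum_c u c * x' (top - (k c)%:Z) w) <= K' * \sum_c u c ^+ 2) ->
  injective k ->
  (forall c M, \sum_(b < M) ip (time_block z top k b c) (time_block z top k b c) <= K') /\
  (forall b, \sum_c ip (time_block z top k b c) (time_block z top k b c) <= K').
Proof.
move=> hK' kI.
have delta2 (c : C) : \sum_c' (if c' == c then 1 else 0 : R) ^+ 2 = 1.
  rewrite (bigD1 c)//= eqxx expr1n big1 ?addr0// => c' /negbTE ->.
  by rewrite expr0n.
split=> [c M|b].
  have := block_comb_le la top k (fun c' => if c' == c then 1 else 0) M.
  move=> /le_trans /(_ (hK' _)); rewrite delta2 mulr1; apply: le_trans.
  rewrite le_eqVlt; apply/orP; left; apply/eqP; apply: eq_bigr => b _.
  by rewrite block_comb_delta; congr ip; apply/funext => w; rewrite mul1r.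
have /card_gt0P[c0 _] := C0.
have xK : ip (x' (top - (k c0)%:Z)) (x' (top - (k c0)%:Z)) <= K'.
  have := hK' (fun c' => if c' == c0 then 1 else 0); rewrite delta2 mulr1; apply: le_trans.
  rewrite le_eqVlt; apply/orP; left; apply/eqP; congr ip; apply/funext => w;
  by rewrite (bigD1 c0)//= eqxx mul1r big1 ?addr0// => c' /negbTE ->; rewrite mul0r.
apply: le_trans _ xK; apply: le_trans _ (la_ip_partial_le la (top - (k c0)%:Z) b.+1).
under eq_bigr => c _ do rewrite (time_block_ip la).
by rewrite -big_mkcond/=; apply: (sum_injective_lags (F := fun l => beta l ^+ 2) b kI) => l; exact: sqr_ge0.
Qed.

Let xi_orth M (b b' : 'I_M.+1) c : b != b' -> ip (xi b c) (xi b' c) = 0.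
Proof.
move=> bb'; have bb'n : (b : nat) != b' by [].
have cz l l' b1 b2 : b1 != b2 -> ip (zX l (top - b1%:Z)) (zY l' (top - b2%:Z)) = 0.
  by move=> b12; apply: cross; exact: lag_neq.
have ip0 f : sqint f -> ip (fun=> 0) f = 0.
  move=> sf; rewrite -[RHS](mul0r (ip (fun=> 0) f)) -ipZl//; last exact: sqint0.
  by congr ip; apply/funext => w; rewrite mul0r.
have ct b1 b2 : b1 != b2 -> ip (time_block zX top kx b1 c) (time_block zY top ky b2 c) = 0.
  move=> b12; have := tX b1 c; have := tY b2 c; rewrite /time_block.
  case: ifP => _; case: ifP => _ => s2 s1; rewrite ?ip0//; first exact: cz.
  by rewrite ipC ip0.
rewrite /xi (ipDl mT)//; last exact: sqintD.
rewrite !(ipDr mT)// (time_block_orth laX)// (time_block_orth laY)// ct//.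
by rewrite (ipC _ _ (time_block zY _ _ _ _)) ct 1?eq_sym// !addr0.
Qed.

Let pX c N := partial zX (top - (kx c)%:Z) (N - kx c).
Let pY c N := partial zY (top - (ky c)%:Z) (N - ky c).

Let sum_xi M c w : \sum_(b < M.+1) xi b c w = pX c M.+1 w + pY c M.+1 w.
Proof. by rewrite /xi big_split/= !sum_time_block. Qed.

(** [hanson_wright_mgf] for the first [M.+1] blocks, with a bound that does not depend on [M]. *)
Let trunc_mgf M lam : `|lam| <= (64 * K)^-1 ->
  (\int[P]_w (expR (lam * (\sum_c (pX c M.+1 w + pY c M.+1 w) ^+ 2 -
     \sum_c ip (fun w => pX c M.+1 w + pY c M.+1 w) (fun w => pX c M.+1 w + pY c M.+1 w))))%:E <=
   (expR (16384 * #|C|%:R * lam ^+ 2 * K ^+ 2))%:E)%E.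
Proof.
move=> lamK.
have [XcM Xb] := covariance_bound_ge laX hKX kxI.
have [YcM Yb] := covariance_bound_ge laY hKY kyI.
have := @hanson_wright_mgf _ T R P _ C (@xi M) Q v (fun b c => ip (xi b c) (xi b c)) K
  (@mxi M) (@ixi M) _ _ _ _ _ _ _ _ _ C0 _ lam lamK.
have cE : \sum_b \sum_c ip (@xi M b c) (xi b c) =
    \sum_c ip (fun w => pX c M.+1 w + pY c M.+1 w) (fun w => pX c M.+1 w + pY c M.+1 w).
  rewrite exchange_big/=; apply: eq_bigr => c _.
  rewrite -(ip_sum_orthogonal (F := fun b : 'I_M.+1 => xi b c)) ?index_enum_uniq//; last first.
    by move=> b b' bb'; exact: xi_orth.
  by congr ip; apply/funext => w; exact: sum_xi.
rewrite cE; under eq_integral do under eq_bigr do rewrite sum_xi.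
apply.
- move=> b u; rewrite /Q; apply: mulr_ge0 => //; apply: addr_ge0; exact: ip_ge0.
- move=> u; rewrite -mulr_sumr big_split/= /K -[leRHS]mulrA ler_wpM2l// mulrDl.
  apply: lerD; first by apply: le_trans (block_comb_le laX top kx u M.+1) (hKX u).
  by apply: le_trans (block_comb_le laY top ky u M.+1) (hKY u).
- by move=> b u; under eq_integral do rewrite xi_comb; exact: subQ.
- move=> b c; rewrite /v; apply: mulr_ge0 => //; apply: addr_ge0; exact: ip_ge0.
- move=> b c s; have := subQ b (fun c' => if c' == c then s else 0).
  under eq_integral do rewrite /cX /cY !block_comb_delta -mulrDr.
  move=> /le_trans; apply; rewrite lee_fin ler_expR /Q /cX /cY !block_comb_delta.
  have sX := tX b c; have sY := tY b c.
  rewrite !ipZl ?ipZr//; try exact: sqintZ.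
  by rewrite le_eqVlt; apply/orP; left; apply/eqP; rewrite /v; field.
- move=> b; rewrite -mulr_sumr big_split/= ler_wpM2l//; apply: lerD; [exact: Xb|exact: Yb].
- rewrite exchange_big/=.
  apply: (@le_trans _ _ (\sum_(c : C) K)); last by rewrite sumr_const (mulr_natl K).
  apply: ler_sum => c _; rewrite -mulr_sumr big_split/= ler_wpM2l//.
  by apply: lerD; [exact: XcM|exact: YcM].
- by move=> b c; rewrite ip_sqr.
- by rewrite /K !mulr_gt0.
- by rewrite card_ord.
Qed.

(** Fatou's lemma applied to [trunc_mgf]. The truncations converge in L_2 as well as almost surely,
    so the second moments that centre the sum converge too. *)
Theorem two_process_mgf lam : `|lam| <= (64 * K)^-1 ->
  (\int[P]_w (expR (lam * (\sum_c (X c w + Y c w) ^+ 2 -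
     \sum_c ip (fun w => X c w + Y c w) (fun w => X c w + Y c w))))%:E <=
   (expR (16384 * #|C|%:R * lam ^+ 2 * K ^+ 2))%:E)%E.
Proof.
move=> lamK.
have spX c N : sqint (pX c N) by exact: partial_sqint laX _ _.
have spY c N : sqint (pY c N) by exact: partial_sqint laY _ _.
have sX c : sqint (X c) by exact: la_x_sqint laX _.
have sY c : sqint (Y c) by exact: la_x_sqint laY _.
have mS (f : C -> T -> R) (r : R) : (forall c, measurable_fun setT (f c)) ->
    measurable_fun setT (fun w => expR (lam * (\sum_c f c w ^+ 2 - r))).
  move=> mf; apply: measurableT_comp => //; apply: measurable_funM => //.
  apply: measurable_funB => //; apply: measurable_sum => c; exact: measurable_funX.
have cip : (fun M => \sum_c ip (fun w => pX c M.+1 w + pY c M.+1 w) (fun w => pX c M.+1 w + pY c M.+1 w)) @ \oo -->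
    \sum_c ip (fun w => X c w + Y c w) (fun w => X c w + Y c w).
  apply: cvgn_sum => c.
  have dX : (fun N => ip (fun w => pX c N w - X c w) (fun w => pX c N w - X c w)) @ \oo --> (0 : R).
    by have := x_partial_cvg laX (top - (kx c)%:Z); rewrite -(cvg_centern (kx c)).
  have dY : (fun N => ip (fun w => pY c N w - Y c w) (fun w => pY c N w - Y c w)) @ \oo --> (0 : R).
    by have := x_partial_cvg laY (top - (ky c)%:Z); rewrite -(cvg_centern (ky c)).
  rewrite (cvg_shiftS (fun M => ip (fun w => pX c M w + pY c M w) (fun w => pX c M w + pY c M w))).
  have E N : ip (fun w => pX c N w + pY c N w) (fun w => pX c N w + pY c N w) =
      ip (pX c N) (pX c N) + 2 * ip (pX c N) (pY c N) + ip (pY c N) (pY c N).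
    rewrite (ipDl mT)//; last exact: sqintD.
    by rewrite !(ipDr mT)// (ipC _ _ (pY c N) (pX c N)); ring.
  have E' : ip (fun w => X c w + Y c w) (fun w => X c w + Y c w) =
      ip (X c) (X c) + 2 * ip (X c) (Y c) + ip (Y c) (Y c).
    rewrite (ipDl mT)//; last exact: sqintD.
    by rewrite !(ipDr mT)// (ipC _ _ (Y c) (X c)); ring.
  rewrite E'; under eq_fun do rewrite E.
  apply: cvgD; [apply: cvgD|]; first exact: (ip_cvg mT (spX c) (spX c)).
    by apply: cvgM; [exact: cvg_cst|exact: (ip_cvg mT (spX c) (spY c))].
  exact: (ip_cvg mT (spY c) (spY c)).
apply: (@fatou_ae_le _ _ _ P (fun M w => expR (lam * (\sum_c (pX c M.+1 w + pY c M.+1 w) ^+ 2 -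
     \sum_c ip (fun w => pX c M.+1 w + pY c M.+1 w) (fun w => pX c M.+1 w + pY c M.+1 w))))).
- by move=> M; apply: mS => c; apply: measurable_funD; [case: (spX c M.+1)|case: (spY c M.+1)].
- by apply: mS => c; apply: measurable_funD; [case: (sX c)|case: (sY c)].
- by move=> M w; exact: expR_ge0.
- by move=> w; exact: expR_ge0.
- have aeX : {ae P, forall w, forall c, (fun M => pX c M.+1 w) @ \oo --> X c w}.
    apply: ae_forall_fin => c; apply: filterS (la_cvg laX (top - (kx c)%:Z)) => w.
    by rewrite -(cvg_centern (kx c)) -cvg_shiftS.
  have aeY : {ae P, forall w, forall c, (fun M => pY c M.+1 w) @ \oo --> Y c w}.
    apply: ae_forall_fin => c; apply: filterS (la_cvg laY (top - (ky c)%:Z)) => w.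
    by rewrite -(cvg_centern (ky c)) -cvg_shiftS.
  apply: filterS2 aeX aeY => w cXw cYw.
  apply: continuous_cvg; first exact: continuous_expR.
  apply: cvgM; first exact: cvg_cst.
  apply: cvgB => //; apply: cvgn_sum => c.
  rewrite expr2; under eq_fun do rewrite expr2.
  by apply: cvgM; apply: cvgD.
- by move=> M; exact: trunc_mgf.
Qed.

End two_processes.

(** * Fourier coefficients and Toeplitz forms *)

Section trigonometric_bound.
Context (R : realType).
Local Notation leb := (@lebesgue_measure R).
Let D : set R := `[- pi, pi]%classic.
Let mD : @measurable _ (measurableTypeR R) D. Proof. exact: measurable_itv. Qed.
Local Notation ip := (ip leb D).
Local Notation sqint := (sqint leb D).

(** Cosines suffice, since only the real part of the quadratic form of f_theta enters
    [stability]. *)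
Definition cosine (h : int) (theta : R) : R := cos (h%:~R * theta).

Lemma continuous_cosine h : continuous (cosine h).
Proof.
rewrite (_ : cosine h = cos \o ( *%R h%:~R)) // => t.
by apply: continuous_comp; [exact: mulrl_continuous|exact: continuous_cos].
Qed.

Lemma continuous_sqint (f : R -> R) : continuous f -> sqint f.
Proof.
move=> cf; split; first exact: measurable_funTS (continuous_measurable_fun cf).
apply: (@continuous_compact_integrable R (fun x => f x ^+ 2)); first exact: segment_compact.
apply: continuous_subspaceT => t.
by apply: (@continuousM _ _ f f); exact: cf.
Qed.

Lemma cosine_sqint h : sqint (cosine h).
Proof. exact/continuous_sqint/continuous_cosine. Qed.

Lemma sin_int_pi (h : int) : sin (h%:~R * pi) = 0 :> R.
Proof.
have nat0 n : sin (n%:R * pi) = 0 :> R.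
  elim: n => [|n ih]; first by rewrite mul0r sin0.
  by rewrite -natr1 mulrDl mul1r sinDpi ih oppr0.
case: (intP h) => [|n|n]; first by rewrite mul0r sin0.
  by rewrite -pmulrn nat0.
by rewrite mulrNz mulNr sinN -pmulrn nat0 oppr0.
Qed.

(** For [h != 0] the primitive sin(h t) / h vanishes at both ends of the interval. *)
Lemma integral_cosine (h : int) : ip (cosine h) (fun=> 1) = if h == 0 then 2 * pi else 0.
Proof.
have pi0 := @pi_gt0 R.
case: eqVneq => [->|h0].
  rewrite /ip (_ : (fun x => _) = (fun=> 1)); last first.
    by apply/funext => t; rewrite /cosine mul0r cos0 mulr1.
  rewrite Rintegral_cst// mul1r; have := lebesgue_measure_itv (`[- pi, pi] : interval R).
  rewrite /= lte_fin (_ : - pi < pi) /=; last lra.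
  by move=> E; transitivity (fine ((pi : R) - - pi)%:E); [congr fine; exact: E|rewrite /=; ring].
have hR0 : h%:~R != 0 :> R by rewrite intr_eq0.
rewrite /ip /Rintegral; under eq_integral do rewrite mulr1.
set a : R := h%:~R in hR0.
pose F : R -> R := a^-1 \*: (sin \o (a \*: (id : R -> R))).
have dF t : is_derive t (1 : R) F (cosine h t).
  have d1 : is_derive t (1 : R) (a \*: (id : R -> R)) (a *: (1 : R)) by exact: is_deriveZ.
  have d2 : is_derive t (1 : R) (sin \o (a \*: (id : R -> R))) (cos (a * t) * (a *: (1 : R))).
    exact: is_derive1_comp.
  apply: is_derive_eq (is_deriveZ a^-1 d2) _.
  by rewrite /cosine -/a /GRing.scale/= mulr1 mulrC mulfK.
have dFt t : derivable F t 1 by case: (dF t).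
have cF : continuous F by move=> t; apply/differentiable_continuous/derivable1_diffP.
rewrite (@continuous_FTC2 _ _ F)//; first last.
- by move=> t _; rewrite derive1E; case: (dF t).
- split; first by move=> t _; exact: dFt.
  + by apply: cvg_at_right_filter; exact: cF.
  + by apply: cvg_at_left_filter; exact: cF.
- by apply: continuous_subspaceT; exact: continuous_cosine.
- lra.
rewrite -EFinB /F /= /GRing.scale/= /a mulrN sinN sin_int_pi.
by rewrite oppr0 mulr0 subrr.
Qed.

Lemma cosine_mul h k t : cosine h t * cosine k t = 2^-1 * (cosine (h + k) t + cosine (h - k) t).
Proof. by rewrite /cosine !intrD mulrNz !mulrDl mulNr cosD cosB; field. Qed.

(** Product-to-sum formula. Both indicators equal 1 when [h = k = 0], which gives the 2 pi of the
    constant function. *)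
Lemma ip_cosine h k : ip (cosine h) (cosine k) =
  pi * ((h == k)%:R + (h == - k)%:R).
Proof.
have s1 : sqint (fun=> 1) by exact/continuous_sqint/cst_continuous.
transitivity (ip (fun t => 2^-1 * (cosine (h + k) t + cosine (h - k) t)) (fun=> 1)).
  by rewrite /ip; apply: eq_Rintegral => t _; rewrite mulr1 cosine_mul.
have sc := cosine_sqint.
rewrite ipZl//; last exact: sqintD.
rewrite ipDl// !integral_cosine subr_eq0 addr_eq0.
by case: (h == k); case: (h == - k); rewrite /= ?mulr1n ?mulr0n; field.
Qed.

(** The sum is the squared modulus of the sum of u_c e^(i k_c t), here the real part squared plus
    the imaginary part squared. *)
Lemma trig_form_ge0 (C : finType) (k : C -> int) (u : C -> R) t :
  0 <= \sum_c \sum_c' u c * u c' * cosine (k c' - k c) t.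
Proof.
have -> : \sum_c \sum_c' u c * u c' * cosine (k c' - k c) t =
    (\sum_c u c * cosine (k c) t) ^+ 2 + (\sum_c u c * sin ((k c)%:~R * t)) ^+ 2.
  rewrite !expr2 !big_distrl/= -big_split/=; apply: eq_bigr => c _.
  rewrite !big_distrr/= -big_split/=; apply: eq_bigr => c' _.
  by rewrite /cosine intrB mulrBl cosB; ring.
by rewrite addr_ge0 ?sqr_ge0.
Qed.

Definition two_sided_sum (f : int -> R) (N : nat) : R :=
  \sum_(0 <= m < N.*2.+1) f (m%:Z - N%:Z).

Lemma two_sided_sum_delta (f : int -> R) (k : int) (N : nat) : (`|k| <= N)%N ->
  two_sided_sum (fun h => f h * (h == k)%:R) N = f k.
Proof.
move=> kN; rewrite /two_sided_sum big_mkord.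
have jN : (absz (k + N%:Z)%R < N.*2.+1)%N by lia.
rewrite (bigD1 (Ordinal jN))//= big1 ?addr0; last first.
  move=> m mj; case: eqP => E; last by rewrite mulr0.
  by case/eqP: mj; apply: val_inj => /=; lia.
have -> : (absz (k + N%:Z)%R)%:Z - N%:Z = k by lia.
by rewrite eqxx mulr1.
Qed.

(* Integrate the partial Fourier sums against the nonnegative trigonometric
   polynomial |sum_c u_c e^(i k_c theta)|^2. *)
Lemma spectral_form_bound (gam : int -> R) (g : R -> R) (M B : R)
    (C : finType) (k : C -> int) (u : C -> R) :
  (forall N, two_sided_sum (fun h => `|gam h|) N <= B) ->
  (forall t, D t -> two_sided_sum (fun h => gam h * cosine h t) @ \oo --> g t) ->
  {ae leb, forall t, D t -> g t <= M} -> injective k ->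
  \sum_c \sum_c' u c * u c' * gam (k c' - k c) <= M * \sum_c u c ^+ 2.
Proof.
move=> gB gl gM kI; have pi0 := @pi_gt0 R.
have sc := cosine_sqint.
pose w t := \sum_c \sum_c' u c * u c' * cosine (k c' - k c) t.
pose gN N t := two_sided_sum (fun h => gam h * cosine h t) N.
have sw : sqint w by do 2!(apply: sqint_sum => // ?); exact: sqintZ.
have sgN N : sqint (gN N) by apply: sqint_sum => // m; exact: sqintZ.
have s1 : sqint (fun=> 1) by exact/continuous_sqint/cst_continuous.
have mw : measurable_fun D w by case: sw.
have w0 t : 0 <= w t by exact: trig_form_ge0.
have mg : measurable_fun D g.
  apply: (measurable_fun_cvg (h := gN)); first by move=> N; case: (sgN N).
  exact: gl.
have gNB N t : `|gN N t| <= B.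
  apply: le_trans (gB N); apply: le_trans (ler_norm_sum _ _ _) _.
  apply: ler_sum => m _; rewrite normrM ler_piMr//; exact: cos_max.
have B0 : 0 <= B by apply: le_trans (gNB 0%N 0).
pose fN N t : \bar R := ((M - gN N t) * w t)%:E.
(* The absolute value makes the limit function nonnegative everywhere; it changes nothing almost
   everywhere. *)
pose f t : \bar R := (`|M - g t| * w t)%:E.
have [] := @dominated_convergence _ _ R leb D mD fN f (fun t => ((`|M| + B) * w t)%:E).
- move=> N; apply/measurable_EFinP; apply: measurable_funM => //.
  by apply: measurable_funB => //; case: (sgN N).
- apply/measurable_EFinP; apply: measurable_funM => //.
  by apply: measurableT_comp => //; exact: measurable_funB.
- apply: (@filterS _ _ (ae_filter_ringOfSetsType leb)) gM => t gMt Dt.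
  rewrite /f ger0_norm ?subr_ge0 ?gMt//; apply: cvg_EFin; first exact: nearW.
  by apply: cvgM; [apply: cvgB; [exact: cvg_cst|exact: gl]|exact: cvg_cst].
- have := sqint_mul mD (sqintZ mD (`|M| + B) sw) s1.
  by under eq_fun do rewrite mulr1.
- apply: aeW => t N _; rewrite lee_fin normrM (ger0_norm (w0 t)) ler_wpM2r//.
  by apply: le_trans (ler_normB _ _) _; rewrite lerD2l.
move=> _ _ lim0.
have I0 : (0 <= \int[leb]_(t in D) f t)%E.
  by apply: integral_ge0 => t _; rewrite lee_fin mulr_ge0.
have wE : ip w (fun=> 1) = 2 * pi * \sum_c u c ^+ 2.
  rewrite ip_suml//; last by move=> c; apply: sqint_sum => // c'; exact: sqintZ.
  rewrite mulr_sumr; apply: eq_bigr => c _.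
  rewrite ip_suml//; last by move=> c'; exact: sqintZ.
  rewrite (bigD1 c)//= big1 ?addr0; last first.
    move=> c' c'c; rewrite ipZl// integral_cosine subr_eq0.
    by rewrite (inj_eq kI) (negbTE c'c) mulr0.
  by rewrite ipZl// integral_cosine subrr eqxx; ring.
pose G := \sum_c \sum_c' u c * u c' * gam (k c' - k c).
(* Cosines pick up both gam h and gam (- h); exchanging the two indices shows that each contributes
   [G]. *)
have GE : G = \sum_c \sum_c' u c * u c' * gam (- (k c' - k c)).
  rewrite /G exchange_big/=; apply: eq_bigr => c _; apply: eq_bigr => c' _.
  by rewrite opprB [u c' * _]mulrC.
(* A crude bound on all frequencies of [w]: from there on the pairing of [w] with the partial sum is
   constant in [N]. *)
pose K0 := (\sum_c \sum_c' `|(k c' - k c)%R|)%N.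
have gwE N : (K0 <= N)%N -> ip (gN N) w = 2 * pi * G.
  move=> KN; have -> : 2 * pi * G = pi * (G + \sum_c \sum_c' u c * u c' * gam (- (k c' - k c))).
    by rewrite -GE; ring.
  rewrite ipC ip_suml//; last by move=> c; apply: sqint_sum => // c'; exact: sqintZ.
  rewrite /G -big_split/= mulr_sumr; apply: eq_bigr => c _.
  rewrite ip_suml//; last by move=> c'; exact: sqintZ.
  rewrite -big_split/= mulr_sumr; apply: eq_bigr => c' _.
  rewrite ipZl// ipC ip_suml//; last by move=> m; exact: sqintZ.
  have kN : (`|(k c' - k c)%R| <= N)%N.
    apply: leq_trans KN; rewrite /K0 (bigD1 c)//= (bigD1 c')//= -addnA; exact: leq_addr.
  have kN' : (`|(- (k c' - k c))%R| <= N)%N by rewrite abszN.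
  transitivity (u c * u c' * (pi * (gam (k c' - k c) + gam (- (k c' - k c))))); last by ring.
  congr (_ * _); rewrite -{1}(two_sided_sum_delta gam kN) -{1}(two_sided_sum_delta gam kN').
  rewrite /two_sided_sum -big_split/= mulr_sumr; apply: eq_bigr => m _.
  by rewrite ipZl// ip_cosine; ring.
have fNE N : (K0 <= N)%N -> (\int[leb]_(t in D) fN N t = (2 * pi * (M * \sum_c u c ^+ 2 - G))%:E)%E.
  move=> KN; have sMw := sqintZ mD M sw.
  transitivity (ip (fun t => M * 1 - gN N t) w)%:E.
    rewrite /ip /Rintegral fineK; first by apply: eq_integral => t _; rewrite mulr1.
    apply: integrable_fin_num => //; apply: sqint_mul => //.
    by apply: sqintB => //; exact: sqintZ.
  congr EFin; rewrite ipBl//; last exact: sqintZ.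
  by rewrite ipZl// (ipC _ _ (fun=> 1)) wE gwE//; ring.
have lim : [sequence (\int[leb]_(t in D) fN N t)%E]_N @ \oo --> (2 * pi * (M * \sum_c u c ^+ 2 - G))%:E.
  apply: cvg_near_cst; exists K0 => // N /= KN; exact: fNE.
have E : (\int[leb]_(t in D) f t = (2 * pi * (M * \sum_c u c ^+ 2 - G))%:E)%E.
  by apply: (cvg_unique _ lim0 lim).
by move: I0; rewrite E lee_fin pmulr_rge0 ?mulr_gt0// subr_ge0.
Qed.

End trigonometric_bound.

(** * Integral operators with square-integrable kernels *)

Section square_integrable_kernels.
Context d1 d2 (T1 : measurableType d1) (T2 : measurableType d2) (R : realType).
Variable m1 : {sigma_finite_measure set T1 -> \bar R}.
Variable m2 : {sigma_finite_measure set T2 -> \bar R}.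
Local Notation m12 := (m1 \x m2)%E.
Implicit Types (K : T1 * T2 -> R) (f : T1 -> R) (g : T2 -> R).

(** Tonelli's theorem gives measurability for nonnegative functions, and the integral of a signed
    function is the difference of those of its two parts. *)
Lemma measurable_partial_integral1 K : measurable_fun setT K ->
  measurable_fun setT (fun x => \int[m2]_y (K (x, y))%:E)%E.
Proof.
move=> mK; have mKE : measurable_fun setT (EFin \o K) by exact/measurable_EFinP.
have -> : (fun x => \int[m2]_y (K (x, y))%:E)%E =
    (fun x => fubini_F m2 (EFin \o K)^\+ x - fubini_F m2 (EFin \o K)^\- x)%E.
  apply/funext => x; rewrite integralE /fubini_F.
  by congr (_ - _)%E; apply: eq_integral => y _; rewrite !(funeposE, funenegE).
apply: emeasurable_funB; apply: measurable_fun_fubini_tonelli_F => //.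
  exact: measurable_funepos.
exact: measurable_funeneg.
Qed.

Lemma measurable_partial_integral2 K : measurable_fun setT K ->
  measurable_fun setT (fun y => \int[m1]_x (K (x, y))%:E)%E.
Proof.
move=> mK; have mKE : measurable_fun setT (EFin \o K) by exact/measurable_EFinP.
have -> : (fun y => \int[m1]_x (K (x, y))%:E)%E =
    (fun y => fubini_G m1 (EFin \o K)^\+ y - fubini_G m1 (EFin \o K)^\- y)%E.
  apply/funext => y; rewrite integralE /fubini_G.
  by congr (_ - _)%E; apply: eq_integral => x _; rewrite !(funeposE, funenegE).
apply: emeasurable_funB; apply: measurable_fun_fubini_tonelli_G => //.
  exact: measurable_funepos.
exact: measurable_funeneg.
Qed.

Lemma measurable_section1 K x : measurable_fun setT K -> measurable_fun setT (fun y => K (x, y)).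
Proof. by move=> mK; exact: measurableT_comp mK _. Qed.

Lemma measurable_section2 K y : measurable_fun setT K -> measurable_fun setT (fun x => K (x, y)).
Proof. by move=> mK; exact: measurableT_comp mK _. Qed.

Definition kint1 K g (x : T1) : R := \int[m2]_y (K (x, y) * g y).
Definition kint2 K f (y : T2) : R := \int[m1]_x (f x * K (x, y)).
Definition bilin f K g : R := \int[m12]_z (f z.1 * K z * g z.2).

Lemma measurable_kint1 K g : measurable_fun setT K -> measurable_fun setT g ->
  measurable_fun setT (kint1 K g).
Proof.
move=> mK mg; apply: measurableT_comp => //=.
apply: (measurable_partial_integral1 (K := fun z => K z * g z.2)).
by apply: measurable_funM => //; exact: measurableT_comp.
Qed.

Lemma measurable_kint2 K f : measurable_fun setT K -> measurable_fun setT f ->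
  measurable_fun setT (kint2 K f).
Proof.
move=> mK mf; apply: measurableT_comp => //=.
apply: (measurable_partial_integral2 (K := fun z => f z.1 * K z)).
by apply: measurable_funM => //; exact: measurableT_comp.
Qed.

Lemma tensor_sqint f g : sqint m1 setT f -> sqint m2 setT g ->
  sqint m12 setT (fun z => f z.1 * g z.2) /\
  ip m12 setT (fun z => f z.1 * g z.2) (fun z => f z.1 * g z.2) =
  ip m1 setT f f * ip m2 setT g g.
Proof.
move=> sf sg; have [mf f2] := sf; have [mg g2] := sg.
have mfg : measurable_fun setT (fun z : T1 * T2 => f z.1 * g z.2).
  by apply: measurable_funM; exact: measurableT_comp.
have E : (\int[m12]_z ((f z.1 * g z.2) ^+ 2)%:E = (ip m1 setT f f * ip m2 setT g g)%:E)%E.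
  rewrite fubini_tonelli1//; last 2 first.
  - by apply/measurable_EFinP; exact: measurable_funX.
  - by move=> z; rewrite lee_fin sqr_ge0.
  rewrite EFinM !ip_sqr// /fubini_F.
  transitivity (\int[m1]_x ((f x ^+ 2)%:E * \int[m2]_y (g y ^+ 2)%:E))%E.
    apply: eq_integral => x _; under eq_integral do rewrite exprMn /=.
    apply: ge0_integralZl_fin; [exact: measurable_funX| |exact: sqr_ge0].
    by move=> y; exact: sqr_ge0.
  apply: ge0_integralZr => //.
  - by apply/measurable_EFinP; exact: measurable_funX.
  - by move=> x _; rewrite lee_fin sqr_ge0.
  - by apply: integral_ge0 => y _; rewrite lee_fin sqr_ge0.
have sfg : sqint m12 setT (fun z => f z.1 * g z.2).
  split => //; apply/integrableP; split.
    by apply/measurable_EFinP; exact: measurable_funX.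
  by under eq_integral do rewrite /= ger0_norm ?sqr_ge0//; rewrite E ltry.
by split=> //; apply: EFin_inj; rewrite ip_sqr.
Qed.

Lemma bilin_integrable f K g : sqint m1 setT f -> sqint m12 setT K -> sqint m2 setT g ->
  m12.-integrable setT (fun z => (f z.1 * K z * g z.2)%:E).
Proof.
move=> sf sK sg; have [sfg _] := tensor_sqint sf sg.
have := sqint_mul measurableT sK sfg; apply: eq_integrable => // z _.
by congr EFin; ring.
Qed.

Lemma bilin_ip f K g : bilin f K g = ip m12 setT K (fun z => f z.1 * g z.2).
Proof. by apply: eq_Rintegral => z _; ring. Qed.

Lemma bilin_le f K g : sqint m1 setT f -> sqint m12 setT K -> sqint m2 setT g ->
  `|bilin f K g| <= Num.sqrt (ip m1 setT f f) * Num.sqrt (ip m12 setT K K) *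
    Num.sqrt (ip m2 setT g g).
Proof.
move=> sf sK sg; have [sfg E] := tensor_sqint sf sg.
rewrite bilin_ip; apply: le_trans (cauchy_schwarz _ sK sfg) _ => //.
rewrite E sqrtrM ?ip_ge0// le_eqVlt; apply/orP; left; apply/eqP; ring.
Qed.

Lemma ae_section1_sqint K : sqint m12 setT K ->
  {ae m1, forall x, sqint m2 setT (fun y => K (x, y))}.
Proof.
move=> [mK K2]; apply: filterS (ae_integrable1 K2) => x Kx.
by split=> //; exact: measurable_section1.
Qed.

Lemma ae_section2_sqint K : sqint m12 setT K ->
  {ae m2, forall y, sqint m1 setT (fun x => K (x, y))}.
Proof.
move=> [mK K2]; apply: filterS (ae_integrable2 K2) => y Ky.
by split=> //; exact: measurable_section2.
Qed.

(** Fubini's theorem. The factor [f x] leaves the inner integral for every [x] whose section is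
    square integrable, hence almost everywhere. *)
Lemma kint1_bilin f K g : sqint m1 setT f -> sqint m12 setT K -> sqint m2 setT g ->
  m1.-integrable setT (fun x => (f x * kint1 K g x)%:E) /\
  \int[m1]_x (f x * kint1 K g x) = bilin f K g.
Proof.
move=> sf sK sg; have ifKg := bilin_integrable sf sK sg.
have [mf _] := sf; have [mg _] := sg; have [mK _] := sK.
have mfk : measurable_fun setT (fun x => f x * kint1 K g x).
  by apply: measurable_funM => //; exact: measurable_kint1.
have aeE : ae_eq m1 setT (fun x => (f x * kint1 K g x)%:E)
    (fubini_F m2 (fun z => (f z.1 * K z * g z.2)%:E)).
  apply: filterS (ae_section1_sqint sK) => x Kx _.
  have i1 := sqint_mul measurableT Kx sg.
  rewrite /kint1 -RintegralZl// /fubini_F /Rintegral fineK.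
    by apply: eq_integral => y _; rewrite mulrA.
  apply: integrable_fin_num => //; under eq_fun do rewrite EFinM.
  exact: integrableZl.
have mfkE : measurable_fun setT (fun x => (f x * kint1 K g x)%:E) by exact/measurable_EFinP.
have iF := integrable_fubini_F ifKg.
have mF : measurable_fun setT (fubini_F m2 (fun z => (f z.1 * K z * g z.2)%:E)).
  by case/integrableP: iF.
split.
  apply/integrableP; split => //.
  have -> : (\int[m1]_x `|(f x * kint1 K g x)%:E| =
      \int[m1]_x `|fubini_F m2 (fun z => (f z.1 * K z * g z.2)%:E) x|)%E.
    apply: ge0_ae_eq_integral => //; try exact: measurableT_comp.
    by apply: (filterS _ aeE) => x + xT => /(_ xT) ->.
  by case/integrableP: iF.
rewrite /bilin /Rintegral -(integral12_prod_meas1 ifKg); congr fine.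
exact: ae_eq_integral.
Qed.

Lemma kint2_bilin f K g : sqint m1 setT f -> sqint m12 setT K -> sqint m2 setT g ->
  \int[m2]_y (kint2 K f y * g y) = bilin f K g.
Proof.
move=> sf sK sg; have ifKg := bilin_integrable sf sK sg.
have [mf _] := sf; have [mg _] := sg; have [mK _] := sK.
have mfk : measurable_fun setT (fun y => kint2 K f y * g y).
  by apply: measurable_funM => //; exact: measurable_kint2.
have aeE : ae_eq m2 setT (fun y => (kint2 K f y * g y)%:E)
    (fubini_G m1 (fun z => (f z.1 * K z * g z.2)%:E)).
  apply: filterS (ae_section2_sqint sK) => y Ky _.
  have i1 := sqint_mul measurableT sf Ky.
  rewrite /kint2 -RintegralZr// /fubini_G /Rintegral fineK//.
  apply: integrable_fin_num => //; under eq_fun do rewrite EFinM.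
  exact: integrableZr.
have mfkE : measurable_fun setT (fun y => (kint2 K f y * g y)%:E) by exact/measurable_EFinP.
have mG : measurable_fun setT (fubini_G m1 (fun z => (f z.1 * K z * g z.2)%:E)).
  exact: (measurable_fubini_G ifKg).
rewrite /bilin /Rintegral -(integral21_prod_meas1 ifKg); congr fine.
exact: ae_eq_integral.
Qed.

(** Cauchy-Schwarz on almost every section, then Tonelli: the Hilbert-Schmidt norm dominates the
    operator norm. *)
Lemma kint1_sqint K g : sqint m12 setT K -> sqint m2 setT g ->
  sqint m1 setT (kint1 K g) /\
  ip m1 setT (kint1 K g) (kint1 K g) <= ip m12 setT K K * ip m2 setT g g.
Proof.
move=> sK sg; have [mg _] := sg; have [mK K2] := sK.
have mk := measurable_kint1 mK mg.
have mK2 : measurable_fun setT (fun z => (K z ^+ 2)%:E) by case/integrableP: K2.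
have le : (\int[m1]_x (kint1 K g x ^+ 2)%:E <= (ip m12 setT K K * ip m2 setT g g)%:E)%E.
  apply: (@le_trans _ _ (\int[m1]_x ((\int[m2]_y (K (x, y) ^+ 2)%:E) * (ip m2 setT g g)%:E))%E).
    apply: ae_ge0_le_integral => //.
    - by move=> x _; rewrite lee_fin sqr_ge0.
    - by apply/measurable_EFinP; exact: measurable_funX.
    - move=> x _; rewrite mule_ge0 ?lee_fin ?ip_ge0//.
      by apply: integral_ge0 => y _; rewrite lee_fin sqr_ge0.
    - apply: emeasurable_funM => //.
      apply: (measurable_fun_fubini_tonelli_F (m2 := m2) _ mK2) => z.
      by rewrite lee_fin sqr_ge0.
    apply: (filterS _ (ae_section1_sqint sK)) => x Kx _.
    rewrite -ip_sqr// -EFinM lee_fin.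
    rewrite -(sqr_sqrtr (ip_ge0 m2 setT (fun y => K (x, y)))) -(sqr_sqrtr (ip_ge0 m2 setT g)).
    rewrite -exprMn -(real_normK (num_real (kint1 K g x))).
    apply: lerXn2r; rewrite ?nnegrE ?mulr_ge0 ?sqrtr_ge0//.
    exact: cauchy_schwarz.
  have -> : (\int[m1]_x ((\int[m2]_y (K (x, y) ^+ 2)%:E) * (ip m2 setT g g)%:E) =
      (ip m12 setT K K)%:E * (ip m2 setT g g)%:E)%E.
    rewrite [X in (_ = X * _)%E]ip_sqr// (fubini_tonelli1 _ mK2); last first.
      by move=> z; rewrite lee_fin sqr_ge0.
    apply: ge0_integralZr => //.
    - apply: (measurable_fun_fubini_tonelli_F (m2 := m2) _ mK2) => z.
      by rewrite lee_fin sqr_ge0.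
    - by move=> x _; apply: integral_ge0 => y _; rewrite lee_fin sqr_ge0.
    - by rewrite lee_fin ip_ge0.
  by rewrite EFinM.
have sk : sqint m1 setT (kint1 K g).
  split => //; apply/integrableP; split.
    by apply/measurable_EFinP; exact: measurable_funX.
  under eq_integral do rewrite /= ger0_norm ?sqr_ge0//.
  by apply: le_lt_trans le _; rewrite ltry.
by split=> //; rewrite -lee_fin ip_sqr.
Qed.

End square_integrable_kernels.

(** * From a domain to the whole space, by extension by zero *)

Section restriction.
Context d (T : measurableType d) (R : realType) (mu : {measure set T -> \bar R}).
Context (D : set T) (mD : measurable D).
Implicit Types f g : T -> R.

Lemma restrictE f x : (f \_ D) x = if x \in D then f x else 0.
Proof. by rewrite patchE. Qed.

Lemma restrict_mul f g : (fun x => (f \_ D) x * (g \_ D) x) = (fun x => f x * g x) \_ D.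
Proof.
by apply/funext => x; rewrite !restrictE; case: ifP => _; rewrite ?mul0r.
Qed.

Lemma sqint_restrict f : sqint mu D f <-> sqint mu setT (f \_ D).
Proof.
have E : (fun x => (((f \_ D) x) ^+ 2)%:E) = (fun x => (f x ^+ 2)%:E) \_ D.
  by apply/funext => x; rewrite restrictE patchE; case: ifP => _ //; rewrite expr0n.
split=> -[mf f2]; split.
- exact/(measurable_restrictT _ mD).
- by rewrite E; apply/(integrable_mkcond _ mD).
- exact/(measurable_restrictT _ mD).
- by apply/(integrable_mkcond _ mD); rewrite -E.
Qed.

Lemma ip_restrict f g : ip mu D f g = ip mu setT (f \_ D) (g \_ D).
Proof. by rewrite /ip Rintegral_mkcond restrict_mul. Qed.

Lemma integrable_restrictE f :
  mu.-integrable D (EFin \o f) <-> mu.-integrable setT (EFin \o (f \_ D)).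
Proof.
have -> : EFin \o (f \_ D) = (EFin \o f) \_ D.
  by apply/funext => x /=; rewrite restrictE patchE; case: ifP.
exact: integrable_mkcond.
Qed.

End restriction.

Section kernels_on_domains.
Context d1 d2 (T1 : measurableType d1) (T2 : measurableType d2) (R : realType).
Variable m1 : {sigma_finite_measure set T1 -> \bar R}.
Variable m2 : {sigma_finite_measure set T2 -> \bar R}.
Variables (D1 : set T1) (D2 : set T2).
Hypotheses (mD1 : measurable D1) (mD2 : measurable D2).
Local Notation m12 := (m1 \x m2)%E.
Implicit Types (K : T1 * T2 -> R) (f : T1 -> R) (g : T2 -> R).

Let mD12 : measurable (D1 `*` D2). Proof. exact: measurableX. Qed.

Definition kernel_apply K g (x : T1) : R := \int[m2]_(y in D2) (K (x, y) * g y).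
(** As an inner product over the product domain, it inherits linearity in [K] from [ip];
    [kernel_formE] recovers the iterated integral. *)
Definition kernel_form f K g : R := ip m12 (D1 `*` D2) K (fun z => f z.1 * g z.2).

Lemma kint1_restrict K g : kint1 m2 (K \_ (D1 `*` D2)) (g \_ D2) = kernel_apply K g \_ D1.
Proof.
apply/funext => x; rewrite restrictE /kint1 /kernel_apply [in RHS]Rintegral_mkcond.
case: ifPn => xD.
  apply: eq_Rintegral => y _; rewrite !restrictE.
  have -> : ((x, y) \in D1 `*` D2) = (y \in D2).
    by rewrite inE in xD; apply/idP/idP; rewrite !inE; [case|split].
  by case: ifP => _; rewrite ?mul0r.
rewrite (_ : (fun y => _) = cst 0) ?Rintegral_cst ?mul0r//.
apply/funext => y; rewrite !restrictE.
have -> : ((x, y) \in D1 `*` D2) = false.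
  by apply/negbTE; apply: contra xD; rewrite !inE => -[].
by rewrite mul0r.
Qed.

Lemma tensor_restrict f g : (fun z => (f \_ D1) z.1 * (g \_ D2) z.2) =
  (fun z => f z.1 * g z.2) \_ (D1 `*` D2).
Proof.
apply/funext => -[x y]; rewrite !restrictE /=.
have -> : ((x, y) \in D1 `*` D2) = (x \in D1) && (y \in D2).
  by apply/idP/andP; rewrite !inE.
by case: (x \in D1); case: (y \in D2); rewrite ?mul0r ?mulr0.
Qed.

Lemma tensor_sqint_on f g : sqint m1 D1 f -> sqint m2 D2 g ->
  sqint m12 (D1 `*` D2) (fun z => f z.1 * g z.2).
Proof.
move=> /(sqint_restrict _ mD1) sf /(sqint_restrict _ mD2) sg.
apply/(sqint_restrict _ mD12); rewrite -tensor_restrict.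
by have [] := tensor_sqint sf sg.
Qed.

Lemma kernel_form_restrict f K g :
  kernel_form f K g = bilin m1 m2 (f \_ D1) (K \_ (D1 `*` D2)) (g \_ D2).
Proof. by rewrite bilin_ip /kernel_form ip_restrict tensor_restrict. Qed.

Lemma kernel_formE f K g : sqint m1 D1 f -> sqint m12 (D1 `*` D2) K -> sqint m2 D2 g ->
  m1.-integrable D1 (fun x => (f x * kernel_apply K g x)%:E) /\
  \int[m1]_(x in D1) (f x * kernel_apply K g x) = kernel_form f K g.
Proof.
move=> /(sqint_restrict _ mD1) sf /(sqint_restrict _ mD12) sK /(sqint_restrict _ mD2) sg.
have [i1 e1] := kint1_bilin sf sK sg.
rewrite kernel_form_restrict -e1 kint1_restrict; split.
  apply/(integrable_restrictE _ mD1 (fun x => f x * kernel_apply K g x)).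
  by move: i1; rewrite kint1_restrict -restrict_mul.
by rewrite [LHS]Rintegral_mkcond -restrict_mul.
Qed.

Lemma kernel_form_le f K g : sqint m1 D1 f -> sqint m12 (D1 `*` D2) K -> sqint m2 D2 g ->
  `|kernel_form f K g| <= Num.sqrt (ip m1 D1 f f) * Num.sqrt (ip m12 (D1 `*` D2) K K) *
    Num.sqrt (ip m2 D2 g g).
Proof.
move=> /(sqint_restrict _ mD1) sf /(sqint_restrict _ mD12) sK /(sqint_restrict _ mD2) sg.
rewrite kernel_form_restrict !(ip_restrict _ D1) (ip_restrict _ D2) (ip_restrict _ (D1 `*` D2)).
exact: bilin_le.
Qed.

Lemma kernel_apply_sqint K g : sqint m12 (D1 `*` D2) K -> sqint m2 D2 g ->
  sqint m1 D1 (kernel_apply K g) /\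
  ip m1 D1 (kernel_apply K g) (kernel_apply K g) <=
  ip m12 (D1 `*` D2) K K * ip m2 D2 g g.
Proof.
move=> /(sqint_restrict _ mD12) sK /(sqint_restrict _ mD2) sg.
have [s1 e1] := kint1_sqint sK sg.
rewrite (ip_restrict _ D1) (ip_restrict _ D2) (ip_restrict _ (D1 `*` D2)) -kint1_restrict.
by split => //; apply/(sqint_restrict _ mD1); rewrite -kint1_restrict.
Qed.

End kernels_on_domains.

(** * Kernel forms on intervals, and adjoints inside the Hilbert space *)

Section function_kernels.
Context {R : realType}.
Local Notation leb := (@lebesgue_measure R).
Local Notation leb2 := (leb \x leb)%E.
Implicit Types (D H : set R).

Let unc (K : R -> R -> R) (z : measurableTypeR R * measurableTypeR R) : R := K z.1 z.2.

Lemma L2ker_sqint (D1 D2 : set R) K : L2ker D1 D2 K -> sqint leb2 (D1 `*` D2) (unc K).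
Proof. by []. Qed.

Lemma inner_ip D f g : inner D f g = ip leb D f g.
Proof. by []. Qed.

Definition kf (D1 D2 : set R) (f : R -> R) (K : R -> R -> R) (g : R -> R) : R :=
  kernel_form leb leb D1 D2 f (unc K) g.

Section forms.
Variables D1 D2 : set R.
Hypotheses (mD1 : @measurable _ (measurableTypeR R) D1)
           (mD2 : @measurable _ (measurableTypeR R) D2).

Lemma kf_le f K g : L2 D1 f -> L2ker D1 D2 K -> L2 D2 g ->
  `|kf D1 D2 f K g| <= norm2 D1 f * hsnorm D1 D2 K * norm2 D2 g.
Proof. move=> sf sK sg; exact: (kernel_form_le mD1 mD2 sf sK sg). Qed.

Lemma kop_integral f K g : L2 D1 f -> L2ker D1 D2 K -> L2 D2 g ->
  leb.-integrable D1 (fun u => (f u * (\int[leb]_(v in D2) (K u v * g v)))%:E) /\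
  \int[leb]_(u in D1) (f u * (\int[leb]_(v in D2) (K u v * g v))) = kf D1 D2 f K g.
Proof. move=> sf sK sg; exact: (kernel_formE mD1 mD2 sf sK sg). Qed.

Lemma kop_L2 K g : L2ker D1 D2 K -> L2 D2 g ->
  L2 D1 (fun u => \int[leb]_(v in D2) (K u v * g v)).
Proof. by move=> sK sg; have [] := kernel_apply_sqint mD1 mD2 sK sg. Qed.

Lemma kf_linearZ f k K g : L2 D1 f -> L2ker D1 D2 K -> L2 D2 g ->
  kf D1 D2 f (fun u v => k * K u v) g = k * kf D1 D2 f K g.
Proof.
move=> sf sK sg; apply: ipZl => //; first exact: measurableX.
exact: tensor_sqint_on.
Qed.

Lemma kf_linearB f K K' g : L2 D1 f -> L2ker D1 D2 K -> L2ker D1 D2 K' -> L2 D2 g ->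
  kf D1 D2 f (fun u v => K u v - K' u v) g = kf D1 D2 f K g - kf D1 D2 f K' g.
Proof.
move=> sf sK sK' sg; apply: ipBl => //; first exact: measurableX.
exact: tensor_sqint_on.
Qed.

Lemma kf_linear_sum (I : Type) (s : seq I) f (K : I -> R -> R -> R) g :
  L2 D1 f -> (forall i, L2ker D1 D2 (K i)) -> L2 D2 g ->
  kf D1 D2 f (fun u v => \sum_(i <- s) K i u v) g = \sum_(i <- s) kf D1 D2 f (K i) g.
Proof.
move=> sf sK sg; apply: (ip_suml _ _ (F := fun i => unc (K i))) => //; first exact: measurableX.
exact: tensor_sqint_on.
Qed.

Lemma L2ker_tensor f g : L2 D1 f -> L2 D2 g -> L2ker D1 D2 (fun u v => f u * g v).
Proof. by move=> sf sg; exact: (tensor_sqint_on mD1 mD2 sf sg). Qed.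

Lemma L2kerZ k K : L2ker D1 D2 K -> L2ker D1 D2 (fun u v => k * K u v).
Proof. by move=> sK; exact: (sqintZ (measurableX mD1 mD2) k (L2ker_sqint sK)). Qed.

Lemma L2kerB K K' : L2ker D1 D2 K -> L2ker D1 D2 K' -> L2ker D1 D2 (fun u v => K u v - K' u v).
Proof. by move=> sK sK'; exact: (sqintB (measurableX mD1 mD2) (L2ker_sqint sK) (L2ker_sqint sK')). Qed.

Lemma L2ker_sum (I : Type) (s : seq I) (K : I -> R -> R -> R) :
  (forall i, L2ker D1 D2 (K i)) -> L2ker D1 D2 (fun u v => \sum_(i <- s) K i u v).
Proof. by move=> sK; exact: (sqint_sum (measurableX mD1 mD2) s (fun i => L2ker_sqint (sK i))). Qed.

Lemma kf_tensor f f' g' g : L2 D1 f -> L2 D1 f' -> L2 D2 g' -> L2 D2 g ->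
  kf D1 D2 f (fun u v => f' u * g' v) g = inner D1 f f' * inner D2 g' g.
Proof.
move=> sf sf' sg' sg; have [_ <-] := kop_integral sf (L2ker_tensor sf' sg') sg.
have i2 := sqint_mul mD2 sg' sg; have i1 := sqint_mul mD1 sf sf'.
transitivity (\int[leb]_(u in D1) (f u * f' u * inner D2 g' g)).
  apply: eq_Rintegral => u _; rewrite -mulrA; congr (_ * _).
  rewrite /inner -RintegralZl//; apply: eq_Rintegral => v _; ring.
by rewrite RintegralZr.
Qed.

Lemma kformE q p (f : fvec R q) (K : kmat R q p) (g : fvec R p) :
  (forall i, L2 D1 (f i)) -> (forall i j, L2ker D1 D2 (K i j)) -> (forall j, L2 D2 (g j)) ->
  kform D1 D2 f K g = \sum_(i < q) \sum_(j < p) kf D1 D2 (f i) (K i j) (g j).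
Proof.
move=> sf sK sg; apply: eq_bigr => i _.
rewrite inner_ip ip_sumr//; [|by move=> j; exact: kop_L2|exact: sf].
by apply: eq_bigr => j _; have [_ <-] := kop_integral (sf i) (sK i j) (sg j).
Qed.

End forms.

Section adjoint.
Variables (D : set R) (HH : set (R -> R)).
Hypothesis mD : @measurable _ (measurableTypeR R) D.
Hypothesis hH : hilbert_in_L2 D HH.

Lemma hilbert_L2 f : HH f -> L2 D f.
Proof. by case: hH => h _ _ _; exact: h. Qed.

Lemma hilbert_lin (a : R) f g : HH f -> HH g -> HH (fun x => a * f x + g x).
Proof. by case: hH => _ [_ h] _ _; exact: h. Qed.

Lemma hilbert0 : HH (fun=> 0).
Proof. by case: hH => _ [h _] _ _. Qed.

Lemma hilbert_sum (I : Type) (s : seq I) (a : I -> R) (F : I -> R -> R) :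
  (forall i, HH (F i)) -> HH (fun x => \sum_(i <- s) a i * F i x).
Proof.
move=> hF; elim: s => [|i s ih].
  by under eq_fun do rewrite big_nil; exact: hilbert0.
by under eq_fun do rewrite big_cons; exact: hilbert_lin.
Qed.

Lemma kernel_adjoint A Phi : tensorH D HH A -> HH Phi ->
  exists b, [/\ HH b, forall g, L2 D g -> kf D D Phi A g = inner D b g &
    norm2 D b <= norm2 D Phi * hsnorm D D A].
Proof.
move=> [sA apA] hPhi; have sPhi := hilbert_L2 hPhi.
have /choice[K hK] n : exists K : R -> R -> R,
    [/\ L2ker D D K, hsnorm D D (fun u v => A u v - K u v) < n.+1%:R^-1 &
     exists2 x, HH x & forall g, L2 D g -> kf D D Phi K g = inner D x g].
  have [//|m [f [g [hf hg lt]]]] := apA n.+1%:R^-1.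
  exists (fun u v => \sum_(i < m) f i u * g i v).
  have sfg i : L2ker D D (fun u v => f i u * g i v).
    by apply: L2ker_tensor => //; exact: hilbert_L2.
  split => //; first exact: L2ker_sum.
  exists (fun v => \sum_(i < m) inner D Phi (f i) * g i v); first exact: hilbert_sum.
  move=> g' sg'; rewrite kf_linear_sum// inner_ip ip_suml//; last first.
    by move=> i; apply: sqintZ => //; exact: hilbert_L2.
  apply: eq_bigr => i _; rewrite kf_tensor//; [|exact: hilbert_L2|exact: hilbert_L2].
  by rewrite ipZl//; exact: hilbert_L2.
have /choice[x hx] n : exists x, HH x /\ forall g, L2 D g -> kf D D Phi (K n) g = inner D x g.
  by have [_ _ [x ? ?]] := hK n; exists x.
have hsx n : HH (x n) by case: (hx n).
have sx n : L2 D (x n) by exact: hilbert_L2.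
have ex n g : L2 D g -> kf D D Phi (K n) g = inner D (x n) g.
  by case: (hx n) => _; exact.
have sK n : L2ker D D (K n) by case: (hK n).
have lt n : hsnorm D D (fun u v => A u v - K n u v) < n.+1%:R^-1 by case: (hK n).
(* The squared distance is the form of [K m - K n] at [Phi] and [x m - x n]; one factor of the
   distance cancels. *)
have dist m n : norm2 D (fun v => x m v - x n v) <=
    norm2 D Phi * (m.+1%:R^-1 + n.+1%:R^-1).
  have sd : L2 D (fun v => x m v - x n v) by exact: (sqintB mD (sx m) (sx n)).
  set N := norm2 D _; have N0 : 0 <= N by exact: sqrtr_ge0.
  have N2 : N ^+ 2 <= norm2 D Phi * (m.+1%:R^-1 + n.+1%:R^-1) * N.
    have -> : N ^+ 2 = kf D D Phi (fun u v => K m u v - K n u v) (fun v => x m v - x n v).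
      rewrite kf_linearB// !ex// -[RHS](ipBl mD (sx m) (sx n) sd).
      by apply: sqr_sqrtr; exact: ip_ge0.
    have sKd := L2kerB mD mD (sK m) (sK n).
    apply: le_trans (ler_norm _) _; apply: le_trans (kf_le mD mD sPhi sKd sd) _.
    apply: ler_wpM2r => //; apply: ler_wpM2l; first exact: sqrtr_ge0.
    have tri := ip_sumsq_le_dist (measurableX mD mD)
      (L2ker_sqint (L2kerB mD mD sA (sK n))) (sqintN (measurableX mD mD) (L2ker_sqint (L2kerB mD mD sA (sK m)))).
    have E1 : (fun z => (A z.1 z.2 - K n z.1 z.2) + - (A z.1 z.2 - K m z.1 z.2)) =
        (fun z : measurableTypeR R * measurableTypeR R => K m z.1 z.2 - K n z.1 z.2).
      by apply/funext => z; ring.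
    have E2 : ip leb2 (D `*` D) (fun z => - (A z.1 z.2 - K m z.1 z.2)) (fun z => - (A z.1 z.2 - K m z.1 z.2)) =
        ip leb2 (D `*` D) (fun z => A z.1 z.2 - K m z.1 z.2) (fun z => A z.1 z.2 - K m z.1 z.2).
      by apply: eq_Rintegral => z _; rewrite mulrNN.
    rewrite /unc E1 E2 in tri; apply: le_trans tri _; rewrite addrC.
    by apply: lerD; apply: ltW; exact: lt.
  have [N00|N00] := eqVneq N 0; first by rewrite N00 mulr_ge0 ?sqrtr_ge0// addr_ge0.
  have Np : 0 < N by rewrite lt_neqAle eq_sym N00.
  by rewrite -(ler_pM2r Np) -expr2.
have cauchy (e : R) : 0 < e -> exists N : nat, forall m n : nat,
    (N <= m)%N -> (N <= n)%N -> norm2 D (fun v => x m v - x n v) < e.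
  move=> e0; pose c := norm2 D Phi; have c0 : 0 <= c by exact: sqrtr_ge0.
  have := @cvg_harmonic R => /cvgrPdist_lt /(_ (e / (2 * (c + 1)))).
  (* Adding 1 keeps the denominator positive when [Phi] is null. *)
  have c1 : 0 < 2 * (c + 1) by rewrite mulr_gt0// ltr_wpDl.
  move=> /(_ (divr_gt0 e0 c1)) [N _ hN]; exists N => m n Nm Nn.
  apply: le_lt_trans (dist m n) _.
  have h k : (N <= k)%N -> k.+1%:R^-1 < e / (2 * (c + 1)).
    by move=> /hN /=; rewrite sub0r normrN ger0_norm// invr_ge0.
  apply: (@le_lt_trans _ _ ((c + 1) * (m.+1%:R^-1 + n.+1%:R^-1))).
    by rewrite ler_wpM2r ?addr_ge0// lerDl.
  have cp : 0 < c + 1 by rewrite ltr_wpDl.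
  have -> : e = (c + 1) * (e / (2 * (c + 1)) + e / (2 * (c + 1))).
    by field; rewrite gt_eqF.
  have lt2 : m.+1%:R^-1 + n.+1%:R^-1 < e / (2 * (c + 1)) + e / (2 * (c + 1)).
    by apply: ltrD; exact: h.
  by rewrite ltr_pM2l.
have [b hb cb] : exists2 b, HH b & (fun n => norm2 D (fun v => x n v - b v)) @ \oo --> (0 : R).
  by case: hH => _ _ _ compl; exact: compl.
have sb := hilbert_L2 hb.
have eb g : L2 D g -> kf D D Phi A g = inner D b g.
  move=> sg; apply/eqP; rewrite -subr_eq0 -normr_le0.
  pose bound n := norm2 D Phi * n.+1%:R^-1 * norm2 D g + norm2 D (fun v => x n v - b v) * norm2 D g.
  have cv0 : bound @ \oo --> (0 : R).
    rewrite -[X in _ --> X](addr0 0); apply: cvgD.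
      rewrite -[X in _ --> X](mul0r (norm2 D g)); apply: cvgMl.
      rewrite -[X in _ --> X](mulr0 (norm2 D Phi)); apply: cvgMr; exact: cvg_harmonic.
    by rewrite -[X in _ --> X](mul0r (norm2 D g)); apply: cvgMl.
  have le n : `|kf D D Phi A g - inner D b g| <= bound n.
    have -> : kf D D Phi A g - inner D b g =
        kf D D Phi (fun u v => A u v - K n u v) g + inner D (fun v => x n v - b v) g.
      have EB : inner D (fun v => x n v - b v) g = inner D (x n) g - inner D b g.
        exact: (ipBl mD (sx n) sb sg).
      by rewrite kf_linearB// EB -ex//; ring.
    apply: le_trans (ler_normD _ _) _; apply: lerD; last exact: (cauchy_schwarz mD (sqintB mD (sx n) sb) sg).
    apply: le_trans (kf_le mD mD sPhi (L2kerB mD mD sA (sK n)) sg) _.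
    by rewrite ler_wpM2r ?sqrtr_ge0// ler_wpM2l ?sqrtr_ge0// ltW.
  rewrite -(cvg_lim (@Rhausdorff R) cv0); apply: limr_ge.
    by apply/cvg_ex; exists 0.
  by apply: nearW => n; exact: le.
exists b; split=> //.
(* For the norm bound, the identity is tested at [g = b] and divided by the norm of [b]. *)
have [Nb0|Nb0] := eqVneq (norm2 D b) 0.
  by rewrite Nb0 mulr_ge0 ?sqrtr_ge0.
have Np : 0 < norm2 D b by rewrite lt_neqAle eq_sym Nb0 sqrtr_ge0.
rewrite -(ler_pM2r Np) -expr2 (_ : norm2 D b ^+ 2 = kf D D Phi A b); last first.
  by rewrite eb//; apply: sqr_sqrtr; exact: ip_ge0.
by apply: le_trans (ler_norm _) _; exact: kf_le.
Qed.

End adjoint.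

End function_kernels.

(** * Second-moment kernels *)

Section second_moment_kernels.
Context d1 d2 d3 (T : measurableType d1) (T1 : measurableType d2) (T2 : measurableType d3).
Context (R : realType).
Variable m0 : {sigma_finite_measure set T -> \bar R}.
Variable m1 : {sigma_finite_measure set T1 -> \bar R}.
Variable m2 : {sigma_finite_measure set T2 -> \bar R}.
Implicit Types (X : T * T1 -> R) (Y : T * T2 -> R).

Lemma ae_eq_Rintegral d' (T' : measurableType d') (mu : {measure set T' -> \bar R}) (D : set T')
    (f g : T' -> R) : measurable D -> measurable_fun D f -> measurable_fun D g ->
  {ae mu, forall x, D x -> f x = g x} -> \int[mu]_(x in D) f x = \int[mu]_(x in D) g x.
Proof.
move=> mD mf mg fg; congr fine; apply: ae_eq_integral => //; [exact/measurable_EFinP|exact/measurable_EFinP|].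
by apply: (filterS _ fg) => x h Dx; rewrite h.
Qed.

Definition moment_kernel X Y (z : T1 * T2) : R := \int[m0]_w (X (w, z.1) * Y (w, z.2)).

Lemma measurable_moment_kernel X Y : measurable_fun setT X -> measurable_fun setT Y ->
  measurable_fun setT (moment_kernel X Y).
Proof.
move=> mX mY; apply: measurableT_comp => //=.
apply: (measurable_partial_integral1 m0
  (K := fun z : (T1 * T2) * T => X (z.2, z.1.1) * Y (z.2, z.1.2))).
have m12 (h : (T1 * T2) * T -> T1) : measurable_fun setT h ->
    measurable_fun setT (fun z : (T1 * T2) * T => (z.2, h z)).
  by move=> mh; apply: measurable_fun_pair => //; exact: measurable_snd.
have m12' (h : (T1 * T2) * T -> T2) : measurable_fun setT h ->
    measurable_fun setT (fun z : (T1 * T2) * T => (z.2, h z)).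
  by move=> mh; apply: measurable_fun_pair => //; exact: measurable_snd.
have m11 : measurable_fun setT (fun z : (T1 * T2) * T => z.1.1).
  by apply: (measurableT_comp measurable_fst); exact: measurable_fst.
have m22 : measurable_fun setT (fun z : (T1 * T2) * T => z.1.2).
  by apply: (measurableT_comp measurable_snd); exact: measurable_fst.
apply: measurable_funM.
  exact: (measurableT_comp mX (m12 _ m11)).
exact: (measurableT_comp mY (m12' _ m22)).
Qed.

(** At almost every (u, v), Cauchy-Schwarz bounds the squared kernel by a product of second moments
    a(u) b(v), whose integral factorizes. *)
Lemma moment_kernel_sqint X Y :
  sqint (m0 \x m1)%E setT X -> sqint (m0 \x m2)%E setT Y ->
  sqint (m1 \x m2)%E setT (moment_kernel X Y).
Proof.
move=> sX sY; have [mX X2] := sX; have [mY Y2] := sY.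
have mK := measurable_moment_kernel mX mY.
split=> //.
have mK2 : measurable_fun setT (fun z => (moment_kernel X Y z ^+ 2)%:E).
  by apply/measurable_EFinP; exact: measurable_funX.
have fin d' (T' : measurableType d') (m : {sigma_finite_measure set T' -> \bar R}) (Z : T * T' -> R) :
    sqint (m0 \x m)%E setT Z ->
    (\int[m]_u \int[m0]_w (Z (w, u) ^+ 2)%:E < +oo)%E /\
    measurable_fun setT (fun u => \int[m0]_w (Z (w, u) ^+ 2)%:E)%E.
  move=> [mZ Z2].
  have mZ2 : measurable_fun setT (fun z => (Z z ^+ 2)%:E).
    by apply/measurable_EFinP; exact: measurable_funX.
  have Z0 z : (0 <= (Z z ^+ 2)%:E)%E by rewrite lee_fin sqr_ge0.
  split; last exact: (measurable_fun_fubini_tonelli_G (m1 := m0) _ mZ2 Z0).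
  have [_] := (integrableP _ _ _ Z2).
  under eq_integral => z _ do rewrite gee0_abs//.
  by rewrite (fubini_tonelli2 (m1 := m0) (m2 := m)).
have [finX mfX] := fin _ _ _ _ sX; have [finY mfY] := fin _ _ _ _ sY.
apply/integrableP; split => //.
have K0 z : (0 <= (moment_kernel X Y z ^+ 2)%:E)%E by rewrite lee_fin sqr_ge0.
under eq_integral => z _ do rewrite gee0_abs//.
rewrite (fubini_tonelli1 (m1 := m1) (m2 := m2))// /fubini_F.
pose a u := (\int[m0]_w (X (w, u) ^+ 2)%:E)%E; pose b v := (\int[m0]_w (Y (w, v) ^+ 2)%:E)%E.
have a0 u : (0 <= a u)%E by apply: integral_ge0 => w _; rewrite lee_fin sqr_ge0.
have b0 v : (0 <= b v)%E by apply: integral_ge0 => w _; rewrite lee_fin sqr_ge0.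
have B0 : (0 <= \int[m2]_v b v)%E by apply: integral_ge0.
have Bfin : (\int[m2]_v b v)%E \is a fin_num by rewrite ge0_fin_numE.
apply: (@le_lt_trans _ _ (\int[m1]_u ((\int[m2]_v b v) * a u))%E); last first.
  by rewrite ge0_integralZl// lte_mul_pinfty.
apply: ae_ge0_le_integral => //.
- by move=> u _; apply: integral_ge0 => v _; rewrite lee_fin sqr_ge0.
- exact: (measurable_fun_fubini_tonelli_F (m2 := m2) _ mK2 K0).
- by move=> u _; exact: mule_ge0.
- exact: emeasurable_funM.
apply: (filterS _ (ae_section2_sqint sX)) => u su _.
rewrite muleC -ge0_integralZl//.
apply: ae_ge0_le_integral => //.
- by apply: (measurableT_comp mK2).
- by move=> v _; exact: mule_ge0.
- exact: emeasurable_funM.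
apply: (filterS _ (ae_section2_sqint sY)) => v sv _.
rewrite /a /b -(ip_sqr measurableT su) -(ip_sqr measurableT sv) -EFinM lee_fin.
have cs := cauchy_schwarz measurableT su sv.
have -> : moment_kernel X Y (u, v) ^+ 2 = `|ip m0 setT (fun w => X (w, u)) (fun w => Y (w, v))| ^+ 2.
  by rewrite real_normK// num_real.
rewrite -(sqr_sqrtr (ip_ge0 m0 setT (fun w => X (w, u)))) -(sqr_sqrtr (ip_ge0 m0 setT (fun w => Y (w, v)))).
by rewrite -exprMn ler_pXn2r// ?nnegrE ?mulr_ge0 ?sqrtr_ge0.
Qed.

(** Fubini's theorem, repeatedly: the expectation is exchanged with the integral over each variable,
    the inner exchange being valid for almost every [u]. *)
Lemma moment_kernel_form X Y f g :
  sqint (m0 \x m1)%E setT X -> sqint (m0 \x m2)%E setT Y ->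
  sqint m1 setT f -> sqint m2 setT g ->
  bilin m1 m2 f (moment_kernel X Y) g = ip m0 setT (kint1 m1 X f) (kint1 m2 Y g).
Proof.
move=> sX sY sf sg; have sK := moment_kernel_sqint sX sY.
have [sYg _] := kint1_sqint sY sg; have [mX _] := sX.
have [i1 <-] := kint1_bilin sf sK sg.
rewrite ipC; have [_ E] := kint1_bilin sYg sX sf.
rewrite /ip E -kint2_bilin//.
transitivity (\int[m1]_u (kint1 m2 (moment_kernel X Y) g u * f u)).
  by apply: eq_Rintegral => u _; exact: mulrC.
have [mK _] := sK; have [mf _] := sf; have [mg _] := sg; have [mYg _] := sYg.
apply: ae_eq_Rintegral => //.
- by apply: measurable_funM => //; exact: measurable_kint1.
- by apply: measurable_funM => //; exact: measurable_kint2.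
apply: (filterS _ (ae_section2_sqint sX)) => u su _; congr (_ * _).
have [_ EY] := kint1_bilin su sY sg.
transitivity (bilin m0 m2 (fun w => X (w, u)) Y g).
  by rewrite -kint2_bilin.
by rewrite -EY; apply: eq_Rintegral => w _; exact: mulrC.
Qed.

End second_moment_kernels.

Section second_moment_kernels_on_domains.
Context d1 d2 d3 (T : measurableType d1) (T1 : measurableType d2) (T2 : measurableType d3).
Context (R : realType).
Variable m0 : {sigma_finite_measure set T -> \bar R}.
Variable m1 : {sigma_finite_measure set T1 -> \bar R}.
Variable m2 : {sigma_finite_measure set T2 -> \bar R}.
Variables (D1 : set T1) (D2 : set T2).
Hypotheses (mD1 : measurable D1) (mD2 : measurable D2).
Implicit Types (X : T * T1 -> R) (Y : T * T2 -> R).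

Lemma moment_kernel_restrict X Y :
  moment_kernel m0 (X \_ (setT `*` D1)) (Y \_ (setT `*` D2)) =
  moment_kernel m0 X Y \_ (D1 `*` D2).
Proof.
apply/funext => -[u v]; rewrite restrictE.
have E d' (T' : measurableType d') (D : set T') (w : T) (x : T') :
    ((w, x) \in setT `*` D) = (x \in D) by apply/idP/idP; rewrite !inE; [case|split].
have -> : ((u, v) \in D1 `*` D2) = (u \in D1) && (v \in D2).
  by apply/idP/andP; rewrite !inE.
rewrite /moment_kernel /=.
case: (boolP (u \in D1)) => hu; case: (boolP (v \in D2)) => hv /=.
- by apply: eq_Rintegral => w _; rewrite !restrictE !E hu hv.
- rewrite (_ : (fun w => _) = cst 0) ?Rintegral_cst ?mul0r//.
  by apply/funext => w; rewrite !restrictE !E (negbTE hv) mulr0.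
- rewrite (_ : (fun w => _) = cst 0) ?Rintegral_cst ?mul0r//.
  by apply/funext => w; rewrite !restrictE !E (negbTE hu) mul0r.
- rewrite (_ : (fun w => _) = cst 0) ?Rintegral_cst ?mul0r//.
  by apply/funext => w; rewrite !restrictE !E (negbTE hu) mul0r.
Qed.

Lemma moment_kernel_sqint_on X Y :
  sqint (m0 \x m1)%E (setT `*` D1) X -> sqint (m0 \x m2)%E (setT `*` D2) Y ->
  sqint (m1 \x m2)%E (D1 `*` D2) (moment_kernel m0 X Y).
Proof.
have mT1 := measurableX (@measurableT _ T) mD1; have mT2 := measurableX (@measurableT _ T) mD2.
move=> /(sqint_restrict _ mT1) sX /(sqint_restrict _ mT2) sY.
apply/(sqint_restrict _ (measurableX mD1 mD2)); rewrite -moment_kernel_restrict.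
exact: moment_kernel_sqint.
Qed.

Lemma moment_kernel_form_on X Y f g :
  sqint (m0 \x m1)%E (setT `*` D1) X -> sqint (m0 \x m2)%E (setT `*` D2) Y ->
  sqint m1 D1 f -> sqint m2 D2 g ->
  kernel_form m1 m2 D1 D2 f (moment_kernel m0 X Y) g =
  ip m0 setT (kernel_apply m1 D1 X f) (kernel_apply m2 D2 Y g).
Proof.
have mT1 := measurableX (@measurableT _ T) mD1; have mT2 := measurableX (@measurableT _ T) mD2.
move=> /(sqint_restrict _ mT1) sX /(sqint_restrict _ mT2) sY.
move=> /(sqint_restrict _ mD1) sf /(sqint_restrict _ mD2) sg.
rewrite kernel_form_restrict -moment_kernel_restrict (moment_kernel_form sX sY sf sg) !kint1_restrict.
by rewrite !patch_setT.
Qed.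

End second_moment_kernels_on_domains.

(** * Functionals of random elements and covariance kernels *)

Section random_functionals.
Context d (T : measurableType d) {R : realType}.
Variable P : probability T R.
Local Notation leb := (@lebesgue_measure R).
Local Notation leb2 := (leb \x leb)%E.

Let path (X : T -> R -> R) (z : T * measurableTypeR R) : R := X z.1 z.2.

Section single.
Variables (D : set R) (HH : set (R -> R)) (X : T -> R -> R).
Hypotheses (mD : @measurable _ (measurableTypeR R) D) (hH : hilbert_in_L2 D HH).
Hypothesis reX : random_element P D HH X.

Let mTD := measurableX (@measurableT _ T) mD.

Lemma random_element_L2 w : L2 D (X w).
Proof. by case: reX => _ h _; exact: hilbert_L2 (h w). Qed.

(** Tonelli's theorem turns the finite expected squared norm into square integrability in both
    variables jointly. *)
Lemma path_sqint : sqint (P \x leb)%E (setT `*` D) (path X).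
Proof.
have [mX _ EX] := reX.
have mX' : measurable_fun (setT `*` D) (path X) by exact: mX.
apply/(sqint_restrict _ mTD); split; first by apply/(measurable_restrictT _ mTD).
have mr : measurable_fun setT (path X \_ (setT `*` D)) by apply/(measurable_restrictT _ mTD).
have mr2 : measurable_fun setT (fun z => ((path X \_ (setT `*` D)) z ^+ 2)%:E).
  by apply/measurable_EFinP; exact: measurable_funX.
apply/integrableP; split => //.
under eq_integral => z _ do rewrite gee0_abs ?lee_fin ?sqr_ge0//.
rewrite (fubini_tonelli1 (m1 := P) (m2 := leb))//; last by move=> z; rewrite lee_fin sqr_ge0.
apply: le_lt_trans EX; rewrite unlock.
rewrite le_eqVlt; apply/orP; left; apply/eqP; apply: eq_integral => w _.
rewrite inner_ip (ip_sqr mD (random_element_L2 w)) [RHS]integral_mkcond /fubini_F.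
apply: eq_integral => u _; rewrite restrictE patchE.
have -> : ((w, u) \in [set: T] `*` D) = (u \in D) by apply/idP/idP; rewrite !inE; [case|split].
by case: ifP => _ //; rewrite expr0n.
Qed.

Lemma kernel_apply_path f w : kernel_apply leb D (path X) f w = inner D f (X w).
Proof. by apply: eq_Rintegral => u _; exact: mulrC. Qed.

Lemma functional_sqint f : L2 D f -> sqint P setT (fun w => inner D f (X w)) /\
  ip P setT (fun w => inner D f (X w)) (fun w => inner D f (X w)) <=
  ip (P \x leb)%E (setT `*` D) (path X) (path X) * norm2 D f ^+ 2.
Proof.
move=> sf; have := kernel_apply_sqint measurableT mD path_sqint sf.
rewrite (_ : kernel_apply leb D (path X) f = fun w => inner D f (X w)); last first.
  by apply/funext => w; exact: kernel_apply_path.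
by rewrite sqr_sqrtr//; exact: ip_ge0.
Qed.

(** The covariance centres at the pointwise mean, which is known to vanish only for almost every
    [u]; keeping it explicit makes [covker] exactly a moment kernel. *)
Definition mean_path (u : R) : R := fine ('E_P[fun w => X w u]).

Hypothesis mzX : mean_zero P D X.

Lemma mean_path_ae : {ae leb, forall u, D u -> mean_path u = 0}.
Proof. by apply: (@filterS _ _ (ae_filter_ringOfSetsType leb) _ _ _ mzX) => u h Du; rewrite /mean_path h. Qed.

Lemma mean_path_L2 : L2 D mean_path.
Proof.
have [mX _ _] := reX.
have mr : measurable_fun setT (path X \_ (setT `*` D)) by apply/(measurable_restrictT _ mTD).
have mm : measurable_fun D mean_path.
  apply/(measurable_restrictT _ mD).
  have -> : mean_path \_ D = fine \o (fun u => \int[P]_w ((path X \_ (setT `*` D)) (w, u))%:E)%E.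
    apply/funext => u /=; rewrite restrictE /mean_path unlock.
    have E w : ((w, u) \in [set: T] `*` D) = (u \in D) by apply/idP/idP; rewrite !inE; [case|split].
    case: (boolP (u \in D)) => hu.
      by congr fine; apply: eq_integral => w _; rewrite restrictE E hu.
    rewrite (_ : (fun w => _) = cst 0%E) ?integral0//.
    by apply/funext => w; rewrite restrictE E (negbTE hu).
  by apply: measurableT_comp => //; exact: measurable_partial_integral2.
split=> //; apply/integrableP; split.
  by apply/measurable_EFinP; exact: measurable_funX.
rewrite (@ae_eq_integral _ _ _ leb D (cst 0%E))//.
- by rewrite integral0 ltry.
- by apply: measurableT_comp => //; apply/measurable_EFinP; exact: measurable_funX.
- apply: (@filterS _ _ (ae_filter_ringOfSetsType leb) _ _ _ mean_path_ae) => u h Du.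
  by rewrite /= h// expr0n /= normr0.
Qed.

Lemma centered_sqint : sqint (P \x leb)%E (setT `*` D) (path (fun w u => X w u - mean_path u)).
Proof.
have s1 : sqint P setT (fun=> 1 : R) by exact: sqint_cst.
have := sqintB mTD path_sqint (tensor_sqint_on measurableT mD s1 mean_path_L2).
by congr sqint; apply/funext => z; rewrite mul1r.
Qed.

Lemma kernel_apply_centered f w : L2 D f ->
  kernel_apply leb D (path (fun w u => X w u - mean_path u)) f w = inner D f (X w).
Proof.
move=> sf; have -> : kernel_apply leb D (path (fun w u => X w u - mean_path u)) f w =
    ip leb D (fun u => X w u - mean_path u) f by [].
rewrite (ipBl mD (random_element_L2 w) mean_path_L2 sf).
have -> : ip leb D mean_path f = \int[leb]_(u in D) (cst 0 u).
  have [mm _] := mean_path_L2; have [mf _] := sf.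
  apply: ae_eq_Rintegral => //; first exact: measurable_funM.
  apply: (@filterS _ _ (ae_filter_ringOfSetsType leb) _ _ _ mean_path_ae) => u h Du.
  by rewrite h// mul0r.
by rewrite Rintegral_cst// mul0r subr0 ipC.
Qed.

End single.

Section pair.
Variables (D1 D2 : set R) (H1 H2 : set (R -> R)) (X Y : T -> R -> R).
Hypotheses (mD1 : @measurable _ (measurableTypeR R) D1) (hH1 : hilbert_in_L2 D1 H1).
Hypotheses (mD2 : @measurable _ (measurableTypeR R) D2) (hH2 : hilbert_in_L2 D2 H2).
Hypotheses (reX : random_element P D1 H1 X) (mzX : mean_zero P D1 X).
Hypotheses (reY : random_element P D2 H2 Y) (mzY : mean_zero P D2 Y).

Lemma covker_moment_kernel :
  (fun z : measurableTypeR R * measurableTypeR R => covker P X Y z.1 z.2) =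
  moment_kernel P (path (fun w u => X w u - mean_path X u)) (path (fun w u => Y w u - mean_path Y u)).
Proof. apply/funext => z; rewrite /covker !unlock /moment_kernel /mean_path /= !unlock; reflexivity. Qed.

Lemma covker_L2 : L2ker D1 D2 (covker P X Y).
Proof.
have := moment_kernel_sqint_on mD1 mD2 (centered_sqint mD1 hH1 reX mzX) (centered_sqint mD2 hH2 reY mzY).
by rewrite -covker_moment_kernel.
Qed.

Lemma kf_covker f g : L2 D1 f -> L2 D2 g ->
  kf D1 D2 f (covker P X Y) g =
  ip P setT (fun w => inner D1 f (X w)) (fun w => inner D2 g (Y w)).
Proof.
move=> sf sg.
have := moment_kernel_form_on mD1 mD2 (centered_sqint mD1 hH1 reX mzX)
  (centered_sqint mD2 hH2 reY mzY) sf sg.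
rewrite -covker_moment_kernel => E; rewrite [LHS]E.
by apply: eq_Rintegral => w _; rewrite (kernel_apply_centered mD1 hH1 reX mzX)//
  (kernel_apply_centered mD2 hH2 reY mzY).
Qed.

End pair.

End random_functionals.

(** * Independence through continuous functionals *)

Section independent_functionals.
Context d (T : measurableType d) (R : realType) (P : probability T R).
Context (E : Type) (S : set E) (dist : E -> E -> R).

(** Continuity for the same [S] and [dist] that define [borel_sets], so that preimages of open sets
    are among its generators. *)
Definition dist_continuous (F : E -> R) := forall x, S x -> forall e, 0 < e ->
  exists2 r, 0 < r & forall y, S y -> dist x y < r -> `|F x - F y| < e.

Lemma dist_continuousD F G : dist_continuous F -> dist_continuous G ->
  dist_continuous (fun x => F x + G x).
Proof.
move=> cF cG x Sx e e0; have e2 : 0 < e / 2 by rewrite divr_gt0.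
have [r r0 hr] := cF x Sx _ e2; have [r' r'0 hr'] := cG x Sx _ e2.
exists (Num.min r r'); first by rewrite lt_min r0.
move=> y Sy; rewrite lt_min => /andP[yr yr'].
have -> : F x + G x - (F y + G y) = (F x - F y) + (G x - G y) by ring.
by apply: le_lt_trans (ler_normD _ _) _; rewrite (splitr e) ltrD ?hr ?hr'.
Qed.

(** Finitely many radii have a positive minimum. The predicate [Q] lets the conditions bear on part
    of the family, as needed in [independent_blocks]. *)
Lemma borel_open_preimage (K : finType) (Q : pred K) (F : K -> E -> R) (O : K -> set R) :
  (forall k, dist_continuous (F k)) -> (forall k, open (O k)) ->
  borel_sets S dist [set x | S x /\ forall k, Q k -> O k (F k x)].
Proof.
move=> cF oO; apply: sub_sigma_algebra; split; first by move=> x [].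
move=> x [Sx Ox].
have /choice[r hr] k : exists r, 0 < r /\
    (Q k -> forall y, S y -> dist x y < r -> O k (F k y)).
  case: (boolP (Q k)) => Qk; last by exists 1.
  have := oO k; rewrite openE => /(_ _ (Ox k Qk)) /nbhs_ballP [e /= e0 he].
  have [r r0 hr] := cF k x Sx e e0; exists r; split=> // _ y Sy xy.
  by apply: he; exact: hr.
exists (\big[Num.min/1]_k r k).
  by elim/big_ind: _ => [|a b a0 b0|k _] //; [rewrite lt_min a0|case: (hr k)].
move=> y Sy xy; split=> // k Qk; have [_ hk] := hr k; apply: hk => //.
by apply: lt_le_trans xy _; apply/bigmin_leP; right; exists k.
Qed.

(** The Borel set attached to the index [i] imposes the conditions of the blocks sent to [i] by
    [tau]. By injectivity there is at most one, so the preimage of [A (tau b)] is exactly the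
    rectangle of [b]. *)
Lemma independent_blocks (I : eqType) (Z : I -> T -> E) (B C : finType) (tau : B -> I)
    (F : B -> C -> E -> R) :
  independent P (borel_sets S dist) Z -> (forall i w, S (Z i w)) -> injective tau ->
  (forall b c, dist_continuous (F b c)) ->
  blocks_independent P (fun b c w => F b c (Z (tau b) w)).
Proof.
move=> ind SZ tauI cF O oO.
pose A i := [set x | S x /\ forall k : B * C, tau k.1 == i -> O k.1 k.2 (F k.1 k.2 x)].
have mA i : borel_sets S dist (A i).
  by apply: (@borel_open_preimage (B * C)%type (fun k => tau k.1 == i)
    (fun k => F k.1 k.2) (fun k => O k.1 k.2)).
have EA b : Z (tau b) @^-1` A (tau b) = rectangle (fun b c w => F b c (Z (tau b) w)) O b.
  apply/seteqP; split => w /=.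
    by move=> [_ h] c _; exact: (h (b, c)).
  move=> h; split=> // -[b' c] /= /eqP /tauI ->; exact: h.
have := ind [seq tau b | b <- enum B] A.
rewrite map_inj_uniq ?enum_uniq// => /(_ isT (fun i _ => mA i)).
rewrite big_map big_enum /= => h.
have -> : \bigcap_b rectangle (fun b c w => F b c (Z (tau b) w)) O b =
    \bigcap_(i in [set` [seq tau b | b <- enum B]]) (Z i @^-1` A i).
  apply/seteqP; split => w h'.
    by move=> i /= /mapP[b _ ->]; have := h' b Logic.I; rewrite -EA.
  by move=> b _; rewrite -EA; apply: h'; rewrite /= map_f// mem_enum.
by rewrite h; congr EFin; apply: eq_bigr => b _; rewrite EA.
Qed.

Lemma independent_ip0 (I : eqType) (Z : I -> T -> E) (F G : E -> R) (i j : I) :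
  independent P (borel_sets S dist) Z -> (forall i w, S (Z i w)) -> i != j ->
  dist_continuous F -> dist_continuous G ->
  sqint P setT (F \o Z i) -> sqint P setT (G \o Z j) ->
  ip P setT (F \o Z i) (fun=> 1) = 0 -> ip P setT (F \o Z i) (G \o Z j) = 0.
Proof.
move=> ind SZ ij cF cG sF sG F0; apply: indep_ip0 => //.
pose A (H : E -> R) (O : unit -> set R) := [set x | S x /\ forall k, xpredT k -> O k (H x)].
move=> O O' oO oO'.
have mA H (O1 : unit -> set R) : dist_continuous H -> (forall k, open (O1 k)) ->
    borel_sets S dist (A H O1).
  by move=> cH oO1; apply: (@borel_open_preimage unit xpredT (fun=> H) O1).
have EA H (O1 : unit -> set R) k : Z k @^-1` A H O1 = \bigcap_(u : unit) ((H \o Z k) @^-1` O1 u).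
  apply/seteqP; split => w /=; first by move=> [_ h] u _; exact: h.
  by move=> h; split=> // u _; exact: h.
(* The preimage is not known to be measurable; independence for a single index shows that its
   probability is finite. *)
have posA k B : borel_sets S dist B -> P (Z k @^-1` B) = (fine (P (Z k @^-1` B)))%:E.
  move=> mB; have := ind [:: k] (fun=> B) isT (fun _ _ => mB).
  rewrite big_seq1 => <-; congr (P _); apply/seteqP; split => w.
    by move=> h i' /=; rewrite inE => /eqP ->.
  by apply; rewrite /= inE.
have := ind [:: i; j] (fun k => if k == i then A F O else A G O').
rewrite /= inE ij /= => /(_ isT).
have mk (k : I) : k \in [:: i; j] -> borel_sets S dist (if k == i then A F O else A G O').
  by move=> _; case: (k == i); exact: mA.
move=> /(_ mk); rewrite big_cons big_seq1 eqxx eq_sym (negbTE ij) EFinM -!posA; [|exact: mA|exact: mA].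
rewrite !EA => <-; congr (P _); apply/seteqP; split => w.
  move=> [h1 h2] k /=; rewrite !inE => /orP[] /eqP ->.
    by rewrite eqxx -[_ _]/((Z i @^-1` A F O) w) EA.
  by rewrite eq_sym (negbTE ij) -[_ _]/((Z j @^-1` A G O') w) EA.
move=> h; split.
  by rewrite -EA; have := h i; rewrite /= !inE eqxx => /(_ isT).
by rewrite -EA; have := h j; rewrite /= !inE eqxx orbT eq_sym (negbTE ij) => /(_ isT).
Qed.

(** The second moment depends only on the law, and two laws that agree on the open sets, a pi-system
    generating the Borel sets, coincide. *)
Lemma equal_law_ip (f g : T -> R) : sqint P setT f -> sqint P setT g ->
  (forall O, open O -> P (f @^-1` O) = P (g @^-1` O)) -> ip P setT f f = ip P setT g g.
Proof.
move=> sf sg fg; have [mf _] := sf; have [mg _] := sg.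
have intE (h : T -> R) (mh : measurable_fun setT h) : sqint P setT h ->
    (ip P setT h h)%:E = (\int[pushforward P h]_x (x ^+ 2)%:E)%E.
  move=> sh; rewrite (ip_sqr measurableT sh) ge0_integral_pushforward//.
    by apply/measurable_EFinP; exact: measurable_funX.
  by move=> x _; rewrite lee_fin sqr_ge0.
apply: EFin_inj; rewrite (intE f)// (intE g)//; apply: eq_measure_integral => A mA _.
have mO : (@measurable _ (measurableTypeR R)) = <<s (open : set (set R)) >>.
  apply/seteqP; split; last first.
    apply: smallest_sub; first exact: sigma_algebra_measurable.
    by move=> O oO; exact: open_measurable.
  rewrite [X in X `<=` _](RGenOpens.measurableE R); apply: smallest_sub.
    exact: smallest_sigma_algebra.
  move=> _ [a [b ->]]; have : open `]a, b[%classic by exact: interval_open.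
  exact: (@sub_sigma_algebra _ setT (open : set (set R))).
apply: (@measure_unique _ _ (measurableTypeR R) open (fun=> setT) mO _ _ _ (pushforward P (f : T -> measurableTypeR R)) (pushforward P (g : T -> measurableTypeR R)) _ _ A mA).
- by move=> U V; exact: openI.
- by move=> _; exact: openT.
- by rewrite bigcup_const//; exists 0%N.
- by move=> O oO; exact: fg.
- by move=> _; have h : (P setT < +oo)%E by [rewrite probability_setT ltry]; exact: h.
Qed.

Lemma identically_distributed_ip (I : eqType) (Z : I -> T -> E) (F : E -> R) (i j : I) :
  identically_distributed P (borel_sets S dist) Z -> (forall i w, S (Z i w)) ->
  dist_continuous F -> sqint P setT (F \o Z i) -> sqint P setT (F \o Z j) ->
  ip P setT (F \o Z i) (F \o Z i) = ip P setT (F \o Z j) (F \o Z j).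
Proof.
move=> idZ SZ cF si sj; apply: equal_law_ip => // O oO.
have mA := @borel_open_preimage unit xpredT (fun=> F) (fun=> O) (fun=> cF) (fun=> oO).
have EA k : (F \o Z k) @^-1` O = Z k @^-1` [set x | S x /\ forall u : unit, xpredT u -> O (F x)].
  by apply/seteqP; split => w /=; [split|case=> _ /(_ tt isT)].
by rewrite !EA; exact: idZ.
Qed.

End independent_functionals.

(** * Functionals of vectors of functions *)

Section vector_functionals.
Context {R : realType}.
Local Notation leb := (@lebesgue_measure R).
Variables (D : set R) (p : nat).
Hypothesis mD : @measurable _ (measurableTypeR R) D.
Implicit Types b z y : fvec R p.

Let vL2 z := forall j, L2 D (z j).

Lemma norm2_le_vdist z y j : norm2 D (fun x => z j x - y j x) <= vdist D z y.
Proof.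
apply: ler_wsqrtr; rewrite /vinner (bigD1 j)//= lerDl.
by apply: sumr_ge0 => i _; exact: ip_ge0.
Qed.

Lemma vinner_sum (I : Type) (s : seq I) (a : I -> R) (b : I -> fvec R p) z :
  (forall i, vL2 (b i)) -> vL2 z ->
  vinner D (fun j x => \sum_(i <- s) a i * b i j x) z = \sum_(i <- s) a i * vinner D (b i) z.
Proof.
move=> sb sz; rewrite /vinner.
under [RHS]eq_bigr => i _ do rewrite mulr_sumr.
rewrite [RHS]exchange_big/=; apply: eq_bigr => j _.
rewrite inner_ip ip_suml//; first by apply: eq_bigr => i _; exact: (ipZl mD _ (sb i j) (sz j)).
- by move=> i; exact: (sqintZ mD _ (sb i j)).
- exact: (sz j).
Qed.

Lemma vinner_lipschitz b z y : vL2 b -> vL2 z -> vL2 y ->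
  `|vinner D b z - vinner D b y| <= (\sum_j norm2 D (b j)) * vdist D z y.
Proof.
move=> sb sz sy; rewrite /vinner -sumrB mulr_suml.
apply: le_trans (ler_norm_sum _ _ _) _; apply: ler_sum => j _.
have -> : inner D (b j) (z j) - inner D (b j) (y j) = inner D (b j) (fun x => z j x - y j x).
  by apply/esym; exact: (ipBr mD (sz j) (sy j) (sb j)).
apply: le_trans (cauchy_schwarz mD (sb j) (sqintB mD (sz j) (sy j))) _.
by apply: ler_wpM2l; [exact: sqrtr_ge0|exact: norm2_le_vdist].
Qed.

Lemma lipschitz_dist_continuous (E : Type) (S : set E) (dist : E -> E -> R) (F : E -> R) (L : R) :
  0 <= L -> (forall x x', S x -> S x' -> `|F x - F x'| <= L * dist x x') ->
  dist_continuous S dist F.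
Proof.
move=> L0 hL x Sx e e0; have L1 : 0 < L + 1 by rewrite ltr_wpDl.
exists (e / (L + 1)); first by rewrite divr_gt0.
move=> y Sy; rewrite ltr_pdivlMr// => h; apply: le_lt_trans (hL x y Sx Sy) _.
have [d0|d0] := leP 0 (dist x y).
  by apply: le_lt_trans h; rewrite mulrC ler_wpM2l// lerDl.
by apply: le_lt_trans e0; rewrite mulr_ge0_le0// ltW.
Qed.

Variable HH : set (R -> R).
Hypothesis hH : hilbert_in_L2 D HH.

Lemma vecH_L2 z : vecH HH z -> vL2 z.
Proof. by move=> hz j; exact: (hilbert_L2 hH (hz j)). Qed.

Lemma vinner_dist_continuous b : vL2 b -> dist_continuous (vecH HH (p := p)) (vdist D (p := p)) (vinner D b).
Proof.
move=> sb; apply: (@lipschitz_dist_continuous _ _ _ _ (\sum_j norm2 D (b j))).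
  by apply: sumr_ge0 => j _; exact: sqrtr_ge0.
by move=> z y Sz Sy; apply: vinner_lipschitz => //; exact: vecH_L2.
Qed.

Lemma inner_dist_continuous (b : R -> R) : L2 D b ->
  dist_continuous HH (fun f g => norm2 D (fun x => f x - g x)) (inner D b).
Proof.
move=> sb; apply: (@lipschitz_dist_continuous _ _ _ _ (norm2 D b)); first exact: sqrtr_ge0.
move=> f g hf hg; have sf := hilbert_L2 hH hf; have sg := hilbert_L2 hH hg.
have -> : inner D b f - inner D b g = inner D b (fun x => f x - g x).
  by apply/esym; exact: (ipBr mD sf sg sb).
exact: (cauchy_schwarz mD sb (sqintB mD sf sg)).
Qed.

(** Component [j] is the sum over [i] of the adjoints of [A i j] at [Phi i]. The norm bound is what
    will make the coefficients of the scalar process summable. *)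
Lemma kernel_matrix_adjoint (A : kmat R p p) (Phi : fvec R p) :
  (forall i j, tensorH D HH (A i j)) -> vecH HH Phi ->
  exists b : fvec R p, [/\ vecH HH b,
    forall g, vL2 g -> vinner D Phi (kop D A g) = vinner D b g &
    forall j, norm2 D (b j) <= \sum_i norm2 D (Phi i) * hsnorm D D (A i j)].
Proof.
move=> tA hPhi.
have /choice[b hb] (ij : 'I_p * 'I_p) := kernel_adjoint mD hH (tA ij.1 ij.2) (hPhi ij.1).
have hbH i j : HH (b (i, j)) by case: (hb (i, j)).
have sb i j : L2 D (b (i, j)) by exact: hilbert_L2 (hbH i j).
have hb1 (j : 'I_p) (s : seq 'I_p) : HH (fun x => \sum_(i <- s) b (i, j) x).
  have := hilbert_sum hH s (fun=> 1) (fun i => hbH i j).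
  by under eq_fun do under eq_bigr do rewrite mul1r.
exists (fun j x => \sum_i b (i, j) x); split.
- by move=> j; exact: hb1.
- move=> g sg; have [_ sPhi] : True /\ vL2 Phi by split=> //; exact: vecH_L2.
  have sA i j : L2ker D D (A i j) by case: (tA i j).
  have := kformE mD mD sPhi sA sg; rewrite /kform => ->; rewrite exchange_big /vinner.
  apply: eq_bigr => j _ /=; rewrite inner_ip ip_suml//; [|by move=> i; exact: (sb i j)|exact: (sg j)].
  by apply: eq_bigr => i _; have [_ + _] := hb (i, j); apply; exact: (sg j).
- move=> j0; apply: (@le_trans _ _ (\sum_i norm2 D (b (i, j0)))); last first.
    by apply: ler_sum => i _; case: (hb (i, j0)).
  elim: (index_enum _) => [|i s ih].
    rewrite big_nil; under eq_fun do rewrite big_nil.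
    by rewrite /norm2 /inner (_ : (fun x => _) = cst 0) ?Rintegral_cst ?mul0r ?sqrtr0//; apply/funext => x; rewrite mulr0.
  rewrite big_cons; under eq_fun do rewrite big_cons.
  apply: le_trans (ip_sumsq_le_dist mD (sb i j0) (hilbert_L2 hH (hb1 j0 s))) _.
  by rewrite lerD2l.
Qed.

End vector_functionals.

(** * Functionals of the errors *)

Section subgaussian_linear_process.
Context d (T : measurableType d) {R : realType} (P : probability T R).
Local Notation leb := (@lebesgue_measure R).
Local Notation ipP := (ip P setT).
Variables (D : set R) (HH : set (R -> R)).
Hypotheses (mD : @measurable _ (measurableTypeR R) D) (hH : hilbert_in_L2 D HH).
Variables (alpha : R) (p : nat) (A : nat -> kmat R p p) (e X : int -> T -> fvec R p).
Hypothesis slp : subgaussian_linear_process P D HH alpha A e X.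

Let path (Z : T -> R -> R) (z : T * measurableTypeR R) : R := Z z.1 z.2.

Let HL2 f : HH f -> L2 D f := @hilbert_L2 _ D HH hH f.

Lemma error_random_element t j : random_element P D HH (fun w => e t w j).
Proof. by case: slp => _ _ _ /(_ t j)[]. Qed.

Lemma error_in_H t w : vecH HH (e t w).
Proof. by move=> j; case: (error_random_element t j) => _ h _; exact: h. Qed.

Lemma error_L2 t w j : L2 D (e t w j).
Proof. by apply: HL2; exact: error_in_H. Qed.

Lemma component_sqint b t j : HH b -> sqint P setT (fun w => inner D b (e t w j)).
Proof.
by move=> hb; have [] := functional_sqint mD hH (error_random_element t j) (HL2 hb).
Qed.

(** The variance in [subgaussian] is an iterated integral against the covariance kernel; [kf_covker]
    identifies it with the second moment of the functional. *)
Lemma component_mgf b t j : HH b ->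
  (\int[P]_w (expR (inner D b (e t w j)))%:E <=
   (expR (alpha ^+ 2 * ipP (fun w => inner D b (e t w j)) (fun w => inner D b (e t w j)) / 2))%:E)%E.
Proof.
move=> hb; have [_ _ _ /(_ t j)[re mz hm] _] := slp.
have := hm b hb; rewrite expectation.unlock.
have sC := covker_L2 mD hH mD hH re mz re mz.
have [_ E] := kop_integral mD mD (HL2 hb) sC (HL2 hb).
rewrite (kf_covker mD hH mD hH re mz re mz (HL2 hb) (HL2 hb)) in E.
move=> h; apply: le_trans h _; rewrite lee_fin ler_expR le_eqVlt; apply/orP; left; apply/eqP.
by congr (_ * _ / 2); exact: E.
Qed.

(** The bound of [component_mgf] in the direction [s * b], for every [s], is the hypothesis of
    [subgaussian_mean0]. *)
Lemma component_mean0 b t j : HH b -> ipP (fun w => inner D b (e t w j)) (fun=> 1) = 0.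
Proof.
move=> hb; pose v := ipP (fun w => inner D b (e t w j)) (fun w => inner D b (e t w j)).
apply: (@subgaussian_mean0 _ _ _ P _ (alpha ^+ 2 * v)); first exact: component_sqint.
  by rewrite mulr_ge0 ?sqr_ge0//; exact: ip_ge0.
move=> s; have hsb : HH (fun x => s * b x).
  have := hilbert_lin hH s hb (hilbert0 hH).
  by under eq_fun do rewrite addr0.
have E w : inner D (fun x => s * b x) (e t w j) = s * inner D b (e t w j).
  by exact: (ipZl mD s (HL2 hb) (error_L2 t w j)).
have fE : (fun w => inner D (fun x => s * b x) (e t w j)) = (fun w => s * inner D b (e t w j)).
  by apply/funext => w; exact: E.
have sq := component_sqint t j hb; have h := component_mgf t j hsb.
rewrite fE (ipZl measurableT s sq (sqintZ measurableT s sq)) (ipZr measurableT s sq sq) -/v in h.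
have -> : alpha ^+ 2 * v * s ^+ 2 / 2 = alpha ^+ 2 * (s * (s * v)) / 2 by ring.
apply: le_trans h; rewrite le_eqVlt; apply/orP; left; apply/eqP.
by apply: eq_integral => w _; rewrite E.
Qed.

Lemma component_orth b b' t j j' : HH b -> HH b' -> j != j' ->
  ipP (fun w => inner D b (e t w j)) (fun w => inner D b' (e t w j')) = 0.
Proof.
move=> hb hb' jj'; have [_ _ /(_ t) ind _ _] := slp.
apply: (independent_ip0 (F := inner D b) (G := inner D b') ind) => //.
- by move=> i w; exact: error_in_H.
- by apply: (inner_dist_continuous mD hH); exact: HL2.
- by apply: (inner_dist_continuous mD hH); exact: HL2.
- exact: component_sqint.
- exact: component_sqint.
- exact: component_mean0.
Qed.

Section functionals.
Variable b : fvec R p.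
Hypothesis hb : vecH HH b.

Lemma error_sqint t : sqint P setT (fun w => vinner D b (e t w)).
Proof.
exact: (sqint_sum measurableT (index_enum 'I_p) (fun j => component_sqint t j (hb j))).
Qed.

Lemma error_ip t : ipP (fun w => vinner D b (e t w)) (fun w => vinner D b (e t w)) =
  \sum_j ipP (fun w => inner D (b j) (e t w j)) (fun w => inner D (b j) (e t w j)).
Proof.
rewrite /vinner; apply: ip_sum_orthogonal => //.
- exact: index_enum_uniq.
- by move=> j; exact: component_sqint.
- by move=> j j' jj'; exact: component_orth.
Qed.

(** The components are independent, so their bounds multiply; by orthogonality their variances add
    up to that of the sum, and the parameter stays [alpha]. *)
Lemma error_mgf t : (\int[P]_w (expR (vinner D b (e t w)))%:E <=
  (expR (alpha ^+ 2 * ipP (fun w => vinner D b (e t w)) (fun w => vinner D b (e t w)) / 2))%:E)%E.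
Proof.
have [_ _ /(_ t) ind _ _] := slp.
have bl : blocks_independent P (fun (j : 'I_p) (_ : unit) w => inner D (b j) (e t w j)).
  apply: (independent_blocks (tau := id) (F := fun j _ => inner D (b j)) ind) => //.
    by move=> i w; exact: error_in_H.
  by move=> j _; apply: (inner_dist_continuous mD hH); exact: HL2.
have mc (j : 'I_p) (c : unit) : measurable_fun setT (fun w => inner D (b j) (e t w j)).
  by have [] := component_sqint t j (hb j).
have := expectation_prod_le (H := fun (j : 'I_p) (x : unit -> R) => expR (x tt))
  (g := fun j => expR (alpha ^+ 2 * ipP (fun w => inner D (b j) (e t w j)) (fun w => inner D (b j) (e t w j)) / 2))
  mc bl (index_enum_uniq 'I_p).
rewrite error_ip mulr_sumr mulr_suml expR_sum.
under [X in _ -> (X <= _)%E]eq_integral => w _ do rewrite expR_sum.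
apply=> //; last by move=> j; exact: component_mgf (hb j).
by move=> j d' T' f mf; exact: measurableT_comp.
Qed.

End functionals.

Lemma error_mean0 b t : vecH HH b -> ipP (fun w => vinner D b (e t w)) (fun=> 1) = 0.
Proof.
move=> hb; rewrite /vinner ip_suml//.
- by apply: big1 => j _; exact: component_mean0.
- by move=> j; exact: component_sqint.
- exact: sqint_cst.
Qed.

Lemma error_orth b b' s s' : vecH HH b -> vecH HH b' -> s != s' ->
  ipP (fun w => vinner D b (e s w)) (fun w => vinner D b' (e s' w)) = 0.
Proof.
move=> hb hb' ss'; have [_ [ind _] _ _ _] := slp.
apply: (independent_ip0 (F := vinner D b) (G := vinner D b') ind) => //.
- by move=> i w; exact: error_in_H.
- by apply: (vinner_dist_continuous mD hH); exact: (vecH_L2 hH hb).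
- by apply: (vinner_dist_continuous mD hH); exact: (vecH_L2 hH hb').
- exact: error_sqint.
- exact: error_sqint.
- exact: error_mean0.
Qed.

Lemma error_law b s s' : vecH HH b ->
  ipP (fun w => vinner D b (e s w)) (fun w => vinner D b (e s w)) =
  ipP (fun w => vinner D b (e s' w)) (fun w => vinner D b (e s' w)).
Proof.
move=> hb; have [_ [_ idd] _ _ _] := slp.
apply: (identically_distributed_ip (F := vinner D b) idd) => //.
- by move=> i w; exact: error_in_H.
- by apply: (vinner_dist_continuous mD hH); exact: (vecH_L2 hH hb).
- exact: error_sqint.
- exact: error_sqint.
Qed.

(** Cauchy-Schwarz and the triangle inequality over the components. [E0] serves the summability of
    the scalar coefficients; no final constant depends on it. *)
Lemma error_norm_le : exists2 E0, 0 <= E0 & forall b, vecH HH b ->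
  Num.sqrt (ipP (fun w => vinner D b (e 0 w)) (fun w => vinner D b (e 0 w))) <=
  E0 * \sum_j norm2 D (b j).
Proof.
pose q j := Num.sqrt (ip (P \x leb)%E (setT `*` D) (path (fun w => e 0 w j)) (path (fun w => e 0 w j))).
exists (\sum_j q j); first by apply: sumr_ge0 => j _; exact: sqrtr_ge0.
move=> b hb; apply: (@le_trans _ _ (\sum_j q j * norm2 D (b j))); last first.
  rewrite mulr_suml; apply: ler_sum => j _; apply: ler_wpM2l; first exact: sqrtr_ge0.
  by rewrite (bigD1 j)//= lerDl sumr_ge0// => i _; exact: sqrtr_ge0.
rewrite /vinner; elim: (index_enum _) => [|j s ih].
  rewrite big_nil; under eq_fun do rewrite big_nil.
  by rewrite /ip (_ : (fun x => _) = cst 0) ?Rintegral_cst ?mul0r ?sqrtr0//; apply/funext => x; rewrite mulr0.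
rewrite big_cons; under eq_fun do rewrite big_cons.
have sj i := component_sqint 0 i (hb i).
have ss := sqint_sum measurableT s sj.
apply: le_trans (ip_sumsq_le_dist measurableT (sj j) ss) _; apply: lerD => //.
have [_ le] := functional_sqint mD hH (error_random_element 0 j) (HL2 (hb j)).
apply: le_trans (ler_wsqrtr le) _.
by rewrite sqrtrM ?ip_ge0// sqrtr_sqr ger0_norm// sqrtr_ge0.
Qed.

End subgaussian_linear_process.

(** * From functional to scalar linear processes *)

Section linear_process_array.
Context d (T : measurableType d) {R : realType} (P : probability T R).
Local Notation leb := (@lebesgue_measure R).
Local Notation ipP := (ip P setT).
Variables (D : set R) (HH : set (R -> R)).
Hypotheses (mD : @measurable _ (measurableTypeR R) D) (hH : hilbert_in_L2 D HH).
Variables (alpha : R) (p : nat) (A : nat -> kmat R p p) (e X : int -> T -> fvec R p).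
Hypothesis slp : subgaussian_linear_process P D HH alpha A e X.

Lemma process_random_element t j : random_element P D HH (fun w => X t w j).
Proof. by case: slp => _ _ _ _ /(_ t)[h _]; exact: h. Qed.

Lemma process_L2 t w j : L2 D (X t w j).
Proof. by case: (process_random_element t j) => _ h _; exact: (hilbert_L2 hH (h w)). Qed.

Lemma process_functional_sqint (Phi : fvec R p) t : vecH HH Phi ->
  sqint P setT (fun w => vinner D Phi (X t w)).
Proof.
move=> hPhi; have sj j : sqint P setT (fun w => inner D (Phi j) (X t w j)).
  by have [] := functional_sqint mD hH (process_random_element t j) (hilbert_L2 hH (hPhi j)).
exact: (sqint_sum measurableT (index_enum 'I_p) sj).
Qed.

Lemma sum_hsnorm_le_knorm (K : kmat R p p) i : \sum_j hsnorm D D (K i j) <= knorm_oo D K.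
Proof. by apply/bigmax_geP; right; exists i. Qed.

(** Pairing [Phi] with the image of an error under [A l] is pairing the adjoint [b l] with the error
    itself, which turns the functional of X_t into a series of functionals of the errors. *)
Lemma linear_process_array (B : R) (Phi : fvec R p) :
  vecH HH Phi -> (\sum_(0 <= l <oo) (knorm_oo D (A l))%:E <= B%:E)%E ->
  exists b : nat -> fvec R p, (forall l, vecH HH (b l)) /\
  exists beta, linear_array P (alpha ^+ 2) (fun l s w => vinner D (b l) (e s w))
    (fun t w => vinner D Phi (X t w)) beta.
Proof.
move=> hPhi sumA; have [tA _ _ _ cvX] := slp.
have sPhi := vecH_L2 hH hPhi.
have /choice[b hb] l := kernel_matrix_adjoint mD hH (tA l) hPhi.
have hbH l : vecH HH (b l) by case: (hb l).
exists b; split => //.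
exists (fun l => Num.sqrt (ipP (fun w => vinner D (b l) (e 0 w)) (fun w => vinner D (b l) (e 0 w)))).
have se s w j : L2 D (e s w j) by exact: (error_L2 hH slp).
split.
- by move=> l s; exact: (error_sqint mD hH slp (hbH l)).
- by move=> t; have [] := process_functional_sqint t hPhi.
- by move=> l; exact: sqrtr_ge0.
- move=> l s; rewrite (error_law mD hH slp s 0 (hbH l)); apply/esym/sqr_sqrtr; exact: ip_ge0.
- by move=> l l' s s'; exact: (error_orth mD hH slp).
- move=> s N a.
  have E w : \sum_(l < N) a l * vinner D (b l) (e s w) =
      vinner D (fun j x => \sum_(l < N) a l * b l j x) (e s w).
    rewrite (@vinner_sum _ D p mD 'I_N (index_enum 'I_N) a (fun l => b l))//.
    by move=> l j; exact: (vecH_L2 hH (hbH l) j).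
  have hbeta : vecH HH (fun j x => \sum_(l < N) a l * b l j x).
    by move=> j; exact: (hilbert_sum hH _ _ (fun l : 'I_N => hbH l j)).
  have := error_mgf mD hH slp hbeta s.
  have fE : (fun w => \sum_(l < N) a l * vinner D (b l) (e s w)) =
      (fun w => vinner D (fun j x => \sum_(l < N) a l * b l j x) (e s w)).
    by apply/funext => w; exact: E.
  rewrite fE; apply: le_trans; rewrite le_eqVlt; apply/orP; left; apply/eqP.
  by apply: eq_integral => w _; rewrite E.
(* Pairing with [Phi] is Lipschitz for [vdist], so the convergence in H^p passes to the scalar
   partial sums. *)
- move=> t; have [_ cv] := cvX t; apply: (filterS _ cv) => w cvw.
  set L := \sum_j norm2 D (Phi j); have L0 : 0 <= L by apply: sumr_ge0 => j _; exact: sqrtr_ge0.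
  have L1 : 0 < L + 1 by rewrite ltr_wpDl.
  have sk l i : L2 D (kop D (A l) (e (t - l%:Z) w) i).
    have sj j : L2 D (fun u => \int[leb]_(v in D) (A l i j u v * e (t - l%:Z) w j v)).
      by apply: (kop_L2 mD mD) => //; case: (tA l i j).
    exact: (sqint_sum mD (index_enum 'I_p) sj).
  have sS N i : L2 D (fun u => \sum_(l < N) kop D (A l) (e (t - l%:Z) w) i u).
    exact: (sqint_sum mD (index_enum 'I_N) (fun l : 'I_N => sk l i)).
  apply/cvgrPdist_lt => eps eps0.
  have e0 : 0 < eps / (L + 1) by rewrite divr_gt0.
  move/cvgrPdist_lt: cvw => /(_ _ e0); apply: filterS => N.
  rewrite sub0r normrN ger0_norm ?sqrtr_ge0// ltr_pdivlMr// => lt.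
  apply: le_lt_trans lt.
  have -> : \sum_(l < N) vinner D (b l) (e (t - l%:Z) w) =
      vinner D Phi (fun i u => \sum_(l < N) kop D (A l) (e (t - l%:Z) w) i u).
    rewrite /vinner; transitivity (\sum_(l < N) vinner D Phi (kop D (A l) (e (t - l%:Z) w))).
      by apply: eq_bigr => l _; case: (hb l) => _ h _; rewrite h//; move=> j; exact: se.
    rewrite /vinner exchange_big/=; apply: eq_bigr => i _; apply/esym.
    exact: (ip_sumr mD (index_enum 'I_N) (fun l : 'I_N => sk l i) (sPhi i)).
  apply: le_trans (vinner_lipschitz mD sPhi _ (sS N)) _; first by move=> j; exact: process_L2.
  by rewrite mulrC -/L; apply: ler_wpM2l; [exact: sqrtr_ge0|rewrite lerDl].
(* The coefficient at lag [l] is at most a constant times [knorm_oo D (A l)], whose partial sums are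
   bounded by [B]. *)
- have [E0 E00 hE] := error_norm_le mD hH slp.
  set F := \sum_i norm2 D (Phi i); have F0 : 0 <= F by apply: sumr_ge0 => j _; exact: sqrtr_ge0.
  exists (E0 * (F * B)) => N.
  apply: (@le_trans _ _ (\sum_(l < N) E0 * (F * knorm_oo D (A l)))).
    apply: ler_sum => l _; apply: le_trans (hE _ (hbH l)) _; apply: ler_wpM2l => //.
    apply: (@le_trans _ _ (\sum_j \sum_i norm2 D (Phi i) * hsnorm D D (A l i j))).
      by apply: ler_sum => j _; case: (hb l) => _ _; exact.
    rewrite exchange_big mulr_suml; apply: ler_sum => i _ /=.
    rewrite -mulr_sumr; apply: ler_wpM2l; first exact: sqrtr_ge0.
    exact: sum_hsnorm_le_knorm.
  rewrite -!mulr_sumr; apply: ler_wpM2l => //; apply: ler_wpM2l => //.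
  rewrite -lee_fin; apply: le_trans sumA; rewrite -sumEFin -(big_mkord xpredT (fun l => (knorm_oo D (A l))%:E)).
  apply: nneseries_lim_ge => l _ _; rewrite lee_fin.
  by apply: (big_ind (fun x => 0 <= x)) => // [x y x0 _|i _]; [rewrite le_max x0|
    apply: sumr_ge0 => j _; exact: sqrtr_ge0].
Qed.

End linear_process_array.

(** * Independence over time of the pairs of errors *)

Section joint_independence.
Context d (T : measurableType d) {R : realType} (P : probability T R).
Local Notation ipP := (ip P setT).
Variables (U V : set R) (HU HV : set (R -> R)).
Hypotheses (mU : @measurable _ (measurableTypeR R) U) (hU : hilbert_in_L2 U HU).
Hypotheses (mV : @measurable _ (measurableTypeR R) V) (hV : hilbert_in_L2 V HV).
Variables (aX aY : R) (p q : nat) (AX : nat -> kmat R p p) (AY : nat -> kmat R q q).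
Variables (eX X : int -> T -> fvec R p) (eY Y : int -> T -> fvec R q).
Hypothesis slX : subgaussian_linear_process P U HU aX AX eX X.
Hypothesis slY : subgaussian_linear_process P V HV aY AY eY Y.
Hypothesis ind : independent P (@borelH2 R U HU p V HV q) (fun t w => (eX t w, eY t w)).

Let S := [set z : fvec R p * fvec R q | vecH HU z.1 /\ vecH HV z.2].
Let dist (y z : fvec R p * fvec R q) := Num.max (vdist U y.1 z.1) (vdist V y.2 z.2).

Let SZ t w : S (eX t w, eY t w).
Proof. by split; [exact: error_in_H slX t w|exact: error_in_H slY t w]. Qed.

Let cont1 (b : fvec R p) : vecH HU b -> dist_continuous S dist (fun z => vinner U b z.1).
Proof.
move=> hb; have L0 : 0 <= \sum_j norm2 U (b j) by apply: sumr_ge0 => j _; exact: sqrtr_ge0.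
apply: (lipschitz_dist_continuous L0) => z y [Sz _] [Sy _].
apply: le_trans (vinner_lipschitz mU (vecH_L2 hU hb) (vecH_L2 hU Sz) (vecH_L2 hU Sy)) _.
by apply: ler_wpM2l => //; rewrite le_max lexx.
Qed.

Let cont2 (b : fvec R q) : vecH HV b -> dist_continuous S dist (fun z => vinner V b z.2).
Proof.
move=> hb; have L0 : 0 <= \sum_j norm2 V (b j) by apply: sumr_ge0 => j _; exact: sqrtr_ge0.
apply: (lipschitz_dist_continuous L0) => z y [_ Sz] [_ Sy].
apply: le_trans (vinner_lipschitz mV (vecH_L2 hV hb) (vecH_L2 hV Sz) (vecH_L2 hV Sy)) _.
by apply: ler_wpM2l => //; rewrite le_max lexx orbT.
Qed.

Lemma joint_error_orth (b : fvec R p) (b' : fvec R q) s s' : vecH HU b -> vecH HV b' -> s != s' ->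
  ipP (fun w => vinner U b (eX s w)) (fun w => vinner V b' (eY s' w)) = 0.
Proof.
move=> hb hb' ss'.
apply: (independent_ip0 (F := fun z => vinner U b z.1) (G := fun z => vinner V b' z.2) ind) => //.
- exact: cont1.
- exact: cont2.
- exact: (error_sqint mU hU slX hb).
- exact: (error_sqint mV hV slY hb').
- exact: (error_mean0 mU hU slX).
Qed.

(** A combination of functionals of both errors at one time is a single continuous functional of the
    pair, to which [independent_blocks] applies. *)
Lemma joint_blocks_independent (b : nat -> fvec R p) (b' : nat -> fvec R q)
    (B C : finType) (tau : B -> int) (L : nat) (a a' : B -> C -> nat -> R) :
  (forall l, vecH HU (b l)) -> (forall l, vecH HV (b' l)) -> injective tau ->
  blocks_independent P (fun i c w => \sum_(l < L) a i c l * vinner U (b l) (eX (tau i) w) +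
                                     \sum_(l < L) a' i c l * vinner V (b' l) (eY (tau i) w)).
Proof.
move=> hb hb' tauI.
pose F i c (z : fvec R p * fvec R q) :=
  vinner U (fun j x => \sum_(l < L) a i c l * b l j x) z.1 +
  vinner V (fun j x => \sum_(l < L) a' i c l * b' l j x) z.2.
have cF i c : dist_continuous S dist (F i c).
  apply: dist_continuousD.
    by apply: cont1 => j; exact: (hilbert_sum hU _ _ (fun l : 'I_L => hb l j)).
  by apply: cont2 => j; exact: (hilbert_sum hV _ _ (fun l : 'I_L => hb' l j)).
have := independent_blocks (F := F) ind SZ tauI cF.
congr (blocks_independent P _); apply/funext => i; apply/funext => c; apply/funext => w.
rewrite /F /=; congr (_ + _).
  apply: (@vinner_sum _ U p mU 'I_L (index_enum 'I_L) (a i c) (fun l => b l)).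
    by move=> l j; exact: (vecH_L2 hU (hb l) j).
  by move=> j; exact: (error_L2 hU slX).
apply: (@vinner_sum _ V q mV 'I_L (index_enum 'I_L) (a' i c) (fun l => b' l)).
  by move=> l j; exact: (vecH_L2 hV (hb' l) j).
by move=> j; exact: (error_L2 hV slY).
Qed.

End joint_independence.

(** * Spectral densities as limits of Fourier sums *)

Section spectral_limit.
Context {R : realType}.
Local Notation leb := (@lebesgue_measure R).
Local Notation leb2 := (leb \x leb)%E.

Lemma spectral_partial_sumE q p (S : int -> kmat R q p) theta N i j u v :
  spectral_partial_sum S theta N i j u v =
  ((2 * pi)^-1 * (\sum_(0 <= m < N.*2.+1) S (m%:Z - N%:Z) i j u v * cosine (m%:Z - N%:Z) theta) +i*
   ((2 * pi)^-1 * (\sum_(0 <= m < N.*2.+1)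
      S (m%:Z - N%:Z) i j u v * sin (- ((m%:Z - N%:Z)%:~R * theta)))))%C.
Proof.
rewrite /spectral_partial_sum /=.
have -> : \sum_(0 <= m < N.*2.+1) (S (m%:Z - N%:Z) i j u v)%:C%C * cexpi (- ((m%:Z - N%:Z)%:~R * theta)) =
   ((\sum_(0 <= m < N.*2.+1) S (m%:Z - N%:Z) i j u v * cosine (m%:Z - N%:Z) theta) +i*
   (\sum_(0 <= m < N.*2.+1)
      S (m%:Z - N%:Z) i j u v * sin (- ((m%:Z - N%:Z)%:~R * theta))))%C.
  elim: (index_iota _ _) => [|m s ih]; first by rewrite !big_nil.
  rewrite !big_cons ih /cexpi cosN /cosine; simpc; by [].
by simpc.
Qed.

Lemma Re_le_normc (z : R[i]) : `|complex.Re z| <= Normc.normc z.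
Proof.
case: z => a b; rewrite /Normc.normc -sqrtr_sqr; apply: ler_wsqrtr.
by rewrite lerDl sqr_ge0.
Qed.

Variables D1 D2 : set R.
Hypotheses (mD1 : @measurable _ (measurableTypeR R) D1)
           (mD2 : @measurable _ (measurableTypeR R) D2).

Lemma L2ker_normc (K : R -> R -> R[i]) :
  L2ker D1 D2 (fun u v => complex.Re (K u v)) -> L2ker D1 D2 (fun u v => complex.Im (K u v)) ->
  L2ker D1 D2 (fun u v => Normc.normc (K u v)).
Proof.
move=> sr si; have [mr r2] := L2ker_sqint sr; have [mi i2] := L2ker_sqint si.
have E z : Normc.normc (K z.1 z.2) = Num.sqrt (complex.Re (K z.1 z.2) ^+ 2 + complex.Im (K z.1 z.2) ^+ 2).
  by case: (K z.1 z.2).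
have m2 : measurable_fun (D1 `*` D2) (fun z : measurableTypeR R * measurableTypeR R =>
    complex.Re (K z.1 z.2) ^+ 2 + complex.Im (K z.1 z.2) ^+ 2).
  by apply: measurable_funD; exact: measurable_funX.
have s : sqint leb2 (D1 `*` D2) (fun z : measurableTypeR R * measurableTypeR R => Normc.normc (K z.1 z.2)).
  split.
    under eq_fun do rewrite E.
    have ms : measurable_fun setT (@Num.sqrt R).
      by apply: continuous_measurable_fun => x; exact: sqrt_continuous.
    exact: (measurableT_comp ms).
  have := integrableD (measurableX mD1 mD2) r2 i2; apply: eq_integrable; first exact: measurableX.
  by move=> z _; rewrite E sqr_sqrtr ?addr_ge0 ?sqr_ge0// EFinD.
exact: s.
Qed.

Lemma hsnorm_Re_le (K : R -> R -> R[i]) :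
  L2ker D1 D2 (fun u v => complex.Re (K u v)) -> L2ker D1 D2 (fun u v => complex.Im (K u v)) ->
  hsnorm D1 D2 (fun u v => complex.Re (K u v)) <= hsnorm D1 D2 (fun u v => Normc.normc (K u v)).
Proof.
move=> sr si; apply: ler_wsqrtr.
apply: (ip_le (measurableX mD1 mD2) (L2ker_sqint sr) (L2ker_sqint (L2ker_normc sr si))) => z _.
apply: le_trans (Re_le_normc _) _; exact: ler_norm.
Qed.

(** Hilbert-Schmidt convergence implies convergence of the bilinear forms, and the real part of a
    partial sum keeps the cosines. The factor 2 pi undoes the normalization. *)
Lemma spectral_form_limit q p (S : int -> kmat R q p) theta (f : ckmat R q p)
    (Phi : fvec R q) (Psi : fvec R p) :
  (forall h i j, L2ker D1 D2 (S h i j)) -> is_spectral_density D1 D2 S theta f ->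
  (forall i, L2 D1 (Phi i)) -> (forall j, L2 D2 (Psi j)) ->
  two_sided_sum (fun h => kform D1 D2 Phi (S h) Psi * cosine h theta) @ \oo -->
  2 * pi * complex.Re (ckform D1 D2 Phi f Psi).
Proof.
move=> sS spf sPhi sPsi; have pi0 : 0 < pi :> R := pi_gt0 R.
have sRe i j : L2ker D1 D2 (fun u v => complex.Re (f i j u v)) by case: (spf i j).
rewrite [complex.Re _]/= (kformE mD1 mD2 sPhi sRe sPsi) mulr_sumr.
have E N : two_sided_sum (fun h => kform D1 D2 Phi (S h) Psi * cosine h theta) N =
    \sum_i \sum_j two_sided_sum (fun h => kf D1 D2 (Phi i) (S h i j) (Psi j) * cosine h theta) N.
  rewrite /two_sided_sum; under [RHS]eq_bigr => i _ do rewrite exchange_big/=.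
  rewrite [RHS]exchange_big/=; apply: eq_bigr => m _.
  rewrite (kformE mD1 mD2 sPhi (sS _) sPsi) mulr_suml.
  by apply: eq_bigr => i _; rewrite mulr_suml.
have -> : two_sided_sum (fun h => kform D1 D2 Phi (S h) Psi * cosine h theta) =
    (fun N => \sum_i \sum_j two_sided_sum (fun h =>
      kf D1 D2 (Phi i) (S h i j) (Psi j) * cosine h theta) N) by apply/funext.
apply: cvgn_sum => i; rewrite mulr_sumr; apply: cvgn_sum => j.
have [_ sIm cv] := spf i j.
pose RS N u v := (2 * pi)^-1 * (\sum_(0 <= m < N.*2.+1) cosine (m%:Z - N%:Z) theta * S (m%:Z - N%:Z) i j u v).
pose IS N u v := (2 * pi)^-1 * (\sum_(0 <= m < N.*2.+1) sin (- ((m%:Z - N%:Z)%:~R * theta)) * S (m%:Z - N%:Z) i j u v).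
have sRS N : L2ker D1 D2 (RS N).
  by apply: L2kerZ => //; apply: L2ker_sum => // m; exact: L2kerZ.
have sIS N : L2ker D1 D2 (IS N).
  by apply: L2kerZ => //; apply: L2ker_sum => // m; exact: L2kerZ.
have ES N u v : spectral_partial_sum S theta N i j u v = (RS N u v +i* IS N u v)%C.
  rewrite spectral_partial_sumE /RS /IS.
  by congr (_ * _ +i* (_ * _))%C; apply: eq_bigr => m _; rewrite mulrC.
have ReB (x y : R[i]) : complex.Re (x - y) = complex.Re x - complex.Re y by case: x; case: y.
have ImB (x y : R[i]) : complex.Im (x - y) = complex.Im x - complex.Im y by case: x; case: y.
have kfRS N : kf D1 D2 (Phi i) (RS N) (Psi j) =
    (2 * pi)^-1 * two_sided_sum (fun h => kf D1 D2 (Phi i) (S h i j) (Psi j) * cosine h theta) N.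
  rewrite kf_linearZ//; last by apply: L2ker_sum => // m; exact: L2kerZ.
  congr (_ * _); rewrite kf_linear_sum//; last by move=> m; exact: L2kerZ.
  by apply: eq_bigr => m _; rewrite kf_linearZ// mulrC.
have lim : (fun N => kf D1 D2 (Phi i) (RS N) (Psi j)) @ \oo -->
    kf D1 D2 (Phi i) (fun u v => complex.Re (f i j u v)) (Psi j).
  set a := norm2 D1 (Phi i); set b := norm2 D2 (Psi j).
  have a0 : 0 <= a by exact: sqrtr_ge0.
  have b0 : 0 <= b by exact: sqrtr_ge0.
  have ab1 : 0 < a * b + 1 by rewrite ltr_wpDl// mulr_ge0.
  apply/cvgrPdist_lt => eps eps0.
  have e0 : 0 < eps / (a * b + 1) by rewrite divr_gt0.
  move/cvgrPdist_lt: cv => /(_ _ e0); apply: filterS => N.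
  rewrite sub0r normrN ger0_norm ?sqrtr_ge0// ltr_pdivlMr// => lt.
  apply: le_lt_trans lt; rewrite distrC -kf_linearB//.
  have sr : L2ker D1 D2 (fun u v => complex.Re (spectral_partial_sum S theta N i j u v - f i j u v)).
    rewrite (_ : (fun u v => _) = (fun u v => RS N u v - complex.Re (f i j u v))); first exact: L2kerB.
    by apply/funext => u; apply/funext => v; rewrite ReB ES.
  have si : L2ker D1 D2 (fun u v => complex.Im (spectral_partial_sum S theta N i j u v - f i j u v)).
    rewrite (_ : (fun u v => _) = (fun u v => IS N u v - complex.Im (f i j u v))); first exact: L2kerB.
    by apply/funext => u; apply/funext => v; rewrite ImB ES.
  apply: le_trans (kf_le mD1 mD2 (sPhi i) (L2kerB mD1 mD2 (sRS N) (sRe i j)) (sPsi j)) _.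
  have := hsnorm_Re_le sr si.
  rewrite (_ : (fun u v => complex.Re (spectral_partial_sum S theta N i j u v - f i j u v)) =
     (fun u v => RS N u v - complex.Re (f i j u v))); last first.
    by apply/funext => u; apply/funext => v; rewrite ReB ES.
  rewrite -/a -/b; set X := hsnorm _ _ _; set Y := hsnorm _ _ _ => XY.
  have X0 : 0 <= X by exact: sqrtr_ge0.
  have Y0 : 0 <= Y by exact: sqrtr_ge0.
  rewrite mulrAC mulrDr mulr1 [Y * _]mulrC; apply: ler_wpDr => //.
  by apply: ler_wpM2l => //; exact: mulr_ge0.
have -> : two_sided_sum (fun h => kf D1 D2 (Phi i) (S h i j) (Psi j) * cosine h theta) =
    (fun N => 2 * pi * kf D1 D2 (Phi i) (RS N) (Psi j)).
  by apply/funext => N; rewrite kfRS mulrA divff ?mul1r// gt_eqF// mulr_gt0.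
exact: cvgMr.
Qed.

End spectral_limit.

(** * Covariance forms and stability measures *)

Section covariance_forms.
Context d (T : measurableType d) {R : realType} (P : probability T R).
Local Notation leb := (@lebesgue_measure R).
Local Notation leb2 := (leb \x leb)%E.
Local Notation ipP := (ip P setT).

Section pair.
Variables (D1 D2 : set R) (H1 H2 : set (R -> R)).
Hypotheses (mD1 : @measurable _ (measurableTypeR R) D1) (hH1 : hilbert_in_L2 D1 H1).
Hypotheses (mD2 : @measurable _ (measurableTypeR R) D2) (hH2 : hilbert_in_L2 D2 H2).
Variables (q p : nat) (X : int -> T -> fvec R q) (Y : int -> T -> fvec R p).
Hypotheses (reX : forall t i, random_element P D1 H1 (fun w => X t w i))
           (mzX : forall t i, mean_zero P D1 (fun w => X t w i)).
Hypotheses (reY : forall t i, random_element P D2 H2 (fun w => Y t w i))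
           (mzY : forall t i, mean_zero P D2 (fun w => Y t w i)).
Hypothesis stXY : cov_stationary P D1 D2 X Y.

Lemma Sigma_L2 h i j : L2ker D1 D2 (Sigma P X Y h i j).
Proof. exact: (covker_L2 mD1 hH1 mD2 hH2 (reX 0 i) (mzX 0 i) (reY h j) (mzY h j)). Qed.

(** Stationarity replaces the base time [t] by 0. It holds almost everywhere in (u, v), which is
    enough after integration. *)
Lemma covariance_form (Phi : fvec R q) (Psi : fvec R p) t h : vecH H1 Phi -> vecH H2 Psi ->
  ipP (fun w => vinner D1 Phi (X t w)) (fun w => vinner D2 Psi (Y (t + h) w)) =
  kform D1 D2 Phi (Sigma P X Y h) Psi.
Proof.
move=> hPhi hPsi.
have sPhi i : L2 D1 (Phi i) by exact: (hilbert_L2 hH1 (hPhi i)).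
have sPsi i : L2 D2 (Psi i) by exact: (hilbert_L2 hH2 (hPsi i)).
rewrite (kformE mD1 mD2 sPhi (Sigma_L2 h) sPsi) /vinner.
have sx i : sqint P setT (fun w => inner D1 (Phi i) (X t w i)).
  by have [] := functional_sqint mD1 hH1 (reX t i) (sPhi i).
have sy j : sqint P setT (fun w => inner D2 (Psi j) (Y (t + h) w j)).
  by have [] := functional_sqint mD2 hH2 (reY (t + h) j) (sPsi j).
rewrite (ip_suml measurableT (index_enum _) sx (sqint_sum measurableT (index_enum _) sy)).
apply: eq_bigr => i _.
rewrite (ip_sumr measurableT (index_enum _) sy (sx i)).
apply: eq_bigr => j _.
have stE := kf_covker mD1 hH1 mD2 hH2 (reX t i) (mzX t i) (reY (t + h) j) (mzY (t + h) j) (sPhi i) (sPsi j).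
rewrite -stE; have [mK1 _] := L2ker_sqint (covker_L2 mD1 hH1 mD2 hH2 (reX t i) (mzX t i) (reY (t + h) j) (mzY (t + h) j)).
have [mK2 _] := L2ker_sqint (Sigma_L2 h i j).
have [mt _] := L2ker_sqint (L2ker_tensor mD1 mD2 (sPhi i) (sPsi j)).
apply: (ae_eq_Rintegral (measurableX mD1 mD2) (measurable_funM mK1 mt) (measurable_funM mK2 mt)).
by apply: (@filterS _ _ (ae_filter_ringOfSetsType leb2) _ _ _ (stXY t h i j)) => z E Dz; congr (_ * _); exact: E.
Qed.

End pair.

Lemma stability_ae_le (D : set R) p (S0 : kmat R p p) (f : R -> ckmat R p p) (A : set (fvec R p))
    (M : R) (Phi : fvec R p) : A Phi -> 0 < kform D D Phi S0 Phi ->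
  (stability D S0 f A <= M%:E)%E ->
  {ae leb, forall t, `[- pi, pi]%classic t ->
    2 * pi * complex.Re (ckform D D Phi (f t) Phi) <= M * kform D D Phi S0 Phi}.
Proof.
move=> APhi q0 stM; have pi2 : 0 < 2 * pi :> R by rewrite mulr_gt0// pi_gt0.
pose F theta : \bar R := ereal_sup
  [set (complex.Re (ckform D D Psi (f theta) Psi) / kform D D Psi S0 Psi)%:E | Psi in A].
have FM : (ess_sup_pi F <= (M / (2 * pi))%:E)%E.
  rewrite -(@lee_pmul2l _ (2 * pi)%:E)//.
  by rewrite -EFinM [X in (_ <= X%:E)%E]mulrC divfK ?gt_eqF.
move: FM => /ess_supP [N [mN N0 sN]].
(* The essential supremum refers to the restricted measure, so its exceptional set is null only
   within the interval. *)
exists (N `&` `[- pi, pi]%classic); split; first exact: measurableI.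
  exact: N0.
have aux (a b : R) : 0 < b -> a / b <= M / (2 * pi) -> 2 * pi * a <= M * b.
  by move=> b0; rewrite ler_pdivrMr// mulrAC ler_pdivlMr// mulrC.
move=> t /not_implyP [Dt nle]; split; last exact: Dt.
apply: sN => Ft; apply: nle; apply: (aux _ _ q0); rewrite -lee_fin.
by apply: le_trans Ft; apply: ereal_sup_ubound; exists Phi.
Qed.

Section quadratic_bound.
Variables (D : set R) (HH : set (R -> R)).
Hypotheses (mD : @measurable _ (measurableTypeR R) D) (hH : hilbert_in_L2 D HH).
Variables (alpha : R) (p : nat) (A : nat -> kmat R p p) (e X : int -> T -> fvec R p).
Hypothesis slp : subgaussian_linear_process P D HH alpha A e X.
Hypothesis mzX : forall t i, mean_zero P D (fun w => X t w i).
Hypothesis stX : cov_stationary P D D X X.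
Variable f : R -> ckmat R p p.
Hypothesis spf : forall theta, theta \in `[- pi, pi] ->
  is_spectral_density D D (Sigma P X X) theta (f theta).
Variables (B : R) (Phi : fvec R p).
Hypothesis sumA : (\sum_(0 <= l <oo) (knorm_oo D (A l))%:E <= B%:E)%E.
Hypothesis hPhi : vecH HH Phi.
Variables (S : set (fvec R p)) (M : R).
Hypothesis SPhi : S Phi.
Hypothesis stM : (stability D (Sigma P X X 0) f S <= M%:E)%E.
Let x t w := vinner D Phi (X t w).
Let q := kform D D Phi (Sigma P X X 0) Phi.
Hypothesis q0 : 0 < q.

(** The set [S] is left free, so that the bound serves the whole of [H0] as well as the sparse
    functions of [H0k]. *)
Lemma quadratic_bound (C : finType) (k : C -> nat) top (u : C -> R) : injective k ->
  ipP (fun w => \sum_c u c * x (top - (k c)%:Z) w) (fun w => \sum_c u c * x (top - (k c)%:Z) w) <=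
  M * q * \sum_c u c ^+ 2.
Proof.
move=> kI; have reX := process_random_element slp.
have sx t : sqint P setT (x t) by exact: (process_functional_sqint mD hH slp t hPhi).
have cov t h : ipP (x t) (x (t + h)) = kform D D Phi (Sigma P X X h) Phi.
  exact: (covariance_form mD hH mD hH reX mzX reX mzX stX).
pose gam h := ipP (x 0) (x h).
have gamE t s : ipP (x t) (x s) = gam (s - t).
  transitivity (kform D D Phi (Sigma P X X (s - t)) Phi).
    by rewrite -(cov t) addrC subrK.
  by rewrite /gam -(cov 0) add0r.
have [b [hb [beta la]]] := linear_process_array mD hH slp hPhi sumA.
have [B' hB'] := autocovariance_summable la.
have sPhi := vecH_L2 hH hPhi.
have lim t : `[- pi, pi]%classic t -> two_sided_sum (fun h => gam h * cosine h t) @ \oo -->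
    2 * pi * complex.Re (ckform D D Phi (f t) Phi).
  move=> Dt; have := spectral_form_limit mD mD (Sigma_L2 mD hH mD hH reX mzX reX mzX)
    (spf Dt) sPhi sPhi.
  rewrite (_ : (fun h => _) = (fun h => gam h * cosine h t))//.
  by apply/funext => h; rewrite /gam -(cov 0) add0r.
have aeM := stability_ae_le SPhi q0 stM.
(* Minus the lags, that is, the times relative to [top]. *)
have kI' : injective (fun c => - (k c)%:Z) by move=> c c' /oppr_inj [] /kI.
have := spectral_form_bound u hB' lim aeM kI'; apply: le_trans.
have sux c : sqint P setT (fun w => u c * x (top - (k c)%:Z) w) by exact: sqintZ.
rewrite (ip_suml measurableT (index_enum _) sux (sqint_sum measurableT (index_enum _) sux)).
rewrite le_eqVlt; apply/orP; left; apply/eqP; apply: eq_bigr => c _.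
rewrite (ip_sumr measurableT (index_enum _) sux (sux c)).
apply: eq_bigr => c' _; rewrite ipZl// ipZr// gamE mulrA; congr (_ * _ * gam _).
ring.
Qed.

End quadratic_bound.

End covariance_forms.

(** * Chernoff bounds *)

Section exponential_tails.
Context d (T : measurableType d) (R : realType) (P : probability T R).

Lemma measurable_gt_set (f : T -> R) (r : R) : measurable_fun setT f -> measurable [set w | r < f w].
Proof.
move=> mf; have := mf measurableT _ (measurable_itv `]r, +oo[); rewrite setTI.
by congr measurable; apply/seteqP; split => w /=; rewrite in_itv/= andbT.
Qed.

Lemma exp_markov (Z : T -> R) (lam s : R) : measurable_fun setT Z ->
  (P [set w | (s < lam * Z w)%R] <= (expR (- s))%:E * \int[P]_w (expR (lam * Z w))%:E)%E.
Proof.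
move=> mZ; have mlZ : measurable_fun setT (fun w => lam * Z w) by exact: measurable_funM.
have mA := measurable_gt_set s mlZ; set A := [set w | _] in mA *.
have me : measurable_fun setT (fun w => expR (lam * Z w)) by exact: measurableT_comp.
rewrite -(ge0_integralZl_fin P me (fun w => expR_ge0 (lam * Z w)) (expR_ge0 (- s))).
rewrite -[A]setIT -integral_indic//.
apply: ge0_le_integral_fin; [exact: measurable_indic|exact: measurable_funM| |].
  by move=> w; rewrite indicE ler0n.
move=> w; rewrite indicE -expRD; case: (boolP (w \in A)) => [|_]; last exact: expR_ge0.
rewrite inE /A /= => h; rewrite -expR0 ler_expR; lra.
Qed.

(** The exponent - lam N K eps + 16384 N lam^2 K^2 is minimal at lam = eps / (2 * 16384 * K), and 2
    * 16384 = 128 * 256. Replacing [eps] there by the minimum [m] of [eps] and 1 keeps [lam] in the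
    allowed range; since m^2 <= m eps, at least half of the linear term survives. *)
Lemma two_sided_tail (Z : T -> R) (K N : R) : measurable_fun setT Z -> 0 < K -> 0 <= N ->
  (forall lam, `|lam| <= (64 * K)^-1 ->
    (\int[P]_w (expR (lam * Z w))%:E <= (expR (16384 * N * lam ^+ 2 * K ^+ 2))%:E)%E) ->
  forall eps, 0 < eps ->
  (P [set w | (N * K * eps < `|Z w|)%R] <=
   (2 * expR (- ((256 * 256)^-1 * N * Num.min (eps ^+ 2) eps)))%:E)%E.
Proof.
move=> mZ K0 N0 mgf eps eps0.
pose m := Num.min eps 1; have m0 : 0 < m by rewrite lt_min eps0 ltr01.
have m1 : m <= 1 by rewrite ge_min lexx orbT.
have me : m <= eps by rewrite ge_min lexx.
have mE : Num.min (eps ^+ 2) eps = m * eps.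
  by rewrite /m expr2 minr_pMl ?ltW// mul1r.
pose lam := m / (128 * 256 * K).
have K64 : 0 < 64 * K by apply: mulr_gt0 => //; rewrite ltr0n.
have lamE : 128 * 256 * K = 512 * (64 * K) by ring.
have lam0 : 0 < lam.
  rewrite /lam lamE; apply: divr_gt0; first exact: m0.
  by apply: mulr_gt0; [rewrite ltr0n|exact: K64].
have lamle : lam <= (64 * K)^-1.
  rewrite /lam lamE invfM mulrA; apply: ler_piMl; first by rewrite invr_ge0 ltW.
  rewrite ler_pdivrMr ?ltr0n// mul1r; apply: le_trans m1 _; by rewrite ler1n.
have bound (s : R) : `|s| = lam -> (P [set w | (lam * (N * K * eps) < s * Z w)%R] <=
    (expR (- ((256 * 256)^-1 * N * (m * eps))))%:E)%E.
  move=> sl; apply: le_trans (exp_markov _ _ mZ) _.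
  apply: (@le_trans _ _ ((expR (- (lam * (N * K * eps))))%:E * (expR (16384 * N * lam ^+ 2 * K ^+ 2))%:E)%E).
    by apply: lee_pmul => //; rewrite ?lee_fin ?expR_ge0//; [
      apply: integral_ge0 => w _; rewrite lee_fin expR_ge0|
      have := mgf s; rewrite sl -(real_normK (num_real s)) sl; exact].
  rewrite -EFinM lee_fin -expRD ler_expR.
  have -> : lam * (N * K * eps) = N * (m * eps) / (128 * 256) by rewrite /lam; field; rewrite gt_eqF.
  have -> : 16384 * N * lam ^+ 2 * K ^+ 2 = N * (m * m) / (256 * 256) by rewrite /lam; field; rewrite gt_eqF.
  have : N * (m * m) <= N * (m * eps) by rewrite ler_wpM2l// ler_wpM2l// ltW.
  lra.
rewrite mE mulr_natl mulr2n EFinD.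
have p1 := bound lam (gtr0_norm lam0); have p2 := bound (- lam).
rewrite normrN in p2; have {}p2 := p2 (gtr0_norm lam0).
have ml (s : R) : measurable [set w | lam * (N * K * eps) < s * Z w].
  by apply: measurable_gt_set; exact: measurable_funM.
apply: le_trans (leeD p1 p2).
apply: le_trans (measureU2 _ (ml lam) (ml (- lam))).
apply: le_measure; rewrite ?inE.
- by apply: measurable_gt_set; exact: measurableT_comp.
- exact: measurableU.
- move=> w /=; rewrite lter_normr => /orP[h|h]; [left|right] => /=.
    by rewrite ltr_pM2l.
  by rewrite mulNr -mulrN ltr_pM2l.
Qed.

(** The thresholds of the theorem are extended reals; this lowers them to real ones, the event being
    empty at +oo. *)
Lemma ereal_event_le (g : T -> R) (e : \bar R) (r b : R) : measurable_fun setT g ->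
  (r%:E <= e)%E -> (P [set w | (r < g w)%R] <= b%:E)%E ->
  (P [set w | (e < (g w)%:E)%E] <= b%:E)%E.
Proof.
move=> mg re; apply: le_trans; apply: le_measure; rewrite ?inE.
- case: e re => [s|_|//] /=; last first.
    by rewrite (_ : [set _ | _] = set0)//; apply/seteqP; split => w //=; rewrite ltNge leey.
  by rewrite (_ : [set _ | _] = [set w | s < g w]) => [_|]; [exact: measurable_gt_set|
    apply/seteqP; split => w /=; rewrite lte_fin].
- exact: measurable_gt_set.
- by move=> w /= h; rewrite -lte_fin; exact: le_lt_trans h.
Qed.

End exponential_tails.

Section empirical_forms.
Context {R : realType}.
Variables (D1 D2 : set R).
Hypotheses (mD1 : @measurable _ (measurableTypeR R) D1)
           (mD2 : @measurable _ (measurableTypeR R) D2).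

(** The empirical kernel is an average of rank-one kernels, whose forms factorize by [kf_tensor].
    Times start at 1, hence [c.+1]. *)
Lemma empirical_form d (T : measurableType d) q p (X : int -> T -> fvec R q)
    (Y : int -> T -> fvec R p) (S : kmat R q p) (Phi : fvec R q) (Psi : fvec R p) (n h : nat) w :
  (forall t i, L2 D1 (X t w i)) -> (forall t j, L2 D2 (Y t w j)) ->
  (forall i j, L2ker D1 D2 (S i j)) -> (forall i, L2 D1 (Phi i)) -> (forall j, L2 D2 (Psi j)) ->
  kform D1 D2 Phi (fun i j u v => hatSigma X Y n h w i j u v - S i j u v) Psi =
  (n - h)%:R^-1 * (\sum_(c < n - h) vinner D1 Phi (X c.+1%:Z w) * vinner D2 Psi (Y (c.+1 + h)%:Z w))
    - kform D1 D2 Phi S Psi.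
Proof.
move=> sX sY sS sPhi sPsi.
pose Hk i j u v := (n - h)%:R^-1 * \sum_(c < n - h) X c.+1%:Z w i u * Y (c.+1 + h)%:Z w j v.
have sT i j (c : 'I_(n - h)) : L2ker D1 D2 (fun u v => X c.+1%:Z w i u * Y (c.+1 + h)%:Z w j v).
  exact: L2ker_tensor.
have sH i j : L2ker D1 D2 (Hk i j) by apply: L2kerZ => //; exact: L2ker_sum.
have -> : (fun i j u v => hatSigma X Y n h w i j u v - S i j u v) =
    (fun i j u v => Hk i j u v - S i j u v).
  apply/funext => i; apply/funext => j; apply/funext => u; apply/funext => v.
  by rewrite /hatSigma /Hk big_add1 big_mkord.
rewrite (kformE mD1 mD2 sPhi (fun i j => L2kerB mD1 mD2 (sH i j) (sS i j)) sPsi).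
rewrite (kformE mD1 mD2 sPhi sS sPsi) mulr_sumr.
transitivity (\sum_i \sum_j ((n - h)%:R^-1 * (\sum_(c < n - h)
    inner D1 (Phi i) (X c.+1%:Z w i) * inner D2 (Psi j) (Y (c.+1 + h)%:Z w j)) -
    kf D1 D2 (Phi i) (S i j) (Psi j))).
  apply: eq_bigr => i _; apply: eq_bigr => j _; rewrite kf_linearB// kf_linearZ//; last exact: L2ker_sum.
  congr (_ * _ - _); rewrite kf_linear_sum//; apply: eq_bigr => c _.
  by rewrite kf_tensor//; congr (_ * _); rewrite !inner_ip ipC.
under eq_bigr => i _ do rewrite sumrB; rewrite sumrB; congr (_ - _).
under eq_bigr => i _ do (under eq_bigr => j _ do rewrite mulr_sumr; rewrite exchange_big/=).
rewrite exchange_big/=; apply: eq_bigr => c _; rewrite /vinner mulr_suml mulr_sumr.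
by apply: eq_bigr => i _; rewrite -mulr_sumr; congr (_ * _); rewrite mulr_sumr.
Qed.

End empirical_forms.

(** * Possible values of the stability measures *)

Section stability_values.
Context d (T : measurableType d) {R : realType} (P : probability T R).
Local Notation ipP := (ip P setT).

(** The inner supremum is at least the nonnegative value at the given pair, and the interval has
    positive measure. *)
Lemma cross_stability_ge0 (D1 D2 : set R) p q (SX : kmat R p p) (SY : kmat R q q)
    (f : R -> ckmat R p q) (A1 : set (fvec R p)) (A2 : set (fvec R q)) Phi1 Phi2 :
  A1 Phi1 -> A2 Phi2 -> (0 <= cross_stability D1 D2 SX SY f A1 A2)%E.
Proof.
move=> h1 h2; have pi0 : 0 < pi :> R := pi_gt0 R.
apply: mule_ge0; first by rewrite lee_fin mulr_ge0// ltW.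
apply: ess_sup_gee.
  pose I : set R := `[- pi, pi]%classic.
  have : (0 < @lebesgue_measure R (setT `&` I))%E.
    rewrite setTI /I lebesgue_measure_itv/= lte_fin ifT; last by rewrite gtrN.
    by rewrite -EFinB lte_fin opprK addr_gt0.
  exact.
apply: nearW => t; apply: le_trans (ereal_sup_ubound _); last first.
  by exists (Phi1, Phi2); [split|reflexivity].
by rewrite lee_fin divr_ge0 ?mulr_ge0 ?sqrtr_ge0//; case: (ckform _ _ _ _ _) => a b; exact: sqrtr_ge0.
Qed.

Variables (D : set R) (HH : set (R -> R)).
Hypotheses (mD : @measurable _ (measurableTypeR R) D) (hH : hilbert_in_L2 D HH).
Variables (alpha : R) (p : nat) (A : nat -> kmat R p p) (e X : int -> T -> fvec R p).
Hypothesis slp : subgaussian_linear_process P D HH alpha A e X.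
Hypothesis mzX : forall t i, mean_zero P D (fun w => X t w i).
Hypothesis stX : cov_stationary P D D X X.
Variable f : R -> ckmat R p p.
Hypothesis spf : forall theta, theta \in `[- pi, pi] ->
  is_spectral_density D D (Sigma P X X) theta (f theta).
Variables (B : R) (Phi : fvec R p).
Hypothesis sumA : (\sum_(0 <= l <oo) (knorm_oo D (A l))%:E <= B%:E)%E.
Hypothesis hPhi : vecH HH Phi.
Variables (S : set (fvec R p)).
Hypothesis SPhi : S Phi.
Let q := kform D D Phi (Sigma P X X 0) Phi.
Hypothesis q0 : 0 < q.

(* [quadratic_bound] applied to the single variable X_0 reads q <= m * q. *)
Lemma stability_ge1 (m : R) : (stability D (Sigma P X X 0) f S <= m%:E)%E -> 1 <= m.
Proof.
move=> stM; rewrite -(ler_pM2r q0) mul1r.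
have kI : injective (fun _ : 'I_1 => 0%N) by move=> i j _; rewrite !ord1.
have := quadratic_bound mD hH slp mzX stX spf sumA hPhi SPhi stM q0 0 (fun _ => 1) kI.
rewrite big_ord1 expr1n mulr1; apply: le_trans.
have reX := process_random_element slp.
rewrite /q -(covariance_form mD hH mD hH reX mzX reX mzX stX 0 0 hPhi hPhi) addr0.
rewrite le_eqVlt; apply/orP; left; apply/eqP; congr ip; apply/funext => w;
  by rewrite big_ord1 mul1r; congr (vinner _ _ (X _ w)).
Qed.

(** The value -oo is excluded because it lies below 0, and [stability_ge1] would give 1 <= 0. *)
Lemma stability_cases : stability D (Sigma P X X 0) f S = +oo%E \/
  exists2 m, stability D (Sigma P X X 0) f S = m%:E & 1 <= m.
Proof.
have := stability_ge1; case: stability => [m|_|]; [|by left|].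
  by move=> h; right; exists m => //; exact: h.
by move=> /(_ 0 (leNye _)); rewrite ler10.
Qed.

End stability_values.

Lemma backward_lag (n c : nat) : (c <= n)%N -> n%:Z - (n - c)%N%:Z = c%:Z.
Proof. by lia. Qed.

Lemma backward_lag_inj (n c c' : nat) : (c < n)%N -> (c' < n)%N ->
  (n - c.+1)%N = (n - c'.+1)%N -> c = c'.
Proof. by lia. Qed.

(** * Tail bounds for sums of squares over a time window *)

Section pair_tail.
Context d (T : measurableType d) {R : realType} (P : probability T R).
Local Notation ipP := (ip P setT).
Variables (U V : set R) (HU HV : set (R -> R)).
Hypotheses (mU : @measurable _ (measurableTypeR R) U) (hU : hilbert_in_L2 U HU).
Hypotheses (mV : @measurable _ (measurableTypeR R) V) (hV : hilbert_in_L2 V HV).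
Variables (aX aY : R) (p q : nat) (AX : nat -> kmat R p p) (AY : nat -> kmat R q q).
Variables (eX X : int -> T -> fvec R p) (eY Y : int -> T -> fvec R q).
Hypothesis slX : subgaussian_linear_process P U HU aX AX eX X.
Hypothesis slY : subgaussian_linear_process P V HV aY AY eY Y.
Hypothesis ind : independent P (@borelH2 R U HU p V HV q) (fun t w => (eX t w, eY t w)).
Variables (BX BY KX KY : R) (Phi : fvec R p) (Psi : fvec R q).
Hypotheses (hPhi : vecH HU Phi) (hPsi : vecH HV Psi).
Hypothesis sumX : (\sum_(0 <= l <oo) (knorm_oo U (AX l))%:E <= BX%:E)%E.
Hypothesis sumY : (\sum_(0 <= l <oo) (knorm_oo V (AY l))%:E <= BY%:E)%E.
Let x t w := vinner U Phi (X t w).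
Let y t w := vinner V Psi (Y t w).
Hypothesis hKX : forall (C : finType) (k : C -> nat) top (u : C -> R), injective k ->
  ipP (fun w => \sum_c u c * x (top - (k c)%:Z) w) (fun w => \sum_c u c * x (top - (k c)%:Z) w) <=
  KX * \sum_c u c ^+ 2.
Hypothesis hKY : forall (C : finType) (k : C -> nat) top (u : C -> R), injective k ->
  ipP (fun w => \sum_c u c * y (top - (k c)%:Z) w) (fun w => \sum_c u c * y (top - (k c)%:Z) w) <=
  KY * \sum_c u c ^+ 2.
Hypothesis KXY : 0 < KX + KY.
Variables (N h : nat).
Hypothesis N0 : (0 < N)%N.

Let xy (c : 'I_N) w := x c.+1%:Z w + y (c.+1 + h)%:Z w.

Lemma pair_tail eps : 0 < eps ->
  (P [set w | (N%:R * (4 * (aX ^+ 2 + aY ^+ 2 + 1) * (KX + KY)) * eps <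
      `|\sum_c xy c w ^+ 2 - \sum_c ipP (xy c) (xy c)|)%R] <=
   (2 * expR (- ((256 * 256)^-1 * N%:R * Num.min (eps ^+ 2) eps)))%:E)%E.
Proof.
(* The 1 keeps [a2] positive when both parameters vanish. *)
move=> eps0; pose a2 := aX ^+ 2 + aY ^+ 2 + 1.
have aXa : aX ^+ 2 <= a2 by rewrite /a2; have := sqr_ge0 aY; lra.
have aYa : aY ^+ 2 <= a2 by rewrite /a2; have := sqr_ge0 aX; lra.
have a20 : 0 < a2 by rewrite /a2; have := sqr_ge0 aY; have := sqr_ge0 aX; lra.
have sxy c : sqint P setT (xy c).
  apply: sqintD => //; first exact: (process_functional_sqint mU hU slX).
  exact: (process_functional_sqint mV hV slY).
have mZ : measurable_fun setT (fun w => \sum_c xy c w ^+ 2 - \sum_c ipP (xy c) (xy c)).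
  apply: measurable_funB => //; apply: measurable_sum => c.
  by apply: measurable_funX; case: (sxy c).
have K0 : 0 < 4 * a2 * (KX + KY) by apply: mulr_gt0 => //; apply: mulr_gt0.
apply: (two_sided_tail mZ K0 (ler0n _ N)) => // lam lamK.
have [b [hb [bX laX]]] := linear_process_array mU hU slX hPhi sumX.
have [b' [hb' [bY laY]]] := linear_process_array mV hV slY hPsi sumY.
(* Both are lags behind the common time [N + h]; those of [x] exceed those of [y] by [h]. *)
pose kx (c : 'I_N) := (N + h - c.+1)%N; pose ky (c : 'I_N) := (N - c.+1)%N.
have cNh (c : 'I_N) : (c < N + h)%N by rewrite ltn_addr.
have kxI : injective kx by move=> c c' /backward_lag_inj E; apply/val_inj/E; exact: cNh.
have kyI : injective ky by move=> c c' /backward_lag_inj E; apply/val_inj/E; exact: ltn_ord.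
have kxE c : (N + h)%:Z - (kx c)%:Z = c.+1%:Z by apply: backward_lag; exact: cNh.
have kyE c : (N + h)%:Z - (ky c)%:Z = (c.+1 + h)%:Z.
  by rewrite /ky -(subnDr h) backward_lag// leq_add2r.
have cross l l' s s' : s != s' ->
    ipP (fun w => vinner U (b l) (eX s w)) (fun w => vinner V (b' l') (eY s' w)) = 0.
  move=> ss'; exact: (joint_error_orth mU hU mV hV slX slY ind (hb l) (hb' l') ss').
have C0 : (0 < #|'I_N|)%N by rewrite card_ord.
have bl (B C : finType) (tau : B -> int) (L : nat) (a a' : B -> C -> nat -> R) :
    injective tau ->
    blocks_independent P (fun i c w => \sum_(l < L) a i c l * vinner U (b l) (eX (tau i) w) +
                                       \sum_(l < L) a' i c l * vinner V (b' l) (eY (tau i) w)).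
  exact: (joint_blocks_independent mU hU mV hV slX slY ind L a a' hb hb').
have hX := fun u => hKX (N + h)%:Z u kxI.
have hY := fun u => hKY (N + h)%:Z u kyI.
have main := two_process_mgf laX laY cross bl aXa aYa a20 kxI kyI C0 hX hY KXY lamK.
pose mgf (F : 'I_N -> T -> R) := (\int[P]_w (expR (lam * (\sum_c F c w ^+ 2 -
    \sum_c ipP (F c) (F c))))%:E <=
  (expR (16384 * #|'I_N|%:R * lam ^+ 2 * (4 * a2 * (KX + KY)) ^+ 2))%:E)%E.
have {main} : mgf (fun c w => x ((N + h)%:Z - (kx c)%:Z) w + y ((N + h)%:Z - (ky c)%:Z) w).
  exact: main.
have -> : (fun c w => x ((N + h)%:Z - (kx c)%:Z) w + y ((N + h)%:Z - (ky c)%:Z) w) = xy.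
  by apply/funext => c; rewrite kxE kyE.
by rewrite /mgf card_ord.
Qed.

End pair_tail.

(** Since [a2 >= 1], dividing [eta] by [4 * a2] costs the minimum at most the factor 16 a2^2, and
    1024^2 = 256^2 * 16. The factor [m] compares the number [N] of terms with the sample size
    [n]. *)
Lemma rate_comparison (R : realFieldType) (a2 eta N n m : R) :
  1 <= a2 -> 0 < eta -> 0 <= N -> 0 < m -> n <= N * m ->
  - ((256 * 256)^-1 * N * Num.min ((eta / (4 * a2)) ^+ 2) (eta / (4 * a2))) <=
  - ((1024 * 1024) * a2 ^+ 2)^-1 / m * (n * Num.min (eta ^+ 2) eta).
Proof.
move=> a21 eta0 N0 m0 nN; have a20 : 0 < a2 by apply: lt_le_trans a21.
have a4 : 0 < 4 * a2 by apply: mulr_gt0 => //; rewrite ltr0n.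
set mu := Num.min (eta ^+ 2) eta.
have mu0 : 0 <= mu by rewrite le_min sqr_ge0 ltW.
have a16 : 0 < 16 * a2 ^+ 2 by apply: mulr_gt0; [rewrite ltr0n|rewrite exprn_gt0].
have le1 : mu / (16 * a2 ^+ 2) <= Num.min ((eta / (4 * a2)) ^+ 2) (eta / (4 * a2)).
  rewrite le_min; apply/andP; split.
    have -> : (eta / (4 * a2)) ^+ 2 = eta ^+ 2 / (16 * a2 ^+ 2) by field; rewrite gt_eqF.
    by rewrite ler_pM2r ?invr_gt0// ge_min lexx.
  apply: (@le_trans _ _ (eta / (16 * a2 ^+ 2))).
    by rewrite ler_pM2r ?invr_gt0// ge_min lexx orbT.
  apply: ler_wpM2l; first exact: ltW.
  rewrite lef_pV2 ?posrE//.
  have : a2 <= a2 ^+ 2 by rewrite expr2 ler_peMr// ltW.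
  lra.
rewrite !mulNr lerN2.
have -> : 1024 * 1024 * a2 ^+ 2 = 256 * 256 * (16 * a2 ^+ 2) by ring.
have k0 : 0 < 256 * 256 :> R by apply: mulr_gt0; rewrite ltr0n.
set k : R := 256 * 256 in k0 *; set w : R := 16 * a2 ^+ 2 in a16 le1 *.
set mn := Num.min _ (eta / (4 * a2)) in le1 *.
have kE : (256 * 256)^-1 = k^-1 :> R by [].
rewrite ?kE; clearbody k w mn.
have -> : (k * w)^-1 / m * (n * mu) = k^-1 * ((n / m) * (mu / w)) by rewrite invfM; ring.
have -> : k^-1 * N * mn = k^-1 * (N * mn) by rewrite mulrA.
apply: ler_wpM2l; first by rewrite invr_ge0 ltW.
have muw : 0 <= mu / w by apply: divr_ge0 => //; exact: ltW.
apply: (@le_trans _ _ (N * (mu / w))); last exact: ler_wpM2l.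
by apply: ler_wpM2r => //; rewrite ler_pdivrMr.
Qed.

Lemma event_le d (T : measurableType d) (R : realType) (P : probability T R)
    (g : T -> R) (e : \bar R) (r b : R) (A : set T) : measurable_fun setT g -> measurable A ->
  (r%:E <= e)%E -> (forall w, r < g w -> A w) -> (P A <= b%:E)%E ->
  (P [set w | (e < (g w)%:E)%E] <= b%:E)%E.
Proof.
move=> mg mA re gA PA; apply: (ereal_event_le mg re); apply: le_trans PA.
by apply: le_measure; rewrite ?inE//; exact: measurable_gt_set.
Qed.

(* The one-term sum makes [hilbert_sum] and [vinner_sum] apply directly. *)
Definition fscale (R : realType) p (a : R) (b : fvec R p) : fvec R p :=
  fun j x => \sum_(i <- [:: tt]) a * b j x.

Section scaled_pair_tail.
Context d (T : measurableType d) {R : realType} (P : probability T R).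
Local Notation ipP := (ip P setT).
Variables (U V : set R) (HU HV : set (R -> R)).
Hypotheses (mU : @measurable _ (measurableTypeR R) U) (hU : hilbert_in_L2 U HU).
Hypotheses (mV : @measurable _ (measurableTypeR R) V) (hV : hilbert_in_L2 V HV).
Variables (aX aY : R) (p q : nat) (AX : nat -> kmat R p p) (AY : nat -> kmat R q q).
Variables (eX X : int -> T -> fvec R p) (eY Y : int -> T -> fvec R q).
Hypothesis slX : subgaussian_linear_process P U HU aX AX eX X.
Hypothesis slY : subgaussian_linear_process P V HV aY AY eY Y.
Hypothesis ind : independent P (@borelH2 R U HU p V HV q) (fun t w => (eX t w, eY t w)).
Variables (BX BY KX KY : R) (Phi : fvec R p) (Psi : fvec R q).
Hypotheses (hPhi : vecH HU Phi) (hPsi : vecH HV Psi).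
Hypothesis sumX : (\sum_(0 <= l <oo) (knorm_oo U (AX l))%:E <= BX%:E)%E.
Hypothesis sumY : (\sum_(0 <= l <oo) (knorm_oo V (AY l))%:E <= BY%:E)%E.
Let x t w := vinner U Phi (X t w).
Let y t w := vinner V Psi (Y t w).
Hypothesis hKX : forall (C : finType) (k : C -> nat) top (u : C -> R), injective k ->
  ipP (fun w => \sum_c u c * x (top - (k c)%:Z) w) (fun w => \sum_c u c * x (top - (k c)%:Z) w) <=
  KX * \sum_c u c ^+ 2.
Hypothesis hKY : forall (C : finType) (k : C -> nat) top (u : C -> R), injective k ->
  ipP (fun w => \sum_c u c * y (top - (k c)%:Z) w) (fun w => \sum_c u c * y (top - (k c)%:Z) w) <=
  KY * \sum_c u c ^+ 2.
Hypotheses (KX0 : 0 < KX) (KY0 : 0 <= KY).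
Variables (N h : nat).
Hypothesis N0 : (0 < N)%N.

(** Scaling the functional [Psi] instead of the process keeps the hypotheses on [Y] intact and
    multiplies the variance bound by [a ^+ 2]. The value [a = 0] is allowed and isolates [x]. *)
Lemma scaled_pair_tail (a eps : R) : 0 < eps ->
  (P [set w | (N%:R * (4 * (aX ^+ 2 + aY ^+ 2 + 1) * (KX + a ^+ 2 * KY)) * eps <
      `|\sum_(c < N) (x c.+1%:Z w + a * y (c.+1 + h)%:Z w) ^+ 2 -
        \sum_(c < N) ipP (fun w => x c.+1%:Z w + a * y (c.+1 + h)%:Z w)
                         (fun w => x c.+1%:Z w + a * y (c.+1 + h)%:Z w)|)%R] <=
   (2 * expR (- ((256 * 256)^-1 * N%:R * Num.min (eps ^+ 2) eps)))%:E)%E.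
Proof.
move=> eps0.
have hPsi' : vecH HV (fscale a Psi) by move=> j; exact: (hilbert_sum hV _ _ (fun=> hPsi j)).
have E t w : vinner V (fscale a Psi) (Y t w) = a * y t w.
  rewrite /fscale (@vinner_sum _ V q mV unit [:: tt] (fun=> a) (fun=> Psi)) ?big_seq1//.
    by move=> _ j; exact: (vecH_L2 hV hPsi j).
  by move=> j; exact: (process_L2 hV slY).
have fE t : (fun w => vinner V (fscale a Psi) (Y t w)) = (fun w => a * y t w).
  by apply/funext => w; exact: E.
have hK (C : finType) (k : C -> nat) top (u : C -> R) : injective k ->
  ipP (fun w => \sum_c u c * vinner V (fscale a Psi) (Y (top - (k c)%:Z) w))
      (fun w => \sum_c u c * vinner V (fscale a Psi) (Y (top - (k c)%:Z) w)) <=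
  (a ^+ 2 * KY) * \sum_c u c ^+ 2.
  move=> kI; have := hKY top (fun c => u c * a) kI.
  have -> : (fun w => \sum_c u c * vinner V (fscale a Psi) (Y (top - (k c)%:Z) w)) =
      (fun w => \sum_c u c * a * y (top - (k c)%:Z) w).
    by apply/funext => w; apply: eq_bigr => c _; rewrite E mulrA.
  move=> h1; apply: le_trans h1 _; rewrite le_eqVlt; apply/orP; left; apply/eqP.
  under eq_bigr do rewrite exprMn; rewrite -mulr_suml; ring.
have KXY : 0 < KX + a ^+ 2 * KY by rewrite ltr_wpDr// mulr_ge0// sqr_ge0.
have main := pair_tail mU hU mV hV slX slY ind hPhi hPsi' sumX sumY hKX hK KXY h N0 eps0.
pose st (F : 'I_N -> T -> R) := (P [set w | (N%:R * (4 * (aX ^+ 2 + aY ^+ 2 + 1) * (KX + a ^+ 2 * KY)) * eps <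
      `|\sum_c F c w ^+ 2 - \sum_c ipP (F c) (F c)|)%R] <=
   (2 * expR (- ((256 * 256)^-1 * N%:R * Num.min (eps ^+ 2) eps)))%:E)%E.
have {main} : st (fun c w => x c.+1%:Z w + vinner V (fscale a Psi) (Y (c.+1 + h)%:Z w)) by exact: main.
have -> : (fun (c : 'I_N) w => x c.+1%:Z w + vinner V (fscale a Psi) (Y (c.+1 + h)%:Z w)) =
    (fun c w => x c.+1%:Z w + a * y (c.+1 + h)%:Z w).
  by apply/funext => c; apply/funext => w; rewrite E.
exact.
Qed.

End scaled_pair_tail.

(** * From sums of squares to estimation errors *)

Section deviation_bounds.
Context d (T : measurableType d) {R : realType} (P : probability T R).
Local Notation ipP := (ip P setT).

Lemma event_pinfty (g : T -> R) (b : R) : 0 <= b -> (P [set w | (+oo < (g w)%:E)%E] <= b%:E)%E.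
Proof.
move=> b0; rewrite (_ : [set _ | _] = set0) ?measure0 ?lee_fin//.
by apply/seteqP; split => w //=; rewrite ltNge leey.
Qed.

Variables (x y : int -> T -> R) (h : nat) (qX qY k : R).
Hypotheses (sx : forall t, sqint P setT (x t)) (sy : forall t, sqint P setT (y t)).
Hypothesis ixx : forall t, ipP (x t) (x t) = qX.
Hypothesis iyy : forall t, ipP (y t) (y t) = qY.
Hypothesis ixy : forall t : nat, ipP (x t%:Z) (y (t + h)%:Z) = k.
Variable N : nat.
Hypothesis N0 : (0 < N)%N.

Let Z (a : R) w : R := \sum_(c < N) (x c.+1%:Z w + a * y (c.+1 + h)%:Z w) ^+ 2 -
        \sum_(c < N) ipP (fun w => x c.+1%:Z w + a * y (c.+1 + h)%:Z w)
                         (fun w => x c.+1%:Z w + a * y (c.+1 + h)%:Z w).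

Lemma deviation_measurable a : measurable_fun setT (Z a).
Proof.
apply: measurable_funB => //; apply: measurable_sum => c.
apply: measurable_funX; have [] // := sqintD measurableT (sx c.+1%:Z) (sqintZ measurableT a (sy (c.+1 + h)%:Z)).
Qed.

Lemma deviationE a w : Z a w =
  \sum_(c < N) (x c.+1%:Z w + a * y (c.+1 + h)%:Z w) ^+ 2 - N%:R * (qX + 2 * a * k + a ^+ 2 * qY).
Proof.
congr (_ - _); rewrite -[in RHS](card_ord N) mulr_natl -sumr_const; apply: eq_bigr => c _.
have sa := sqintZ measurableT a (sy (c.+1 + h)%:Z).
have s := sqintD measurableT (sx c.+1%:Z) sa.
rewrite (ipDl measurableT (sx c.+1%:Z) sa s) !(ipDr measurableT (sx c.+1%:Z) sa)//.
rewrite !(ipZl measurableT)// !(ipZr measurableT)// ixx iyy (ipC _ _ (y _)) ixy; ring.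
Qed.

(** [Z 0] is N qX times the relative error of the variance, so the two thresholds correspond
    exactly. *)
Lemma variance_deviation (a2 eta m w0 : R) w : 0 < qX -> 0 < a2 ->
  m * eta < `|(N%:R^-1 * (\sum_(c < N) x c.+1%:Z w * x c.+1%:Z w) - qX) / qX| ->
  N%:R * (4 * a2 * (m * qX + 0 ^+ 2 * w0)) * (eta / (4 * a2)) < `|Z 0 w|.
Proof.
move=> q0 a20 lt; have Np : 0 < N%:R :> R by rewrite ltr0n.
have -> : Z 0 w = N%:R * qX * ((N%:R^-1 * (\sum_(c < N) x c.+1%:Z w * x c.+1%:Z w) - qX) / qX).
  rewrite deviationE (eq_bigr (fun c : 'I_N => x c.+1%:Z w * x c.+1%:Z w)); last first.
    by move=> c _; rewrite mul0r addr0 expr2.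
  by field; rewrite !gt_eqF.
rewrite normrM gtr0_norm ?mulr_gt0//.
have -> : N%:R * (4 * a2 * (m * qX + 0 ^+ 2 * w0)) * (eta / (4 * a2)) = N%:R * qX * (m * eta).
  by field; rewrite gt_eqF.
by rewrite ltr_pM2l// mulr_gt0.
Qed.

(** Polarization: [Z 1 - Z (-1)] is 4 N times the error [F], so the two deviations cannot both be
    small. The normalizations fit because mX qX + mY qY <= (mX + mY) (qX + qY). *)
Lemma cross_deviation (a2 eta mX mY : R) w : 0 < qX -> 0 < qY -> 0 < a2 -> 0 < eta -> 0 <= mX -> 0 <= mY ->
  (mX + mY) * eta < `|(N%:R^-1 * (\sum_(c < N) x c.+1%:Z w * y (c.+1 + h)%:Z w) - k) / (qX + qY)| ->
  N%:R * (4 * a2 * (mX * qX + 1 ^+ 2 * (mY * qY))) * (eta / (4 * a2)) < `|Z 1 w| \/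
  N%:R * (4 * a2 * (mX * qX + (-1) ^+ 2 * (mY * qY))) * (eta / (4 * a2)) < `|Z (-1) w|.
Proof.
move=> qX0 qY0 a20 eta0 mX0 mY0 lt; have Np : 0 < N%:R :> R by rewrite ltr0n.
have q0 : 0 < qX + qY by exact: addr_gt0.
set F := N%:R^-1 * _ - k in lt.
have ZE : Z 1 w - Z (-1) w = 4 * (N%:R * F).
  rewrite !deviationE /F.
  have -> : \sum_(c < N) (x c.+1%:Z w + 1 * y (c.+1 + h)%:Z w) ^+ 2 =
     \sum_(c < N) (x c.+1%:Z w + -1 * y (c.+1 + h)%:Z w) ^+ 2 +
     4 * \sum_(c < N) x c.+1%:Z w * y (c.+1 + h)%:Z w.
    by rewrite mulr_sumr -big_split; apply: eq_bigr => c _ /=; ring.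
  by field; rewrite gt_eqF.
set s := N%:R * (mX * qX + mY * qY) * eta.
have -> : N%:R * (4 * a2 * (mX * qX + 1 ^+ 2 * (mY * qY))) * (eta / (4 * a2)) = s.
  by rewrite /s; field; rewrite gt_eqF.
have -> : N%:R * (4 * a2 * (mX * qX + (-1) ^+ 2 * (mY * qY))) * (eta / (4 * a2)) = s.
  by rewrite /s; field; rewrite gt_eqF.
have s0 : 0 <= s.
  apply: mulr_ge0; last exact: ltW.
  by apply: mulr_ge0; [exact: ltW|apply: addr_ge0; apply: mulr_ge0 => //; exact: ltW].
have sF : s < N%:R * `|F|.
  rewrite /s -mulrA ltr_pM2l//; move: lt; rewrite normrM normfV (gtr0_norm q0) ltr_pdivlMr//.
  apply: le_lt_trans; rewrite mulrAC ler_pM2r//.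
  have h1 : 0 <= mX * qY by rewrite mulr_ge0// ltW.
  have h2 : 0 <= mY * qX by rewrite mulr_ge0// ltW.
  by rewrite mulrDl !mulrDr; lra.
case: (ltP s `|Z 1 w|) => [|l1]; first by left.
case: (ltP s `|Z (-1) w|) => [|l2]; first by right.
have : `|Z 1 w - Z (-1) w| <= s + s by apply: le_trans (ler_normB _ _) _; exact: lerD.
rewrite ZE normrM ger0_norm ?ler0n// normrM (gtr0_norm Np); lra.
Qed.

End deviation_bounds.

Theorem theorem1 (R : realType) (aU bU aV bV : R) (hU : aU < bU) (hV : aV < bV)
    (HU HV : set (R -> R)) :
  let U : set R := `[aU, bU]%classic in
  let V : set R := `[aV, bV]%classic in
  hilbert_in_L2 U HU -> hilbert_in_L2 V HV ->
  forall (h : nat) (alphaX alphaY : R), 0 <= alphaX -> 0 <= alphaY ->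
  forall BX BY omegaX omegaY : R,
  exists c c1 c2 : R, [/\ 0 < c, 0 < c1, 0 < c2 &
  forall (disp : measure_display) (Omega : measurableType disp) (P : probability Omega R)
    (p d : nat)
    (AX : nat -> kmat R p p) (epsX X : int -> Omega -> fvec R p)
    (AY : nat -> kmat R d d) (epsY Y : int -> Omega -> fvec R d)
    (fX : R -> ckmat R p p) (fY : R -> ckmat R d d) (fXY : R -> ckmat R p d),
  let SX := Sigma P X X in
  let SY := Sigma P Y Y in
  let SXY := Sigma P X Y in
  let MX := stability U (SX 0) fX in
  let MY := stability V (SY 0) fY in
  let MXY := cross_stability U V (SX 0) (SY 0) fXY in
  let HX := H0 U HU (SX 0) in
  let HY := H0 V HV (SY 0) in
  let HXk := H0k U HU (SX 0) in
  let HYk := H0k V HV (SY 0) in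
  subgaussian_linear_process P U HU alphaX AX epsX X ->
  subgaussian_linear_process P V HV alphaY AY epsY Y ->
  independent P (@borelH2 R U HU p V HV d) (fun t w => (epsX t w, epsY t w)) ->
  mean_zero_jointly_stationary P U V X Y ->
  (forall theta, theta \in `[- pi, pi] -> is_spectral_density U U SX theta (fX theta)) ->
  (forall theta, theta \in `[- pi, pi] -> is_spectral_density V V SY theta (fY theta)) ->
  (MX HX < +oo)%E -> (MY HY < +oo)%E ->
  (forall theta, theta \in `[- pi, pi] -> is_spectral_density U V SXY theta (fXY theta)) ->
  (MXY HX HY < +oo)%E ->
  (\sum_(0 <= l <oo) (knorm_oo U (AX l))%:E <= BX%:E)%E ->
  (\sum_(0 <= l <oo) (knorm_oo V (AY l))%:E <= BY%:E)%E ->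
  error_condition P U epsX omegaX ->
  error_condition P V epsY omegaY ->
  forall k1 k2 : nat, (1 <= k1 <= p)%N -> (1 <= k2 <= d)%N ->
  forall (Phi1 : fvec R p) (Phi2 : fvec R d),
  HX Phi1 -> HY Phi2 -> (l0norm U Phi1 <= k1)%N -> (l0norm V Phi2 <= k2)%N ->
  forall (n : nat) (eta : R), 0 < eta ->
    let rate := n%:R * Num.min (eta ^+ 2) eta in
    let DX w : kmat R p p := fun i j u v => hatSigma X X n 0 w i j u v - SX 0 i j u v in
    let DXY w : kmat R p d := fun i j u v => hatSigma X Y n h w i j u v - SXY h%:Z i j u v in
    let qX := kform U U Phi1 (SX 0) Phi1 in
    let qY := kform V V Phi2 (SY 0) Phi2 in
    ((0 < n)%N ->
      (P [set w | MX (HXk k1) * eta%:E < `|kform U U Phi1 (DX w) Phi1 / qX|%:E]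
         <= (2 * expR (- c * rate))%:E)%E) /\
    ((h < n)%N ->
      (P [set w | (MX (HXk k1) + MY (HYk k2) + MXY (HXk k1) (HYk k2)) * eta%:E
                    < `|kform U V Phi1 (DXY w) Phi2 / (qX + qY)|%:E]
         <= (c1 * expR (- c2 * rate))%:E)%E)].
Proof.
move=> U V hU' hV' h alphaX alphaY alphaX0 alphaY0 BX BY omegaX omegaY.
pose a2 := alphaX ^+ 2 + alphaY ^+ 2 + 1.
have a21 : 1 <= a2 by rewrite /a2; have := sqr_ge0 alphaX; have := sqr_ge0 alphaY; lra.
have a20 : 0 < a2 by exact: lt_le_trans a21.
(* The constant 256^2 of [two_sided_tail] times the loss 16 a2^2 of [rate_comparison]. *)
pose c0 := (1024 * 1024 * a2 ^+ 2)^-1.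
have c00 : 0 < c0.
  rewrite invr_gt0; apply: mulr_gt0; last exact: exprn_gt0.
  by apply: mulr_gt0; rewrite ltr0n.
have h1 : 0 < h.+1%:R :> R by rewrite ltr0n.
(* 4 adds the two tails with constant 2, for [a = 1] and [a = -1]; [h.+1] comes from n <= (n - h) (h
   + 1). *)
exists c0, 4, (c0 / h.+1%:R); split; [exact: c00|by rewrite ltr0n|exact: divr_gt0|].
move=> disp Omega P p d AX epsX X AY epsY Y fX fY fXY SX SY SXY MX MY MXY HX HY HXk HYk.
move=> slX slY ind [mzX mzY stX stY stXY] spX spY finX finY spXY finXY sumX sumY _ _.
move=> k1 k2 _ _ Phi1 Phi2 HPhi1 HPhi2 l1 l2 n eta eta0 rate DX DXY qX qY.
have mU : @measurable _ (measurableTypeR R) U by exact: measurable_itv.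
have mV : @measurable _ (measurableTypeR R) V by exact: measurable_itv.
have [hPhi1 qX0] := HPhi1; have [hPhi2 qY0] := HPhi2.
have H1k : HXk k1 Phi1 by [].
have H2k : HYk k2 Phi2 by [].
have reX := process_random_element slX; have reY := process_random_element slY.
pose x t w := vinner U Phi1 (X t w); pose y t w := vinner V Phi2 (Y t w).
have sx t : sqint P setT (x t) by exact: (process_functional_sqint mU hU' slX t hPhi1).
have sy t : sqint P setT (y t) by exact: (process_functional_sqint mV hV' slY t hPhi2).
have ixx t : ip P setT (x t) (x t) = qX.
  by rewrite -{2}[t]addr0; exact: (covariance_form mU hU' mU hU' reX mzX reX mzX stX).
have iyy t : ip P setT (y t) (y t) = qY.
  by rewrite -{2}[t]addr0; exact: (covariance_form mV hV' mV hV' reY mzY reY mzY stY).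
pose kXY := kform U V Phi1 (SXY h%:Z) Phi2.
have ixyg (g t : nat) : ip P setT (x t%:Z) (y (t + g)%:Z) = kform U V Phi1 (SXY g%:Z) Phi2.
  by rewrite PoszD; exact: (covariance_form mU hU' mV hV' reX mzX reY mzY stXY).
have sPhi1 := vecH_L2 hU' hPhi1; have sPhi2 := vecH_L2 hV' hPhi2.
have sXt w t i : L2 U (X t w i) by exact: (process_L2 hU' slX).
have sYt w t i : L2 V (Y t w i) by exact: (process_L2 hV' slY).
have sSX := Sigma_L2 mU hU' mU hU' reX mzX reX mzX.
have sSXY := Sigma_L2 mU hU' mV hV' reX mzX reY mzY.
have bX (S : set (fvec R p)) (m : R) (SPhi : S Phi1) (E : MX S = m%:E) (C : finType)
    (k : C -> nat) top (u : C -> R) (kI : injective k) :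
    ip P setT (fun w => \sum_c u c * x (top - (k c)%:Z) w) (fun w => \sum_c u c * x (top - (k c)%:Z) w) <=
    m * qX * \sum_c u c ^+ 2.
  have le : (MX S <= m%:E)%E by rewrite E.
  exact: (quadratic_bound mU hU' slX mzX stX spX sumX hPhi1 SPhi le qX0 top u kI).
have bY (S : set (fvec R d)) (m : R) (SPhi : S Phi2) (E : MY S = m%:E) (C : finType)
    (k : C -> nat) top (u : C -> R) (kI : injective k) :
    ip P setT (fun w => \sum_c u c * y (top - (k c)%:Z) w) (fun w => \sum_c u c * y (top - (k c)%:Z) w) <=
    m * qY * \sum_c u c ^+ 2.
  have le : (MY S <= m%:E)%E by rewrite E.
  exact: (quadratic_bound mV hV' slY mzY stY spY sumY hPhi2 SPhi le qY0 top u kI).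
have a4 : 0 < 4 * a2 by apply: mulr_gt0 => //; rewrite ltr0n.
(* This value cancels the factor [4 * a2] in the thresholds of [scaled_pair_tail]. *)
have eps0 : 0 < eta / (4 * a2) by exact: divr_gt0.
have casesX : MX (HXk k1) = +oo%E \/ exists2 m, MX (HXk k1) = m%:E & 1 <= m.
  exact: (stability_cases mU hU' slX mzX stX spX sumX hPhi1 H1k qX0).
have casesY : MY (HYk k2) = +oo%E \/ exists2 m, MY (HYk k2) = m%:E & 1 <= m.
  exact: (stability_cases mV hV' slY mzY stY spY sumY hPhi2 H2k qY0).
have casesY' : MY HY = +oo%E \/ exists2 m, MY HY = m%:E & 1 <= m.
  exact: (stability_cases mV hV' slY mzY stY spY sumY hPhi2 HPhi2 qY0).
have expR0' (r : R) (s : R) : 0 <= s -> 0 <= s * expR r by move=> s0; rewrite mulr_ge0// expR_ge0.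
have ge02 : 0 <= 2 :> R by rewrite ler0n.
have ge04 : 0 <= 4 :> R by rewrite ler0n.
split=> hn.
  have E w : kform U U Phi1 (DX w) Phi1 = n%:R^-1 * (\sum_(c < n) x c.+1%:Z w * x c.+1%:Z w) - qX.
    rewrite (empirical_form mU mU n 0 (sXt w) (sXt w) (sSX 0) sPhi1 sPhi1) subn0.
    by congr (_ * _ - _); apply: eq_bigr => c _; rewrite addn0.
  have gE : (fun w => `|kform U U Phi1 (DX w) Phi1 / qX|) =
      (fun w => `|(n%:R^-1 * (\sum_(c < n) x c.+1%:Z w * x c.+1%:Z w) - qX) / qX|).
    by apply/funext => w; rewrite E.
  case: casesX => [->|[m Em m1]].
    by rewrite gt0_mulye ?lte_fin//; apply: event_pinfty; exact: expR0'.
  (* [scaled_pair_tail] takes a real variance bound for [y] also at [a = 0]; the finite stability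
     measure over [H0] supplies it. *)
  case: casesY' => [EY|[mY EmY mY1]]; first by move: finY; rewrite EY.
  have m0 : 0 < m by exact: lt_le_trans m1.
  have KX0 : 0 < m * qX by exact: mulr_gt0.
  have KY0 : 0 <= mY * qY by apply: mulr_ge0; [exact: le_trans mY1|exact: ltW].
  have tail := scaled_pair_tail mU hU' mV hV' slX slY ind hPhi1 hPhi2 sumX sumY
    (bX _ _ H1k Em) (bY _ _ HPhi2 EmY) KX0 KY0 0 hn 0 eps0.
  have mg : measurable_fun setT (fun w => `|kform U U Phi1 (DX w) Phi1 / qX|).
    rewrite gE; apply: measurableT_comp => //; apply: measurable_funM => //.
    apply: measurable_funB => //; apply: measurable_funM => //; apply: measurable_sum => c.
    by apply: measurable_funM; case: (sx c.+1%:Z).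
  have mA := measurable_gt_set (n%:R * (4 * a2 * (m * qX + 0 ^+ 2 * (mY * qY))) * (eta / (4 * a2)))
    (measurableT_comp (@normr_measurable R setT) (deviation_measurable 0%N sx sy n 0)).
  apply: (event_le (r := m * eta) mg mA).
  - by rewrite Em EFinM.
  - move=> w; rewrite E => lt.
    exact: (variance_deviation sx sy ixx iyy (ixyg 0%N) hn (mY * qY) qX0 a20 lt).
  apply: le_trans tail _; rewrite lee_fin ler_pM2l ?ltr0n// ler_expR.
  have := rate_comparison (m := 1) (n := n%:R) a21 eta0 (ler0n R n) ltr01.
  by rewrite mulr1 divr1 => /(_ (lexx _)).
have N0 : (0 < n - h)%N by rewrite subn_gt0.
have E w : kform U V Phi1 (DXY w) Phi2 =
    (n - h)%:R^-1 * (\sum_(c < n - h) x c.+1%:Z w * y (c.+1 + h)%:Z w) - kXY.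
  exact: (empirical_form mU mV n h (sXt w) (sYt w) (sSXY h%:Z) sPhi1 sPhi2).
have gE : (fun w => `|kform U V Phi1 (DXY w) Phi2 / (qX + qY)|) =
    (fun w => `|((n - h)%:R^-1 * (\sum_(c < n - h) x c.+1%:Z w * y (c.+1 + h)%:Z w) - kXY) / (qX + qY)|).
  by apply/funext => w; rewrite E.
have MXY0 : (0 <= MXY (HXk k1) (HYk k2))%E by exact: (cross_stability_ge0 _ _ _ _ _ H1k H2k).
(* An infinite threshold is never exceeded; [MXY0] rules out that the last term is -oo and spoils
   the sum. *)
have pinf : ((MX (HXk k1) + MY (HYk k2))%E = +oo)%E ->
    (P [set w | (MX (HXk k1) + MY (HYk k2) + MXY (HXk k1) (HYk k2)) * eta%:E
        < `|kform U V Phi1 (DXY w) Phi2 / (qX + qY)|%:E]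
     <= (4 * expR (- (c0 / h.+1%:R) * rate))%:E)%E.
  move=> ->; rewrite addye; last by apply: contraTneq MXY0 => ->.
  by rewrite gt0_mulye ?lte_fin//; apply: event_pinfty; exact: expR0'.
case: casesX => [EX|[mX EX mX1]].
  by apply: pinf; rewrite EX addye//; case: casesY => [->|[? ->]].
case: casesY => [EY|[mY EY mY1]]; first by apply: pinf; rewrite EX EY.
have mX0 : 0 <= mX by exact: le_trans mX1.
have mY0 : 0 <= mY by exact: le_trans mY1.
have KX0 : 0 < mX * qX by apply: mulr_gt0 => //; exact: lt_le_trans mX1.
have KY0 : 0 <= mY * qY by apply: mulr_ge0 => //; exact: ltW.
have tail a := scaled_pair_tail mU hU' mV hV' slX slY ind hPhi1 hPhi2 sumX sumY
  (bX _ _ H1k EX) (bY _ _ H2k EY) KX0 KY0 h N0 a eps0.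
have mg : measurable_fun setT (fun w => `|kform U V Phi1 (DXY w) Phi2 / (qX + qY)|).
  rewrite gE; apply: measurableT_comp => //; apply: measurable_funM => //.
  apply: measurable_funB => //; apply: measurable_funM => //; apply: measurable_sum => c.
  by apply: measurable_funM; [case: (sx c.+1%:Z)|case: (sy (c.+1 + h)%:Z)].
have mA a := measurable_gt_set ((n - h)%:R * (4 * a2 * (mX * qX + a ^+ 2 * (mY * qY))) * (eta / (4 * a2)))
  (measurableT_comp (@normr_measurable R setT) (deviation_measurable h sx sy (n - h)%N a)).
apply: (event_le (r := (mX + mY) * eta) mg (measurableU _ _ (mA 1) (mA (-1)))).
(* The cross stability measure is nonnegative, so the threshold is at least [(mX + mY) * eta]. *)
- rewrite EX EY EFinM EFinD; apply: lee_wpmul2r; first by rewrite lee_fin ltW.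
  exact: leeDl.
- move=> w; rewrite E => lt.
  exact: (cross_deviation sx sy ixx iyy (ixyg h) N0 qX0 qY0 a20 eta0 mX0 mY0 lt).
apply: le_trans (measureU2 _ (mA 1) (mA (-1))) _.
apply: le_trans (leeD (tail 1) (tail (-1))) _.
(* As n - h >= 1, h is at most (n - h) h. *)
have nN : n%:R <= (n - h)%:R * h.+1%:R :> R.
  by rewrite -natrM ler_nat mulnS -{1}(subnK (ltnW hn)) leq_add2l leq_pmull.
have le := rate_comparison a21 eta0 (ler0n R (n - h)) h1 nN.
have {}le : expR (- ((256 * 256)^-1 * (n - h)%:R * Num.min ((eta / (4 * a2)) ^+ 2) (eta / (4 * a2))))
    <= expR (- (c0 / h.+1%:R) * rate) by rewrite ler_expR; move: le; rewrite mulNr.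
rewrite -EFinD lee_fin; lra.
Qed.
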